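(* Let $E=[0,\infty)$, $\bar E=[0,\infty]$, and let $(X_t,t\geq 0)$ be a non-explosive Markov process with state space $E$, with no negative jumps, with semigroup $(P_t)_{t\geq 0}$ satisfying (i) for every $f\in C_b(E)$ and $t\geq 0$, $P_tf\in C_b(E)$; (ii) for every $f\in C_b(E)$ and $x\in E$, $P_tf(x)\to f(x)$ as $t\to 0$. Assume moreover the entrance boundary condition $$\forall t>0,\quad \lim_{b\to\infty}\liminf_{x\to\infty}\mathbb{P}_x(T_b\leq t)=1,$$ where $T_b:=\inf\{t\geq 0: X_t<b\}$ (with $\inf\emptyset=\infty$). Then $(X_t,t\geq 0)$ can be extended into a Feller process on $\bar E$ such that, under the law $\mathbb{P}_\infty$ of the extended process started from $\infty$, it starts from $\infty$, leaves it instantaneously and stays finite almost surely: $$\mathbb{P}_\infty(X_0=\infty)=1\quad\text{and}\quad \mathbb{P}_\infty(\forall t>0,\ X_t<\infty)=1.$$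
   Context: $C_b(E)$ is the space of bounded continuous functions on $E$, and $C(\bar E)$ is the space of continuous functions on $\bar E$ (i.e. functions in $C_b(E)$ having a finite limit at $\infty$). $\mathbb{P}_x$ denotes the law of the process started from $x$. A process is called Feller on $\bar E$ if its semigroup maps $C(\bar E)$ into $C(\bar E)$ and $P_tf(x)\to f(x)$ as $t\to0$ for every $f\in C(\bar E)$ and every $x\in\bar E$. *)

(* Defs.v *)
From HB Require Import structures.
From mathcomp Require Import all_boot all_order all_algebra.
From mathcomp Require Import all_classical all_reals all_analysis measurable_realfun.
Set Implicit Arguments. Unset Strict Implicit. Unset Printing Implicit Defensive.
Import Order.TTheory GRing.Theory Num.Theory.
Import numFieldNormedType.Exports.
Local Open Scope classical_set_scope.
Local Open Scope ring_scope.

Section Defs.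
Context {R : realType}.

Definition Eset : set R := [set x | 0 <= x].
Definition Ebarset : set (\bar R) := [set x | (0 <= x)%E].

(* C_b(E): bounded continuous functions on E (values off E are irrelevant). *)
Definition CbE (f : R -> R) : Prop :=
  {within Eset, continuous f} /\ exists M : R, forall x, Eset x -> `|f x| <= M.

(* C(Ebar): continuous functions on the compact space Ebar = [0,+oo]
   (i.e. functions in C_b(E) with a finite limit at oo). *)
Definition CEbar (g : \bar R -> R) : Prop := {within Ebarset, continuous g}.

Context {d : measure_display} {Omega : measurableType d} {S : Type}.

Definition semigroup (P : S -> probability Omega R) (X : R -> Omega -> S)
  (t : R) (f : S -> R) (x : S) : R :=
  fine (\int[P x]_w (f (X t w))%:E)%E.

Fixpoint iter_sg (Pt : R -> (S -> R) -> S -> R) (s : seq (R * (S -> R)))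
  : S -> R :=
  match s with
  | [::] => fun _ => 1
  | (dt, f) :: s' => Pt dt (fun y => f y * iter_sg Pt s' y)
  end.

Fixpoint fdd_prod (X : R -> Omega -> S) (s : seq (R * (S -> R))) (t0 : R)
  (w : Omega) : R :=
  match s with
  | [::] => 1
  | (dt, f) :: s' => f (X (t0 + dt) w) * fdd_prod X s' (t0 + dt) w
  end.

(* Time-homogeneous Markov property (finite-dimensional form, w.r.t. the
   natural filtration): for x in the state space, 0 <= t1 <= ... <= tn and
   test functions f_k,
   E_x[f1(X_{t1}) ... fn(X_{tn})] = P_{t1}(f1 P_{t2-t1}(f2 ... P_{tn-t_{n-1}} fn))(x). *)
Definition markov_fdd (dom : set S) (test : set (S -> R))
  (P : S -> probability Omega R) (X : R -> Omega -> S) : Prop :=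
  forall x, dom x -> forall s : seq (R * (S -> R)),
    (forall p, p \in s -> 0 <= p.1 /\ test p.2) ->
    fine (\int[P x]_w (fdd_prod X s 0 w)%:E)%E = iter_sg (semigroup P X) s x.

End Defs.

Section Paths.
Context {R : realType} {T : topologicalType}.

Definition cadlag (p : R -> T) : Prop :=
  (forall t, 0 <= t -> p x @[x --> t^'+] --> p t) /\
  (forall t, 0 < t -> exists l : T, p x @[x --> t^'-] --> l).
End Paths.

Section Hitting.
Context {R : realType} {d : measure_display} {Omega : measurableType d}.

Definition hit_below (X : R -> Omega -> R) (b : R) (w : Omega) : \bar R :=
  ereal_inf [set t%:E | t in [set t : R | 0 <= t /\ X t w < b]].

Definition no_neg_jumps (p : R -> R) : Prop :=
  forall t, 0 < t -> forall l, p x @[x --> t^'-] --> l -> l <= p t.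
End Hitting.

(* Main.v *)
Require Import Defs.
From HB Require Import structures.
From mathcomp Require Import all_boot all_order all_algebra.
From mathcomp Require Import all_classical all_reals all_analysis measurable_realfun.
From mathcomp Require Import lra zify.
Set Implicit Arguments. Unset Strict Implicit. Unset Printing Implicit Defensive.
Import Order.TTheory GRing.Theory Num.Theory.
Import numFieldNormedType.Exports.
Local Open Scope classical_set_scope.
Local Open Scope ring_scope.

(** Let [x_0 < x_1 < ...] tend to infinity. Without negative jumps, a path started
    from [x_(k+1)] is exactly at [x_k] when it first passes below [x_k], and by the
    strong Markov property it continues from there as an independent copy of [X]
    started from [x_k]. The process coming down from infinity is therefore built
    from independent copies of [X] started from all the [x_k]: the copy started
    from [x_(k+1)] is run until it passes below [x_k], then the next one takes
    over. The entrance condition makes the total duration of the descent from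
    infinity finite, so the concatenated paths [Zp N], which have the law of [X]
    under [P (x_N)], converge pointwise as [N] grows to a cadlag path [Yp] which
    starts from infinity and is finite at positive times. Its finite-dimensional
    laws are thus limits of those of [X]. Since the sequence is arbitrary,
    [P_t g(x)] has a limit as [x] tends to infinity for every [g] in [C(Ebar)]:
    this is the Feller property, and the Markov property at infinity follows by
    passing to the limit. *)

(** * Path spaces and image measures *)

(** The Markov property is given at fixed times. At the passage below [b] it is obtained by
    approaching the passage time strictly from above through grid times: right-continuity carries
    the path to the limit and (i) carries the iterated semigroup. There the path sits exactly at
    [b], so the law of the future is one fixed law and the future is independent of the past. The
    delicate point is to turn this independence into an equality of laws for concatenated paths: a
    path is only a point of a product over all real times, and for the product sigma-algebra the
    joint evaluation of a path at a time is not measurable. Past and future are therefore recombined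
    on a grid, and the mesh tends to zero afterwards. The duration of the descent is controlled
    without moments. The path from [x_M] stays above [x_N] for the sum of the passage durations
    between these levels, so the entrance condition bounds the law of this sum uniformly in [M], and
    monotonicity in [M] passes the bound to the infinite sum. *)

Definition coord_gen (I : Type) (d : measure_display) (T : measurableType d) :
    set (set (I -> T)) :=
  [set A | exists i B, measurable B /\ A = [set p | B (p i)]].

Notation pathType I T := (g_sigma_algebraType (@coord_gen I _ T)).

Section path_space.
Context {I : Type} {d : measure_display} {T : measurableType d}.
Let PT : measurableType _ := pathType I T.

Lemma measurable_coord (i : I) : measurable_fun [set: PT] (fun p : PT => p i).
Proof.
move=> _ B mB; rewrite setTI; apply: sub_sigma_algebra.
by exists i, B.
Qed.

Lemma measurable_fun_path (d' : measure_display) (S : measurableType d')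
    (f : S -> PT) :
  (forall i, measurable_fun setT (fun s => f s i)) -> measurable_fun setT f.
Proof.
move=> mf; apply: (@measurability _ _ _ PT setT f (@coord_gen I d T)) => //.
by move=> _ [_ [i [B [mB ->]]] <-]; exact: mf.
Qed.

End path_space.

Section mkprob.
Context {d : measure_display} {T : measurableType d} {R : realType}.

(** An alias used as key for the measure and probability structures, so that any measure of total
    mass one can be packed as a probability. *)
Definition copym (m : {measure set T -> \bar R}) : set T -> \bar R := m.

HB.instance Definition _ (m : {measure set T -> \bar R}) :=
  isMeasure.Build d T R (copym m) (measure0 m) (measure_ge0 m)
    (@measure_semi_sigma_additive _ _ _ m).

Definition mkprob (m : {measure set T -> \bar R}) (m1 : m setT = 1%E) :
    probability T R :=
  HB.pack (copym m) (Measure_isProbability.Build d T R (copym m) m1).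

End mkprob.

Section pushforward_packed.
Context {d d' : measure_display} {T1 : measurableType d}
  {T2 : measurableType d'} {R : realType} (f : T1 -> T2).
Hypothesis mf : measurable_fun setT f.

(** The image measure bundled with its measurability proof, kept transparent so that [pushmE] holds
    by computation. *)
Definition pushm (m : {measure set T1 -> \bar R}) :
  {measure set T2 -> \bar R}.
Proof.
refine [the {measure set T2 -> \bar R} of pushforward m f]; exact: mf.
Defined.

Lemma pushmE m A : pushm m A = m (f @^-1` A). Proof. by []. Qed.

Lemma ge0_integral_pushm m (g : T2 -> \bar R) :
  measurable_fun setT g -> (forall y, 0 <= g y)%E ->
  (\int[pushm m]_y g y = \int[m]_x g (f x))%E.
Proof.
move=> mg g0.
by rewrite -[LHS]/(integral (pushforward m f) setT g) ge0_integral_pushforward//.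
Qed.

Definition pushp (m : probability T1 R) : probability T2 R :=
  mkprob (probability_setT m : pushm m setT = 1%E).

Lemma integral_pushp (m : probability T1 R) (g : T2 -> \bar R) :
  measurable_fun setT g -> m.-integrable setT (g \o f) ->
  (\int[pushp m]_y g y = \int[m]_x g (f x))%E.
Proof.
move=> mg ig.
by rewrite -[LHS]/(integral (pushforward m f) setT g) integral_pushforward.
Qed.

End pushforward_packed.

(** * Countable products of probability spaces *)

Section infinite_product.
Local Open Scope ereal_scope.
Context {d : measure_display} {T : measurableType d} {R : realType}.
Variable P : nat -> probability T R.

Local Notation W := (pathType nat T).

Definition upd (w : W) (k : nat) (v : T) : W :=
  fun i => if i == k then v else w i.

Lemma measurable_upd k :
  measurable_fun setT (fun x : W * T => upd x.1 k x.2).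
Proof.
apply: measurable_fun_path => i; rewrite /upd; case: (i == k) => //.
  exact: measurable_snd.
exact: (measurableT_comp (measurable_coord i) measurable_fst).
Qed.

Lemma measurable_updr (w : W) k : measurable_fun setT (upd w k).
Proof.
apply: measurable_fun_path => i; rewrite /upd; case: (i == k) => //.
Qed.

Definition avg k (F : W -> \bar R) (w : W) : \bar R :=
  \int[P k]_v F (upd w k v).

(** Iterated integral over the coordinates from [k] to [k + m - 1], the largest index innermost. *)
Fixpoint avgs k m (F : W -> \bar R) : W -> \bar R :=
  if m is m'.+1 then avg k (avgs k.+1 m' F) else F.

Definition depends (n : nat) (U : Type) (F : W -> U) :=
  forall w w' : W, (forall i, (i < n)%N -> w i = w' i) -> F w = F w'.

Lemma depends_le n m (U : Type) (F : W -> U) :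
  (n <= m)%N -> depends n F -> depends m F.
Proof. by move=> nm h w w' ww'; apply: h => i /leq_trans/(_ nm)/ww'. Qed.

Lemma avg_ge0 k F : (forall w, 0 <= F w) -> forall w, 0 <= avg k F w.
Proof. by move=> F0 w; apply: integral_ge0 => v _. Qed.

Lemma measurable_avg k F : (forall w, 0 <= F w) ->
  measurable_fun setT F -> measurable_fun setT (avg k F).
Proof.
move=> F0 mF.
exact: (@measurable_fun_fubini_tonelli_F _ _ W T R (P k)
  (fun x => F (upd x.1 k x.2)) (measurableT_comp mF (measurable_upd k))).
Qed.

Lemma avgs_ge0 k m F : (forall w, 0 <= F w) -> forall w, 0 <= avgs k m F w.
Proof. by move=> F0; elim: m k => //= m ih k; apply: avg_ge0. Qed.

Lemma measurable_avgs k m F : (forall w, 0 <= F w) ->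
  measurable_fun setT F -> measurable_fun setT (avgs k m F).
Proof.
move=> F0 mF; elim: m k => //= m ih k.
by apply: measurable_avg => //; exact: avgs_ge0.
Qed.

Lemma avg_depends n k F : depends n F -> (n <= k)%N -> avg k F = F.
Proof.
move=> dF nk; apply/funext => w; rewrite /avg.
under eq_integral => v _.
  rewrite (dF _ w); first over.
  by move=> i ilt; rewrite /upd ltn_eqF// (leq_trans ilt).
by rewrite integral_cst// [X in _ * X](@probability_setT _ _ _ (P k)) mule1.
Qed.

Lemma avgs_depends n k m F : depends n F -> (n <= k)%N -> avgs k m F = F.
Proof.
move=> dF; elim: m k => //= m ih k nk.
by rewrite ih ?(leq_trans nk)//; exact: (avg_depends dF).
Qed.

Lemma avgsD k m j F : avgs k (m + j) F = avgs k m (avgs (k + m) j F).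
Proof.
elim: m k => [|m ih] k /=; first by rewrite addn0.
by rewrite ih addSnnS.
Qed.

Lemma avg_dependsS k F : depends k.+1 F -> depends k (avg k F).
Proof.
move=> dF w w' ww'; apply: eq_integral => v _; apply: dF => i.
rewrite /upd ltnS leq_eqVlt; case: eqP => //= _; exact: ww'.
Qed.

Lemma avgs_dependsS k m F : depends (k + m) F -> depends k (avgs k m F).
Proof.
elim: m k => [|m ih] k /=; first by rewrite addn0.
by move=> dF; apply: avg_dependsS; apply: ih; rewrite addSnnS.
Qed.

Definition cylinder n (C : set W) := measurable C /\ depends n C.

Definition cylinders : set (set W) := [set C | exists n, cylinder n C].

Definition ind (C : set W) (w : W) : \bar R := (\1_C w)%:E.

Lemma ind_ge0 C w : 0 <= ind C w. Proof. by rewrite lee_fin. Qed.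

Lemma ind_le1 C w : ind C w <= 1.
Proof. by rewrite lee_fin indicE; case: (_ \in _). Qed.

Lemma measurable_ind C : measurable C -> measurable_fun setT (ind C).
Proof. by move=> mC; apply/measurable_EFinP; exact: measurable_indic. Qed.

Lemma depends_ind n C : depends n C -> depends n (ind C).
Proof. by move=> dC w w' ww'; rewrite /ind !indicE; congr (_%:R%:E);
  congr nat_of_bool; apply/idP/idP; rewrite !inE (dC w w'). Qed.

(* The level picked by [xget] is irrelevant, see [cylmE]. *)
Definition cylm (C : set W) : \bar R :=
  avgs 0 (xget 0%N [set n | cylinder n C]) (ind C) point.

(** Averaging over a coordinate that the indicator does not see changes nothing, each [P k] having
    mass one; hence any two admissible levels agree. *)
Lemma cylmE n C : cylinder n C -> cylm C = avgs 0 n (ind C) point.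
Proof.
move=> nC; rewrite /cylm; case: xgetP => [m _ mC|/(_ n)//].
wlog mn : m n mC nC / (m <= n)%N.
  by move=> h; case: (leqP m n) => [|/ltnW] mn; [apply: h|apply/esym/h].
rewrite -(subnKC mn) avgsD (@avgs_depends m (0 + m))//.
by case: mC => _ /depends_ind.
Qed.

Lemma cylinder_le n m C : (n <= m)%N -> cylinder n C -> cylinder m C.
Proof. by move=> nm [mC dC]; split => //; exact: depends_le dC. Qed.

Lemma avgsDr k m F G : (forall w, 0 <= F w) -> (forall w, 0 <= G w) ->
  measurable_fun setT F -> measurable_fun setT G ->
  avgs k m (fun w => F w + G w) = (fun w => avgs k m F w + avgs k m G w).
Proof.
move=> F0 G0 mF mG; elim: m k => //= m ih k.
rewrite ih; apply/funext => w; rewrite /avg ge0_integralD//.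
- by move=> v _; exact: avgs_ge0.
- by apply: (measurableT_comp _ (measurable_updr w k)); exact: measurable_avgs.
- by move=> v _; exact: avgs_ge0.
- by apply: (measurableT_comp _ (measurable_updr w k)); exact: measurable_avgs.
Qed.

Lemma le_avgs k m F G : (forall w, 0 <= F w) -> (forall w, F w <= G w) ->
  measurable_fun setT F -> measurable_fun setT G ->
  forall w, avgs k m F w <= avgs k m G w.
Proof.
move=> F0 FG mF mG; elim: m k => //= m ih k w.
apply: ge0_le_integral => //.
- by move=> v _; exact: avgs_ge0.
- by apply: (measurableT_comp _ (measurable_updr w k)); exact: measurable_avgs.
- by apply: (measurableT_comp _ (measurable_updr w k));
    apply: measurable_avgs => // v; exact: le_trans (FG v).
Qed.

Lemma avgs_cst k m (r : \bar R) : avgs k m (cst r) = cst r.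
Proof. exact: (@avgs_depends 0). Qed.


(** Lets cylinders of different levels be compared at a common level [M]. The subtractions are
    truncated at zero, which covers the case where all relevant coordinates lie below [k]. *)
Lemma avgs_stable n M k C : cylinder n C -> (n <= M)%N ->
  avgs k (M - k) (ind C) = avgs k (n - k) (ind C).
Proof.
move=> [mC /depends_ind dC] nM; case: (leqP k n) => kn.
  rewrite -(subnKC nM) -addnBAC// avgsD subnKC//.
  by rewrite (avgs_depends _ dC).
by rewrite !(avgs_depends _ dC) // ltnW.
Qed.

Lemma avgs_ind_le1 k m C w : measurable C -> avgs k m (ind C) w <= 1.
Proof.
move=> mC; rewrite -[leRHS]/(cst 1 w) -(@avgs_cst k m 1).
apply: le_avgs => //; [exact: ind_ge0|exact: ind_le1|exact: measurable_ind].
Qed.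

Lemma cylm_ge0 C : 0 <= cylm C.
Proof. by apply: avgs_ge0; exact: ind_ge0. Qed.

Lemma cylm_le1 C : cylinders C -> cylm C <= 1.
Proof. by move=> [n nC]; rewrite (cylmE nC); apply: avgs_ind_le1; case: nC. Qed.

Lemma cylm0 : cylm set0 = 0.
Proof.
rewrite (@cylmE 0%N)//.
by rewrite /= /ind indic0.
Qed.

Lemma cylmT : cylm setT = 1.
Proof.
rewrite (@cylmE 0%N)//.
by rewrite /= /ind indicT.
Qed.

Lemma cylinderI n m A B : cylinder n A -> cylinder m B ->
  cylinder (maxn n m) (A `&` B).
Proof.
move=> /(cylinder_le (leq_maxl n m))[mA dA] /(cylinder_le (leq_maxr n m))[mB dB].
split; first exact: measurableI.
by move=> w w' ww'; rewrite /setI /mkset (dA _ _ ww') (dB _ _ ww').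
Qed.

Lemma cylinderC n A : cylinder n A -> cylinder n (~` A).
Proof.
move=> [mA dA]; split; first exact: measurableC.
by move=> w w' ww'; rewrite /setC /mkset (dA _ _ ww').
Qed.

Lemma cylindersI : setI_closed cylinders.
Proof. by move=> A B [n nA] [m mB]; exists (maxn n m); exact: cylinderI. Qed.

Lemma cylindersC : setC_closed cylinders.
Proof. by move=> A [n nA]; exists n; exact: cylinderC. Qed.

Lemma cylinders0 : cylinders set0. Proof. by exists 0%N; split. Qed.

Lemma cylindersU : setU_closed cylinders.
Proof.
move=> A B cA cB; rewrite -(setCK (_ `|` _)) setCU.
by apply: cylindersC; apply: cylindersI; exact: cylindersC.
Qed.

Lemma cylmU A B : cylinders A -> cylinders B -> A `&` B = set0 ->
  cylm (A `|` B) = cylm A + cylm B.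
Proof.
move=> [n nA] [m mB] AB.
have nU : cylinder (maxn n m) (A `|` B).
  rewrite -(setCK (_ `|` _)) setCU; apply: cylinderC.
  by apply: cylinderI; exact: cylinderC.
rewrite (cylmE nU) (cylmE (cylinder_le (leq_maxl n m) nA)).
rewrite (cylmE (cylinder_le (leq_maxr n m) mB)).
have -> : ind (A `|` B) = (fun w => ind A w + ind B w).
  apply/funext => w; rewrite /ind !indicE in_setU -EFinD.
  case: (boolP (w \in A)); case: (boolP (w \in B)) => //=; rewrite ?addr0 ?add0r//.
  rewrite !inE => Bw Aw; suff : (A `&` B) w by rewrite AB.
  by split.
rewrite avgsDr//; [exact: ind_ge0|exact: ind_ge0| |].
  by apply: measurable_ind; case: nA.
by apply: measurable_ind; case: mB.
Qed.

(** * Continuity at the empty set of the content on cylinders *)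

Section cylm_continuity.
Variables (D : (set W)^nat) (N : nat -> nat).
Hypothesis cD : forall j, cylinder (N j) (D j).
Hypothesis ndD : forall j, D j.+1 `<=` D j.

Let h k j := avgs k (N j - k) (ind (D j)).

Let mD j : measurable (D j). Proof. by case: (cD j). Qed.

Let h_ge0 k j w : 0 <= h k j w.
Proof. by apply: avgs_ge0; exact: ind_ge0. Qed.

Let h_le1 k j w : h k j w <= 1.
Proof. exact: avgs_ind_le1. Qed.

Let mh k j : measurable_fun setT (h k j).
Proof.
by apply: measurable_avgs; [exact: ind_ge0|exact: measurable_ind].
Qed.

Let h_ni k w : nonincreasing_seq (fun j => h k j w).
Proof.
apply/nonincreasing_seqP => j; rewrite /h.
rewrite -(avgs_stable k (cD j) (leq_maxl (N j) (N j.+1))).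
rewrite -(avgs_stable k (cD j.+1) (leq_maxr (N j) (N j.+1))).
apply: le_avgs.
- exact: ind_ge0.
- move=> v; rewrite lee_fin !indicE; case: (boolP (v \in D j.+1)) => //.
  by rewrite inE => /ndD Dv; rewrite mem_set.
- exact: measurable_ind.
- exact: measurable_ind.
Qed.

Let avg_h k j : avg k (h k.+1 j) = h k j.
Proof.
rewrite /h; case: (ltnP k (N j)) => kN; first by rewrite -(subnSK kN).
have [_ /depends_ind dD] := cD j.
rewrite !(avgs_depends _ dD)//; last by rewrite (leq_trans kN).
exact: avg_depends dD kN.
Qed.

Let h_dep k j : depends k (h k j).
Proof.
rewrite /h; have [_ /depends_ind dD] := cD j; case: (leqP k (N j)) => kN.
  by apply: avgs_dependsS; rewrite subnKC.
by rewrite (avgs_depends _ dD (ltnW kN)); exact: depends_le (ltnW kN) dD.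
Qed.

Let H k w := limn (fun j => h k j w).

Let h_cvg k w : (fun j => h k j w) @ \oo --> H k w.
Proof. exact/ereal_nonincreasing_is_cvgn/h_ni. Qed.

Let avg_H k w : avg k (H k.+1) w = H k w.
Proof.
apply/esym/cvg_lim => //.
under eq_fun do rewrite -avg_h.
apply: (@dominated_cvg _ _ _ (P k) _ measurableT
  (fun j v => h k.+1 j (upd w k v)) (fun v => H k.+1 (upd w k v)) (cst 1)).
- by move=> j; exact: measurableT_comp (measurable_updr w k).
- by move=> v _; exact: h_cvg.
- by [].
- exact: finite_measure_integrable_cst.
- by move=> j v _; rewrite gee0_abs.
Qed.

Let H_ge0 k w : 0 <= H k w.
Proof. by apply: lime_ge; [exact/ereal_nonincreasing_is_cvgn/h_ni|exact: nearW]. Qed.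

(* If the limit is positive then so is the limit of the partial averages [H 0];
   as [H k] is the average of [H k.+1], coordinates can be chosen one after the
   other so that all [H k] stay positive, and the resulting point belongs to
   every [D j]. *)
Lemma cylm_cvg0 : \bigcap_j D j = set0 -> cylm \o D @ \oo --> 0.
Proof.
move=> D0.
have h0 : cylm \o D = (fun j => h 0 j point).
  by apply/funext => j /=; rewrite (cylmE (cD j)) /h subn0.
rewrite h0; have [H00|H0] := eqVneq (H 0 point) 0.
  by rewrite -H00; exact: h_cvg.
have step (kw : nat * W) : exists v,
    0 < H kw.1 kw.2 -> 0 < H kw.1.+1 (upd kw.2 kw.1 v).
  case: kw => k w /=; apply: contrapT => /forallNP nv.
  have /= : H k w = 0.
    rewrite -avg_H /avg; apply: integral0_eq => v _.
    apply/eqP; rewrite eq_le H_ge0 andbT leNgt; apply/negP => Hv.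
    by apply: (nv v).
  by move=> H0'; apply: (nv point); rewrite H0' ltxx.
have [f fP] := choice step.
pose fix g k : W := if k is k'.+1 then upd (g k') k' (f (k', g k')) else point.
have gP k : 0 < H k (g k).
  by elim: k => [|k ih]; [rewrite lt0e H0 H_ge0|exact: (fP (k, g k))].
pose om : W := fun i => g i.+1 i.
have omg k i : (i < k)%N -> om i = g k i.
  elim: k => // k ih; rewrite ltnS leq_eqVlt => /orP[/eqP->//|ik].
  by rewrite ih//= /upd ltn_eqF.
have Hom k : 0 < H k om.
  have E : (fun j => h k j om) = (fun j => h k j (g k)).
    by apply/funext => j; exact: (@h_dep k j om (g k) (@omg k)).
  by rewrite /H E; exact: gP.
suff : (\bigcap_j D j) om by rewrite D0.
move=> j _; apply: contrapT => nD.
have := Hom (N j); suff -> : H (N j) om = 0 by rewrite ltxx.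
apply/eqP; rewrite eq_le H_ge0 andbT.
have -> : 0 = h (N j) j om by rewrite /h subnn /= /ind indicE memNset.
by have /ereal_nonincreasing_cvgn/cvg_lim := h_ni (N j) om; rewrite /H => ->//;
  apply: ereal_inf_lbound; exists j.
Qed.

End cylm_continuity.

(** By finite additivity the mass of the union is the partial sum plus the mass of the remainder
    [D n]; the remainders decrease to the empty set, so [cylm_cvg0] concludes. *)
Lemma cylm_semi_sigma_additive (F : (set W)^nat) :
  (forall i, cylinders (F i)) -> trivIset setT F ->
  cylinders (\bigcup_i F i) ->
  (fun n => \sum_(0 <= i < n) cylm (F i)) @ \oo --> cylm (\bigcup_i F i).
Proof.
move=> cF tF cU; set U := \bigcup_i F i.
pose D n := U `&` [set w | forall i, (i < n)%N -> ~ F i w].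
have DS n : D n.+1 = D n `&` ~` F n.
  apply/seteqP; split=> w [].
    by move=> Uw h; split; [split => // i ni; apply: h; rewrite ltnS ltnW|exact: h].
  move=> [Uw h] nF; split => // i; rewrite ltnS leq_eqVlt => /orP[/eqP->//|]; exact: h.
have cD n : cylinders (D n).
  elim: n => [|n ih]; last by rewrite DS; apply: cylindersI => //; exact: cylindersC.
  by rewrite /D (_ : [set w | _] = setT) ?setIT//; apply/seteqP; split.
have [N NP] := choice cD.
have D0 : \bigcap_j D j = set0.
  apply/seteqP; split => // w Dw; have [[i _ Fi] _] := Dw 0%N I.
  by have [_ /(_ i (ltnSn i))] := Dw i.+1 I.
have DF n : D n = F n `|` D n.+1.
  rewrite DS; apply/seteqP; split => [w Dw|w].
    by have [Fw|nF] := pselect (F n w); [left|right].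
  move=> [Fw|[]//]; split; first by exists n.
  move=> i ni Fi; have := tF i n I I (ex_intro _ w (conj Fi Fw)).
  by move=> e; rewrite e ltnn in ni.
have cDF n : cylm (D n) = cylm (F n) + cylm (D n.+1).
  rewrite {1}DF cylmU// DS; apply/seteqP; split => // w [Fw []//].
have sumE n : cylm U = \sum_(0 <= i < n) cylm (F i) + cylm (D n).
  elim: n => [|n ih].
    rewrite big_geq// add0e; congr cylm; rewrite /D (_ : [set w | _] = setT) ?setIT//.
    by apply/seteqP; split.
  by rewrite big_nat_recr//= -addeA -cDF.
have fD n : cylm (D n) \is a fin_num.
  by rewrite ge0_fin_numE ?cylm_ge0// (le_lt_trans (cylm_le1 (cD n)))// ltry.
have -> : (fun n => \sum_(0 <= i < n) cylm (F i)) =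
    (fun n => cylm U - cylm (D n)).
  by apply/funext => n; rewrite (sumE n) addeK.
rewrite -[X in _ --> X]sube0; apply: cvgeB => //; [|exact: cvg_cst|].
  by rewrite fin_num_adde_defl.
apply: (cylm_cvg0 NP) => // j; rewrite DS; exact: subIsetl.
Qed.

End infinite_product.


(** A separate alias: here sequences carry the algebra of cylinders, from which the measure is
    extended, whereas [pathType nat T] carries the generated sigma-algebra. *)
Definition cylType {d : measure_display} (T : measurableType d) : Type :=
  nat -> T.

Section cylinder_algebra.
Context {d : measure_display} {T : measurableType d}.

HB.instance Definition _ := Pointed.on (cylType T).
HB.instance Definition _ := @isAlgebraOfSets.Build default_measure_display
  (cylType T) (@cylinders d T) (@cylinders0 d T) (@cylindersU d T)
  (@cylindersC d T).

End cylinder_algebra.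

(** * The product probability and the resampling of one coordinate *)

Section product_probability.
Local Open Scope ereal_scope.
Context {d : measure_display} {T : measurableType d} {R : realType}.
Variable P : nat -> probability T R.
Local Notation W := (pathType nat T).

Definition cylmu : set (cylType T) -> \bar R := cylm P.

Let cylmu_semi_sigma_additive : semi_sigma_additive cylmu.
Proof. by move=> F mF tF mU; exact: cylm_semi_sigma_additive. Qed.

HB.instance Definition _ := isMeasure.Build _ (cylType T) R cylmu
  (cylm0 P) (@cylm_ge0 _ _ _ P) cylmu_semi_sigma_additive.

Let cylX := g_sigma_algebraType (@measurable _ (cylType T)).

Let mid : measurable_fun [set: cylX] (fun w : cylX => (w : W)).
Proof.
apply: measurable_fun_path => i _ B mB; rewrite setTI.
apply: sub_sigma_algebra; exists i.+1; split.
  by apply: sub_sigma_algebra; exists i, B.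
by move=> w w' ww'; rewrite /preimage /mkset (ww' i).
Qed.

Definition prodm : {measure set W -> \bar R} := pushm mid (measure_extension cylmu).

Lemma prodmE (C : set W) : cylinders C -> prodm C = cylm P C.
Proof. by move=> cC; rewrite /prodm pushmE /= /measure_extension measurable_mu_extE. Qed.

Let prodmT : prodm setT = 1.
Proof. by rewrite prodmE ?cylmT//; exists 0%N; split. Qed.

Definition prodP : probability W R := mkprob prodmT.

Definition rect (n : nat) (B : nat -> set T) : set W :=
  [set w | forall i, (i < n)%N -> B i (w i)].

Lemma cylinder_rect n B : (forall i, measurable (B i)) ->
  cylinder n (rect n B).
Proof.
move=> mB; split; last first.
  move=> w w' ww'; rewrite /rect /mkset; apply/propext.
  by split=> h i ni; have := h i ni; rewrite ww'.
rewrite (_ : rect n B = \bigcap_(i in `I_n) [set w : W | B i (w i)]); last first.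
  by apply/seteqP; split => w h i ni; exact: h.
apply: bigcap_measurableType => i _.
by rewrite -[X in measurable X]setTI; exact: (measurable_coord i).
Qed.

Lemma avgs_rect k m B : (forall i, measurable (B i)) ->
  avgs P k m (ind (R := R) (rect (k + m) B)) =
  (fun w => ind (rect k B) w * \prod_(k <= i < k + m) P i (B i)).
Proof.
move=> mB; elim: m k => [|m ih] k /=.
  by rewrite addn0; apply/funext => w; rewrite big_geq// mule1.
rewrite -addSnnS ih; apply/funext => w; rewrite /avg.
have indS v : ind (R := R) (rect k.+1 B) (upd w k v) = ind (rect k B) w * (\1_(B k) v)%:E.
  rewrite /ind -EFinM !indicE -natrM mulnb; congr (_%:R%:E); congr nat_of_bool.
  apply/idP/andP; rewrite !inE.
    move=> h; split; last by have := h k (ltnSn k); rewrite /upd eqxx.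
    by move=> i ik; have := h i (ltnW ik); rewrite /upd ltn_eqF.
  move=> [h Bv] i; rewrite /upd ltnS leq_eqVlt; case: eqP => [->//|_] /=; exact: h.
under eq_integral => v _ do rewrite indS -muleA.
rewrite ge0_integralZl//; last 3 first.
- apply: emeasurable_funM => //.
  by apply/measurable_EFinP; exact: measurable_indic.
- by move=> v _; rewrite mule_ge0 ?lee_fin// prode_ge0.
- exact: ind_ge0.
rewrite ge0_integralZr//; last 2 first.
- by apply/measurable_EFinP; exact: measurable_indic.
- exact: prode_ge0.
rewrite integral_indic// setIT; congr (_ * _).
by rewrite [in RHS]big_ltn// addSn ltnS leq_addr.
Qed.

Lemma prodP_rect n B : (forall i, measurable (B i)) ->
  prodP (rect n B) = \prod_(0 <= i < n) P i (B i).
Proof.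
move=> mB; have cR := cylinder_rect n mB.
rewrite [LHS]prodmE; last by exists n.
rewrite (cylmE P cR); have := avgs_rect 0 n mB; rewrite add0n => ->.
by rewrite /ind indicE mem_set// mul1e.
Qed.

Lemma rect_gen : @measurable _ W =
  <<s [set A : set W | exists n B, (forall i, measurable (B i)) /\ A = rect n B] >>.
Proof.
apply/seteqP; split; last first.
  apply: smallest_sub; first exact: sigma_algebra_measurable.
  by move=> _ [n [B [mB ->]]]; case: (cylinder_rect n mB).
apply: smallest_sub; first exact: smallest_sigma_algebra.
move=> _ [i [B [mB ->]]]; apply: sub_sigma_algebra.
exists i.+1, (fun j => if j == i then B else setT); split.
  by move=> j; case: ifP.
apply/seteqP; split => w /=.
  by move=> Bw j _; case: eqP => [->|].
by move=> /(_ i (ltnSn i)); rewrite eqxx.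
Qed.

(** Isolates coordinate [k] from the others: a leg of the descent can thus be treated as independent
    of the lower ones, on a product of two factors. Rectangles form a generating pi-system on which
    both sides are explicit products. *)
Lemma prodP_upd k : forall A, measurable A ->
  prodP A = (prodP \x P k)%E ((fun x : W * T => upd x.1 k x.2) @^-1` A).
Proof.
pose m2 : {measure set W -> \bar R} := pushm (measurable_upd k) (prodP \x P k).
move=> A mA; rewrite -[RHS]/(m2 A).
apply: (measure_unique
  [set A : set W | exists n B, (forall i, measurable (B i)) /\ A = rect n B]
  (fun=> setT)) => //.
- exact: rect_gen.
- move=> _ _ [n [B [mB ->]]] [n' [B' [mB' ->]]].
  pose C i := (if (i < n)%N then B i else setT) `&`
              (if (i < n')%N then B' i else setT).
  exists (maxn n n'), C; split.
    by move=> i; apply: measurableI; case: ifP.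
  apply/seteqP; split => w.
    by move=> [h h'] i _; split; case: ifPn => // ?; [exact: h|exact: h'].
  move=> h; split => i ni; have := h i; rewrite leq_max ni ?orbT => /(_ isT)[];
    by rewrite ni.
- by move=> _; exists 0%N, (fun=> setT); split => //; apply/seteqP; split.
- exact: bigcup_const.
- move=> _ [n [B [mB ->]]]; transitivity (\prod_(0 <= i < n) P i (B i)).
    exact: prodP_rect.
  pose B' i := if i == k then setT else B i.
  pose Bk := if (k < n)%N then B k else setT.
  have mB' i : measurable (B' i) by rewrite /B'; case: ifP.
  rewrite pushmE (_ : _ @^-1` _ = rect n B' `*` Bk); last first.
    apply/seteqP; split=> -[w v] /=.
      move=> h; split.
        move=> i ni; rewrite /B'; case: eqP => // /eqP ik.
        by have := h i ni; rewrite /upd (negbTE ik).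
      by rewrite /Bk; case: ifP => // kn; have := h k kn; rewrite /upd eqxx.
    move=> [h Bv] i ni; rewrite /upd; case: eqP => [ik|/eqP ik].
      by move: Bv; rewrite /Bk -ik ni.
    by have := h i ni; rewrite /B' (negbTE ik).
  have mBk : measurable Bk by rewrite /Bk; case: ifP.
  transitivity (prodP (rect n B') * P k Bk); last first.
    apply/esym; apply: product_measure1E => //.
    by case: (cylinder_rect n mB').
  rewrite prodP_rect// /Bk; case: ifPn => kn.
    rewrite !big_mkord (bigD1 (Ordinal kn))//= [X in _ = X * _](bigD1 (Ordinal kn))//=.
    rewrite /B' eqxx probability_setT mul1e muleC; congr (_ * _).
    by apply: eq_bigr => i; rewrite -val_eqE/= => /negbTE ->.
  rewrite probability_setT mule1; apply: eq_big_nat => i /= ni.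
  by rewrite /B'; case: eqP => // ik; rewrite -ik ni in kn.
- by move=> n; rewrite [X in X < _](_ : _ = 1) ?ltry//; exact: prodmT.
Qed.

Lemma ge0_integral_prodP_upd k (F : W -> \bar R) : measurable_fun setT F ->
  (forall w, 0 <= F w) ->
  \int[prodP]_w F w = \int[prodP \x P k]_x F (upd x.1 k x.2).
Proof.
move=> mF F0; rewrite -(ge0_integral_pushm (measurable_upd k))//.
apply: eq_measure_integral => A mA _.
exact: prodP_upd.
Qed.

Lemma prodP_coord k (B : set T) : measurable B ->
  prodP [set w : W | B (w k)] = P k B.
Proof.
move=> mB; pose C i := if i == k then B else setT.
have mC i : measurable (C i) by rewrite /C; case: ifP.
rewrite (_ : [set w | _] = rect k.+1 C); last first.
  apply/seteqP; split => w /=.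
    by move=> Bw j _; rewrite /C; case: eqP => [->|].
  by move=> /(_ k (ltnSn k)); rewrite /C eqxx.
rewrite prodP_rect// big_nat_recr//= {2}/C eqxx big1_seq ?mul1e// => i.
rewrite mem_index_iota => /andP[_ ik].
by rewrite /C ltn_eqF// probability_setT.
Qed.

End product_probability.

(** * Laws of processes *)

Section bounded_integrals.
Context {d : measure_display} {T : measurableType d} {R : realType}.
Variable P : probability T R.

Lemma bounded_integrable (f : T -> R) (M : R) : measurable_fun setT f ->
  (forall w, `|f w| <= M) -> P.-integrable setT (EFin \o f).
Proof.
move=> mf fM; apply: (@le_integrable _ _ _ P _ measurableT _ (cst M%:E)).
- exact/measurable_EFinP.
- move=> w _ /=; by rewrite lee_fin (le_trans (fM w))// ler_norm.
- exact: finite_measure_integrable_cst.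
Qed.

(** Convergence is asked on an event of probability one because the good behaviour of paths, such as
    their starting point or the finite duration of the descent, is only almost sure. *)
Lemma bounded_convergence (f_ : nat -> T -> R) (f : T -> R) (M : R) :
  (forall n, measurable_fun setT (f_ n)) -> measurable_fun setT f ->
  (exists A, [/\ measurable A, P A = 1%E &
     forall w, A w -> f_ n w @[n --> \oo] --> f w]) ->
  (forall n w, `|f_ n w| <= M) ->
  (\int[P]_w (f_ n w)%:E)%E @[n --> \oo] --> (\int[P]_w (f w)%:E)%E.
Proof.
move=> mf_ mf [A [mA PA Af]] fM.
have [] := @dominated_convergence _ _ _ P setT measurableT
  (fun n => EFin \o f_ n) (EFin \o f) (cst M%:E) => //.
- by move=> n; exact/measurable_EFinP.
- exact/measurable_EFinP.
- exists (~` A); split; first exact: measurableC.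
    by transitivity (1 - P A)%E; [exact: probability_setC|rewrite PA subee].
  move=> w /= /not_implyP[_ h] Aw; apply: h.
  by apply: cvg_EFin; [exact: nearW|exact: Af].
- exact: finite_measure_integrable_cst.
- by apply: aeW => w n _ /=; rewrite lee_fin.
Qed.

Lemma eq_integral_ae (f g : T -> R) (A : set T) : measurable A ->
  P A = 1%E -> measurable_fun setT f -> measurable_fun setT g ->
  (forall w, A w -> f w = g w) ->
  (\int[P]_w (f w)%:E = \int[P]_w (g w)%:E)%E.
Proof.
move=> mA PA mf mg fg; apply: ae_eq_integral => //.
- exact/measurable_EFinP.
- exact/measurable_EFinP.
- exists (~` A); split; first exact: measurableC.
    by transitivity (1 - P A)%E; [exact: probability_setC|rewrite PA subee].
  by move=> w /= /not_implyP[_ h] Aw; apply: h; rewrite fg.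
Qed.

Lemma integral_bounded_fin_num (f : T -> R) (M : R) :
  measurable_fun setT f -> (forall w, `|f w| <= M) ->
  (\int[P]_w (f w)%:E)%E \is a fin_num.
Proof. by move=> mf fM; exact/integrable_fin_num/bounded_integrable. Qed.

End bounded_integrals.

Section test_functions.
Context {R : realType}.

Definition test01 (f : R -> R) := continuous f /\ forall y, 0 <= f y <= 1.

(* Increases with [k] to the indicator function of [y > a]. *)
Definition ramp (a : R) (k : nat) (y : R) : R :=
  Num.min 1 (Num.max 0 (k%:R * (y - a))).

Lemma ramp_test01 a k : test01 (ramp a k).
Proof.
split; last first.
  move=> y; rewrite /ramp le_min ler01 le_max lexx/=.
  by rewrite ge_min lexx.
have h : continuous (fun y : R => k%:R * (y - a)).
  by move=> y; apply: cvgM; [exact: cvg_cst|apply: cvgB; [exact: cvg_id|exact: cvg_cst]].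
move=> y; apply: (@continuous_min R R (cst 1) (fun y => Num.max 0 (k%:R * (y - a)))).
  exact: cst_continuous.
apply: (@continuous_max R R (cst 0) (fun y => k%:R * (y - a))).
  exact: cst_continuous.
exact: h.
Qed.

Lemma ramp_cvg a y : ramp a k y @[k --> \oo] --> (\1_[set y | a < y] y : R).
Proof.
rewrite indicE; case: (boolP (y \in _)); rewrite ?inE ?notin_setE /= => ay.
  apply: cvg_near_cst; near=> k.
  rewrite /ramp (@max_r _ _ 0)//; last by rewrite mulr_ge0// subr_ge0 ltW.
  rewrite min_l// -ler_pdivrMr ?subr_gt0// div1r.
  near: k; exact: nbhs_infty_ger.
apply: cvg_near_cst; apply: nearW => k.
rewrite /ramp max_l; first by rewrite min_r.
by rewrite mulr_ge0_le0// subr_le0 leNgt; apply/negP.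
Unshelve. all: by end_near. Qed.

Lemma measurable_test01 f : test01 f -> measurable_fun setT f.
Proof. by move=> [cf _]; exact: continuous_measurable_fun. Qed.

Definition prodl {T : Type} (Z : R -> T -> R) (l : seq (R * (R -> R))) (w : T) :=
  \prod_(p <- l) p.2 (Z p.1 w).

Definition tests (l : seq (R * (R -> R))) :=
  forall p, p \in l -> test01 p.2.

Lemma prodl01 (T : Type) (Z : R -> T -> R) l w : tests l ->
  0 <= prodl Z l w <= 1.
Proof.
rewrite /prodl; elim: l => [|p l ih] tl; first by rewrite big_nil ler01 lexx.
have /andP[h1 h2] : 0 <= \prod_(q <- l) q.2 (Z q.1 w) <= 1.
  by apply: ih => q ql; apply: tl; rewrite inE ql orbT.
have [_ /(_ (Z p.1 w))/andP[h3 h4]] := tl p (mem_head _ _).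
by rewrite big_cons mulr_ge0//= mulr_ile1.
Qed.

Lemma measurable_prodl (d : measure_display) (T : measurableType d)
    (Z : R -> T -> R) l : (forall t, measurable_fun setT (Z t)) ->
  (forall p, p \in l -> measurable_fun setT p.2) ->
  measurable_fun setT (prodl Z l).
Proof.
move=> mZ; rewrite /prodl; elim: l => [|p l ih] tl.
  rewrite (_ : (fun w => _) = cst 1) //.
  by apply/funext => w; rewrite big_nil.
under eq_fun do rewrite big_cons; apply: measurable_funM.
  by apply: measurableT_comp => //; apply: tl; exact: mem_head.
by apply: ih => q ql; apply: tl; rewrite inE ql orbT.
Qed.

End test_functions.

(** * Products of continuous tests determine the law of a path *)

Section law_determination.
Context {R : realType}.
Let pathR := pathType R R.

(** Strict lower bounds at finitely many times form a pi-system generating the path sigma-algebra;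
    strictness makes each indicator the limit of products of [ramp] tests. *)
Definition box (l : seq (R * R)) : set pathR :=
  [set p | forall q, q \in l -> q.2 < p q.1].

Lemma box_cons q l : box (q :: l) = [set p : pathR | q.2 < p q.1] `&` box l.
Proof.
apply/seteqP; split => p.
  by move=> h; split => [|r rl]; apply: h; rewrite inE ?eqxx ?rl ?orbT.
by move=> [h1 h2] r; rewrite inE => /orP[/eqP->//|]; exact: h2.
Qed.

Lemma measurable_gt (t a : R) : measurable [set p : pathR | a < p t].
Proof.
apply: sub_sigma_algebra; exists t, `]a, +oo[%classic; split => //.
by apply/seteqP; split => p /=; rewrite in_itv/= andbT.
Qed.

Lemma measurable_box l : measurable (box l).
Proof.
elim: l => [|q l ih].
  by rewrite (_ : box [::] = setT) //; apply/seteqP; split.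
by rewrite box_cons; apply: measurableI => //; exact: measurable_gt.
Qed.

Lemma box_gen : @measurable _ pathR = <<s [set box l | l in setT] >>.
Proof.
apply/seteqP; split; last first.
  apply: smallest_sub; first exact: sigma_algebra_measurable.
  by move=> _ [l _ <-]; exact: measurable_box.
apply: smallest_sub; first exact: smallest_sigma_algebra.
move=> _ [t [B [mB ->]]].
pose G := [set box l | l in setT].
have : measurable_fun [set: g_sigma_algebraType G]
    (fun p : g_sigma_algebraType G => p t : R).
  apply: (measurability (@RGenOInfty.G R)) => //.
    exact: RGenOInfty.measurableE.
  move=> _ [_ [a ->] <-]; rewrite setTI; apply: sub_sigma_algebra.
  exists [:: (t, a)] => //; apply/seteqP; split => p /=.
    by move=> /(_ _ (mem_head _ _)) /=; rewrite in_itv/= andbT.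
  by rewrite in_itv/= andbT => ap q; rewrite inE => /eqP ->.
by move=> /(_ measurableT B mB); rewrite setTI.
Qed.

Lemma box_setI : setI_closed [set box l | l in setT].
Proof.
move=> _ _ [l _ <-] [m _ <-]; exists (l ++ m) => //.
apply/seteqP; split => p.
  by move=> h; split => q ql; apply: h; rewrite mem_cat ql ?orbT.
by move=> [h1 h2] q; rewrite mem_cat => /orP[]; [exact: h1|exact: h2].
Qed.

Definition rampl k (l : seq (R * R)) : seq (R * (R -> R)) :=
  [seq (q.1, ramp q.2 k) | q <- l].

Lemma tests_rampl k l : tests (rampl k l).
Proof. by move=> p /mapP[q _ ->]; exact: ramp_test01. Qed.

Lemma prodl_rampl_cvg (T : Type) (Z : R -> T -> R) l w :
  prodl Z (rampl k l) w @[k --> \oo] --> (\1_(box l) (Z ^~ w) : R).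
Proof.
elim: l => [|q l ih].
  rewrite (_ : box [::] = setT); last by apply/seteqP; split.
  rewrite indicT; apply: cvg_near_cst; apply: nearW => k.
  by rewrite /prodl big_nil.
rewrite box_cons indicI.
under eq_fun do rewrite /prodl /= big_cons.
apply: cvgM; last exact: ih.
have := @ramp_cvg R q.2 (Z q.1 w).
by rewrite !indicE; congr (_ --> _); congr (_%:R); congr nat_of_bool;
  apply/idP/idP; rewrite !inE.
Qed.

Context {d1 d2 : measure_display} {T1 : measurableType d1}
  {T2 : measurableType d2} (P1 : probability T1 R) (P2 : probability T2 R).
Variables (g1 : T1 -> R) (g2 : T2 -> R) (Z1 : R -> T1 -> R) (Z2 : R -> T2 -> R).
Hypotheses (mg1 : measurable_fun setT g1) (mg2 : measurable_fun setT g2).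
Hypotheses (g1_01 : forall w, 0 <= g1 w <= 1) (g2_01 : forall w, 0 <= g2 w <= 1).
Hypotheses (mZ1 : forall t, measurable_fun setT (Z1 t))
  (mZ2 : forall t, measurable_fun setT (Z2 t)).

Lemma measurable_paths (d : measure_display) (T : measurableType d)
    (Z : R -> T -> R) :
  (forall t, measurable_fun setT (Z t)) ->
  measurable_fun setT (fun w => Z ^~ w : pathR).
Proof. by move=> mZ; exact: measurable_fun_path. Qed.

Hypothesis H : forall l, tests l ->
  (\int[P1]_w (g1 w * prodl Z1 l w)%:E = \int[P2]_w (g2 w * prodl Z2 l w)%:E)%E.

Let mpre (d : measure_display) (T : measurableType d) (Z : R -> T -> R)
    (B : set pathR) : (forall t, measurable_fun setT (Z t)) -> measurable B ->
  measurable [set w | B (Z ^~ w)].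
Proof.
by move=> mZ mB; rewrite -[X in measurable X]setTI; exact: (measurable_paths mZ).
Qed.

Let indE (d : measure_display) (T : measurableType d) (P : probability T R)
  (g : T -> R) (Z : R -> T -> R) (B : set pathR) :
  (\int[P]_(w in [set w | B (Z ^~ w)]) (g w)%:E =
   \int[P]_w (g w * \1_B (Z ^~ w))%:E)%E.
Proof.
rewrite integral_mkcond; apply: eq_integral => w _.
rewrite /patch indicE; case: ifPn; rewrite ?inE ?notin_setE /= => h.
  by rewrite mem_set// mulr1.
by rewrite memNset// mulr0.
Qed.

Let lim_box (d : measure_display) (T : measurableType d) (P : probability T R)
  (g : T -> R) (Z : R -> T -> R) l : measurable_fun setT g ->
  (forall w, 0 <= g w <= 1) -> (forall t, measurable_fun setT (Z t)) ->
  (\int[P]_w (g w * prodl Z (rampl k l) w)%:E)%E @[k --> \oo] -->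
  (\int[P]_(w in [set w | box l (Z ^~ w)]) (g w)%:E)%E.
Proof.
move=> mg g01 mZ; rewrite indE; apply: (@bounded_convergence _ _ _ _ _ _ 1).
- move=> k; apply: measurable_funM => //; apply: measurable_prodl => // p pl.
  by apply: measurable_test01; exact: tests_rampl pl.
- apply: measurable_funM => //.
  rewrite (_ : (fun w => _) = \1_[set w | box l (Z ^~ w)]).
    exact: measurable_indic (mpre mZ (measurable_box l)).
  apply/funext => w; rewrite !indicE; congr (_%:R); congr nat_of_bool.
- exists setT; split => //; first exact: probability_setT.
  by move=> w _; apply: cvgM; [exact: cvg_cst|exact: prodl_rampl_cvg].
- move=> k w; have /andP[h1 h2] := g01 w.
  have /andP[h3 h4] := prodl01 Z w (@tests_rampl k l).
  by rewrite ger0_norm ?mulr_ge0// mulr_ile1.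
Qed.

(* The weights [g1] and [g2] turn this uniqueness statement into a tool for
   conditional laws. *)
Lemma law_determined (B : set pathR) : measurable B ->
  (\int[P1]_(w in [set w | B (Z1 ^~ w)]) (g1 w)%:E =
   \int[P2]_(w in [set w | B (Z2 ^~ w)]) (g2 w)%:E)%E.
Proof.
(* The empty list of tests yields equal total masses, as required by the complement step of the
   Dynkin induction. *)
have HT : (\int[P1]_w (g1 w)%:E = \int[P2]_w (g2 w)%:E)%E.
  transitivity (\int[P1]_w (g1 w * prodl Z1 [::] w)%:E)%E.
    by apply: eq_integral => w _; rewrite /prodl big_nil mulr1.
  by rewrite H//; apply: eq_integral => w _; rewrite /prodl big_nil mulr1.
move=> mB; move: (mB); rewrite box_gen => sB; move: B sB {mB}.
apply: (dynkin_induction box_gen box_setI).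
- by [].
- move=> _ [l _ <-].
  have L1 := lim_box (P := P1) (l := l) mg1 g1_01 mZ1.
  have L2 := lim_box (P := P2) (l := l) mg2 g2_01 mZ2.
  rewrite -(cvg_lim _ L1)// -(cvg_lim _ L2)//.
  by under eq_fun do rewrite (H (@tests_rampl _ _)).
- move=> S mS.
  have E (d : measure_display) (T : measurableType d) (P : probability T R)
      (g : T -> R) (Z : R -> T -> R) (mZ : forall t, measurable_fun setT (Z t)) :
      measurable_fun setT g -> (forall w, 0 <= g w <= 1) ->
      (\int[P]_(w in [set w | (~` S) (Z ^~ w)]) (g w)%:E =
       \int[P]_w (g w)%:E - \int[P]_(w in [set w | S (Z ^~ w)]) (g w)%:E)%E.
    move=> mg g01.
    have gle1 w : `|g w| <= 1 by have /andP[? ?] := g01 w; rewrite ger0_norm.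
    have ig := bounded_integrable P mg gle1.
    have mSZ := mpre mZ mS.
    have -> : (\int[P]_w (g w)%:E =
      \int[P]_(w in [set w | S (Z ^~ w)] `|` [set w | (~` S) (Z ^~ w)]) (g w)%:E)%E.
      by congr (integral _ _ _); apply/seteqP; split => // w _; rewrite /=; exact: EM.
    rewrite ge0_integral_setU//.
    + rewrite addeAC subee ?add0e//.
      apply: integrable_fin_num => //.
      exact: integrableS ig.
    + exact: (mpre mZ (measurableC mS)).
    + by apply/measurable_EFinP; exact: measurable_funS mg.
    + by move=> w _; rewrite lee_fin; case/andP: (g01 w).
    + by apply/disj_setPS => w [? ?].
  by move=> SE; rewrite !E// HT SE.
- move=> F mF tF FE.
  have E (d : measure_display) (T : measurableType d) (P : probability T R)
      (g : T -> R) (Z : R -> T -> R) (mZ : forall t, measurable_fun setT (Z t)) :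
      measurable_fun setT g -> (forall w, 0 <= g w <= 1) ->
      (\int[P]_(w in [set w | (\bigcup_k F k) (Z ^~ w)]) (g w)%:E =
       \sum_(0 <= i <oo) \int[P]_(w in [set w | F i (Z ^~ w)]) (g w)%:E)%E.
    move=> mg g01.
    have -> : [set w | (\bigcup_k F k) (Z ^~ w)] =
       \bigcup_k [set w | F k (Z ^~ w)] by apply/seteqP; split.
    apply: ge0_integral_bigcup.
    + by move=> k; exact: mpre.
    + by apply/measurable_EFinP; exact: measurable_funS mg.
    + by move=> w _; rewrite lee_fin; case/andP: (g01 w).
    + move=> i j _ _ [w [Fi Fj]]; apply: tF => //.
      by exists (Z ^~ w).
  by rewrite !E//; apply: eq_eseriesr => i _; exact: FE.
Qed.

End law_determination.

(** * Hitting times and concatenation of paths *)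

Section hitting_times.
Context {R : realType}.
Implicit Types (p : R -> R) (b s t : R).

Lemma at_right_ex (t : R) (Q : set R) : (\forall x \near t^'+, Q x) ->
  exists2 e : R, 0 < e & forall x, t < x < t + e -> Q x.
Proof.
case=> e /= e0 he; exists e => // x /andP[tx xe]; apply: he => //=.
by rewrite distrC ger0_norm ?subr_ge0 1?ltW// ltrBlDl.
Qed.

(** [hit_below] for a single path, so that it also applies to concatenated paths. *)
Definition hit p b : \bar R :=
  ereal_inf [set t%:E | t in [set t : R | 0 <= t /\ p t < b]].

Lemma hit_ltP p b s : (hit p b < s%:E)%E <->
  exists t, [/\ 0 <= t, t < s & p t < b].
Proof.
split.
  by move=> /ereal_inf_lt[_ [t [t0 pt] <-]]; rewrite lte_fin => ts; exists t.
move=> [t [t0 ts pt]]; apply: le_lt_trans (_ : t%:E < _)%E; last by rewrite lte_fin.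
by apply: ereal_inf_lbound; exists t.
Qed.

Lemma hit_ge0 p b : (0 <= hit p b)%E.
Proof. by apply: le_ereal_inf_tmp => _ [t [t0 _] <-]; rewrite lee_fin. Qed.

Lemma lt_hit p b t : 0 <= t -> (t%:E < hit p b)%E -> b <= p t.
Proof.
move=> t0; apply: contraTT; rewrite -ltNge -leNgt => pt.
by apply: ereal_inf_lbound; exists t.
Qed.

(** A right-continuous path strictly below [b] at some time is still below [b] just after, hence at
    a rational time: the event becomes a countable union. *)
Lemma hit_lt_ratP p b s : cadlag p -> (hit p b < s%:E)%E <->
  exists q : rat, [/\ (0 : R) <= ratr q, ratr q < s & p (ratr q) < b].
Proof.
move=> [rc _]; split; last by move=> [q h]; apply/hit_ltP; exists (ratr q).
move=> /hit_ltP[t [t0 ts pt]].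
have /at_right_ex[e e0 he] : \forall x \near t^'+, p x < b by exact: (cvgr_lt
  (p t)) (rc t t0) _ pt.
have /rat_in_itvoo[q] : t < Num.min s (t + e) by rewrite lt_min ts ltrDl.
rewrite in_itv /= lt_min => /and3P[tq qs qe]; exists q; split => //.
  by rewrite (le_trans t0)// ltW.
by apply: he; rewrite tq.
Qed.

Lemma hit_gt0 p b : cadlag p -> b < p 0 -> (0 < hit p b)%E.
Proof.
move=> [rc _] bp.
have /at_right_ex[e e0 he] : \forall x \near (0:R)^'+, b < p x.
  exact: (cvgr_gt (p 0)) (rc 0 (lexx _)) _ bp.
apply: (@lt_le_trans _ _ e%:E); first by rewrite lte_fin.
apply: le_ereal_inf_tmp => _ [t [t0 pt] <-]; rewrite lee_fin leNgt.
apply/negP => te; move: pt; apply/negP; rewrite -leNgt.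
move: t0; rewrite le_eqVlt => /orP[/eqP <-|t0]; first exact: ltW.
by apply/ltW/he; rewrite t0 add0r.
Qed.

(** The left limit at [T] is at least [b], so the absence of negative jumps gives [b <= p T]. If the
    inequality were strict, right-continuity would keep the path above [b] beyond [T], against the
    definition of the infimum. *)
Lemma hit_attained p b T : cadlag p -> no_neg_jumps p -> b < p 0 ->
  hit p b = T%:E -> p T = b.
Proof.
move=> cp nj bp hT; have := hit_gt0 cp bp; rewrite hT lte_fin => T0.
have [rc lc] := cp.
apply/eqP; rewrite eq_le; apply/andP; split; last first.
  have [l pl] := lc T T0; apply: (le_trans _ (nj T T0 l pl)).
  rewrite -(cvg_lim _ pl)//; apply: limr_ge; first by apply/cvg_ex; exists l.
  near=> x; apply: lt_hit.
    by near: x; exact: nbhs_left_ge.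
  by rewrite hT lte_fin; near: x; exact: nbhs_left_lt.
rewrite leNgt; apply/negP => pT.
have /at_right_ex[e e0 he] : \forall x \near T^'+, b < p x.
  exact: (cvgr_gt (p T)) (rc T (ltW T0)) _ pT.
have : (hit p b < (T + e)%:E)%E by rewrite hT lte_fin ltrDl.
move=> /hit_ltP[t [t0 te pt]].
have : T <= t by rewrite -lee_fin -hT; apply: ereal_inf_lbound; exists t.
rewrite le_eqVlt => /orP[/eqP Tt|Tt].
  by move: pt; rewrite -Tt ltNge (ltW pT).
by move: pt; rewrite ltNge => /negP; apply; apply/ltW/he; rewrite Tt.
Unshelve. all: by end_near. Qed.

(* The first point of the grid [e, 2e, 3e, ...] strictly above [t]. *)
Definition gridup (e t : R) : R := (Num.truncn (t / e)).+1%:R * e.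

Lemma gridup_itv e t : 0 < e -> 0 <= t -> t < gridup e t <= t + e.
Proof.
move=> e0 t0; have h : 0 <= t / e by rewrite divr_ge0// ltW.
have /andP[h1 h2] := truncn_itv h.
rewrite /gridup -ltr_pdivrMr// h2 /= -natr1 mulrDl mul1r lerD2r.
by rewrite -ler_pdivlMr.
Qed.

Lemma gridup_ge0 e t : 0 < e -> 0 <= gridup e t.
Proof. by move=> e0; rewrite mulr_ge0// ltW. Qed.

Lemma gridupE e t k : 0 < e -> 0 <= t ->
  (Num.truncn (t / e) = k) <-> (k%:R * e <= t < k.+1%:R * e).
Proof.
move=> e0 t0; have h : 0 <= t / e by rewrite divr_ge0// ltW.
rewrite -ler_pdivlMr// -ltr_pdivrMr//; split.
  by move=> <-; exact: truncn_itv.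
by move=> kt; apply: truncn_def.
Qed.

Definition mesh (n : nat) : R := n.+1%:R^-1.

Lemma mesh_gt0 n : 0 < mesh n. Proof. by rewrite invr_gt0. Qed.

Lemma gridup_cvg t : 0 <= t -> gridup (mesh n) t @[n --> \oo] --> t.
Proof.
move=> t0; apply: (@squeeze_cvgr _ _ _ _ (cst t) (fun n => t + mesh n)).
- apply: nearW => n; have /andP[h1 h2] := gridup_itv (mesh_gt0 n) t0.
  by rewrite h2 (ltW h1).
- exact: cvg_cst.
- rewrite -[X in _ --> X]addr0; apply: cvgD; first exact: cvg_cst.
  exact: cvg_harmonic.
Qed.

Lemma cvg_right_seq (U : topologicalType) (p : R -> U) (t : R) (u : nat -> R) :
  p x @[x --> t^'+] --> p t -> (forall n, t < u n) -> u n @[n --> \oo] --> t ->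
  p (u n) @[n --> \oo] --> p t.
Proof.
move=> pt tu ut; apply: cvg_comp pt.
move=> A [e e0 he]; have := ut (ball t e) (nbhsx_ballx t e e0).
by case=> N _ hN; exists N => // n /hN h; apply: he => //=.
Qed.


Lemma at_right_shift (t r : R) : (x - r) @[x --> t^'+] --> (t - r)^'+.
Proof.
move=> A [e /= e0 he]; exists e => //= x xe tx; apply: he => /=.
  by rewrite opprB addrA subrK.
by rewrite ltrD2r.
Qed.

Lemma at_left_shift (t r : R) : (x - r) @[x --> t^'-] --> (t - r)^'-.
Proof.
move=> A [e /= e0 he]; exists e => //= x xe tx; apply: he => /=.
  by rewrite opprB addrA subrK.
by rewrite ltrD2r.
Qed.

Definition cpath p b (v : R -> R) (t : R) : R :=
  if (t%:E < hit p b)%E then p t else v (t - fine (hit p b)).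

Lemma cpath_lt p b v t : (t%:E < hit p b)%E -> cpath p b v t = p t.
Proof. by rewrite /cpath => ->. Qed.

Lemma cpath_ge p b v t : (hit p b <= t%:E)%E ->
  cpath p b v t = v (t - fine (hit p b)).
Proof. by rewrite leNgt /cpath => /negbTE ->. Qed.

Lemma hit_fineK p b t : (hit p b <= t%:E)%E -> hit p b = (fine (hit p b))%:E.
Proof.
move=> h; rewrite fineK// ge0_fin_numE; first exact: (le_lt_trans h (ltry _)).
exact: hit_ge0.
Qed.

(** At the junction the left limit comes from [p], while the value and the right limit come from [v]
    at time zero. *)
Lemma cadlag_cpath p b v : cadlag p -> cadlag v -> cadlag (cpath p b v).
Proof.
move=> [prc plc] [vrc vlc]; split => t t0.
  have [Tt|tT] := leP (hit p b) t%:E.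
    have TE := hit_fineK Tt; set r := fine (hit p b) in TE.
    have rt : r <= t by rewrite -lee_fin -TE.
    rewrite (cpath_ge _ Tt) -/r.
    have h : v (x - r) @[x --> t^'+] --> v (t - r).
      by apply: cvg_comp (@at_right_shift t r) _; apply: vrc; rewrite subr_ge0.
    apply: cvg_trans h; apply: near_eq_cvg; near=> x.
    by rewrite cpath_ge// TE lee_fin (le_trans rt).
  rewrite (cpath_lt _ tT); apply: cvg_trans (prc t t0).
  apply: near_eq_cvg; near=> x; rewrite cpath_lt//.
  near: x; move: tT; case: (hit p b) => [r| |]//.
    rewrite lte_fin => tr; have := nbhs_right_lt tr.
    by apply: filterS => x; rewrite lte_fin.
  by move=> _; apply: nearW => x; rewrite ltry.
have [tT|Tt] := leP t%:E (hit p b).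
  have [l pl] := plc t t0; exists l; apply: cvg_trans pl.
  apply: near_eq_cvg; near=> x; rewrite cpath_lt//.
  apply: lt_le_trans tT; rewrite lte_fin; near: x; exact: nbhs_left_lt.
have TE := hit_fineK (ltW Tt); set r := fine (hit p b) in TE.
have rt : r < t by rewrite -lte_fin -TE.
have [|l vl] := vlc (t - r); first by rewrite subr_gt0.
exists l; have h := cvg_comp _ _ (@at_left_shift t r) vl.
apply: cvg_trans h; apply: near_eq_cvg; near=> x.
rewrite cpath_ge// TE lee_fin.
by near: x; exact: nbhs_left_ge.
Unshelve. all: by end_near. Qed.

End hitting_times.

(** * The simple and strong Markov properties *)

Section CbE_functions.
Context {R : realType}.
Implicit Types f g : R -> R.

(** Values of [f] off [E] are uncontrolled; clamping the argument gives a function continuous on the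
    whole line, hence Borel, with the same values on [E]. *)
Lemma CbE_ext f : CbE f -> continuous (fun y : R => f (Num.max 0 y) : R).
Proof.
move=> [/subspace_continuousP cf _] y.
have Ey : @Eset R (Num.max 0 y) by rewrite /Eset/= le_max lexx.
apply: (@cvg_comp _ _ _ (fun y => Num.max 0 y) f _ (within Eset (nbhs (Num.max
  0 y)))); last exact: cf.
have mc : {for y, continuous (fun y : R => Num.max 0 y)}.
  by apply: (@continuous_max R R (cst 0) id); [exact: cst_continuous|exact: cvg_id].
move=> U hU; change (nbhs y [set z : R | U (Num.max 0 z)]).
have h : \forall z \near y, Eset (Num.max 0 z) -> U (Num.max 0 z) by exact: mc _ hU.
by apply: filterS h => z; apply; rewrite /Eset/= le_max lexx.
Qed.

Lemma CbE_cont f : continuous f -> (exists M, forall y, `|f y| <= M) -> CbE f.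
Proof.
by move=> cf [M fM]; split; [exact: continuous_subspaceT|exists M => y _].
Qed.

Lemma CbE_test f : test01 f -> CbE f.
Proof.
move=> [cf f01]; apply: CbE_cont => //; exists 1 => y.
by have /andP[? ?] := f01 y; rewrite ger0_norm.
Qed.

Lemma CbE_cst (c : R) : CbE (fun=> c).
Proof. by apply: CbE_cont; [exact: cst_continuous|exists `|c|]. Qed.

Lemma CbEM f g : CbE f -> CbE g -> CbE (fun y => f y * g y).
Proof.
move=> [cf [M fM]] [cg [N gN]]; split.
  by move=> y; apply: cvgM; [exact: cf|exact: cg].
exists (M * N) => y Ey; rewrite normrM ler_pM//; [exact: fM|exact: gN].
Qed.

Definition goodl (l : seq (R * (R -> R))) :=
  forall p, p \in l -> 0 <= p.1 /\ CbE p.2.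

Definition testl (l : seq (R * (R -> R))) :=
  forall p, p \in l -> 0 <= p.1 /\ test01 p.2.

Lemma testl_goodl l : testl l -> goodl l.
Proof. by move=> h p /h[p0 /CbE_test]. Qed.

Lemma goodl_cons p l : goodl (p :: l) <-> (0 <= p.1 /\ CbE p.2) /\ goodl l.
Proof.
split; first by move=> h; split => [|q ql]; apply: h; rewrite inE ?eqxx ?ql ?orbT.
by move=> [h1 h2] q; rewrite inE => /orP[/eqP->|/h2].
Qed.

Lemma testl_cons p l : testl (p :: l) <-> (0 <= p.1 /\ test01 p.2) /\ testl l.
Proof.
split; first by move=> h; split => [|q ql]; apply: h; rewrite inE ?eqxx ?ql ?orbT.
by move=> [h1 h2] q; rewrite inE => /orP[/eqP->|/h2].
Qed.

(** Turns absolute times into the successive waiting times expected by [fdd_prod] and [iter_sg];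
    sorting the list first makes them nonnegative. *)
Fixpoint incr (t0 : R) (l : seq (R * (R -> R))) :=
  if l is p :: l' then (p.1 - t0, p.2) :: incr p.1 l' else [::].

Definition le_time (p q : R * (R -> R)) := p.1 <= q.1.

Lemma le_time_total : total le_time.
Proof. by move=> p q; exact: le_total. Qed.

Lemma testl_incr (t0 : R) (l : seq (R * (R -> R))) :
  path le_time (t0, cst 0) l -> tests l -> testl (incr t0 l).
Proof.
elim: l t0 => //= p l ih t0 /andP[tp pl] tl.
apply/testl_cons; split.
  by split; [rewrite subr_ge0|exact: (tl p (mem_head _ _))].
apply: ih; last by move=> q ql; apply: tl; rewrite inE ql orbT.
by case: l pl {tl} => //= q l /andP[-> ->].
Qed.

Lemma sorted_path (l : seq (R * (R -> R))) :
  (forall p, p \in l -> 0 <= p.1) -> path le_time (0, cst 0) (sort le_time l).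
Proof.
move=> l0; have E p : p \in sort le_time l -> 0 <= p.1 by rewrite mem_sort => /l0.
have := sort_sorted le_time_total l; case: (sort _ _) E => //= p l' E ->.
by rewrite andbT /le_time/=; exact: (E p (mem_head _ _)).
Qed.

Lemma fdd_prod_incr (d : measure_display) (T : measurableType d) (Z : R -> T ->
  R) u t0 l s w :
  fdd_prod Z (incr t0 l ++ s) (u + t0) w =
  prodl (fun t => Z (u + t)) l w * fdd_prod Z s (u + last t0 (map fst l)) w.
Proof.
elim: l t0 => [|p l ih] t0 /=; first by rewrite /prodl big_nil mul1r.
by rewrite -addrA (addrC t0) subrK ih /prodl big_cons mulrA.
Qed.

Lemma prodl_perm (T : Type) (Z : R -> T -> R) l l' w :
  perm_eq l l' -> prodl Z l w = prodl Z l' w.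
Proof. by move=> ll'; rewrite /prodl (perm_big _ ll'). Qed.

Lemma prodl_map (T : Type) (Z : R -> T -> R) (h : R -> R) l w :
  prodl Z [seq (h p.1, p.2) | p <- l] w = prodl (fun t => Z (h t)) l w.
Proof. by rewrite /prodl big_map. Qed.

Lemma tests_map (h : R -> R) l : tests l -> tests [seq (h p.1, p.2) | p <- l].
Proof. by move=> tl _ /mapP[p pl ->]; exact: tl pl. Qed.

Lemma iter_sg_cat (Sg : R -> (R -> R) -> R -> R) s s1 s2 :
  iter_sg Sg s1 = iter_sg Sg s2 -> iter_sg Sg (s ++ s1) = iter_sg Sg (s ++ s2).
Proof. by move=> e; elim: s => //= -[dt f] s ->. Qed.

End CbE_functions.

Lemma integral01 (d : measure_display) (T : measurableType d) (R : realType)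
    (P : probability T R) (f : T -> R) : measurable_fun setT f ->
  (forall w, 0 <= f w <= 1) -> 0 <= fine (\int[P]_w (f w)%:E)%E <= 1.
Proof.
move=> mf f01; rewrite fine_ge0/=; last first.
  by apply: integral_ge0 => w _; rewrite lee_fin; case/andP: (f01 w).
rewrite -lee_fin fineK; last first.
  apply: (@integral_bounded_fin_num _ _ _ _ _ 1) => // w.
  by have /andP[? ?] := f01 w; rewrite ger0_norm.
apply: (@le_trans _ _ (\int[P]_w (cst 1%:E) w)%E).
  apply: ge0_le_integral => //.
  - by move=> w _; rewrite lee_fin; case/andP: (f01 w).
  - exact/measurable_EFinP.
  - by move=> w _; rewrite lee_fin; case/andP: (f01 w).
by rewrite integral_cst// [X in (_ * X)%E](probability_setT P) mule1.
Qed.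

(** * The Markov property at a fixed time, for general past events *)

Section simple_markov.
Context {R : realType} {d : measure_display} {Omega : measurableType d}.
Variables (P : R -> probability Omega R) (X : R -> Omega -> R).
Hypothesis mX : forall t, measurable_fun setT (X t).
Hypothesis XE : forall t w, 0 <= t -> Eset (X t w).
Hypothesis XM : markov_fdd Eset CbE P X.
Hypothesis Xi : forall f t, CbE f -> 0 <= t -> CbE (semigroup P X t f).

Local Notation Sg := (semigroup P X).

Lemma CbE_X f t : CbE f -> 0 <= t -> measurable_fun setT (fun w => f (X t w)).
Proof.
move=> cf t0.
rewrite (_ : (fun w => _) = (fun y => f (Num.max 0 y)) \o X t).
  apply: measurableT_comp => //.
  exact: (continuous_measurable_fun (CbE_ext cf)).
by apply/funext => w /=; rewrite max_r//; exact: XE.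
Qed.

Lemma iter_CbE s : goodl s -> CbE (iter_sg Sg s).
Proof.
elim: s => [|[dt f] s ih] /=; first by move=> _; exact: CbE_cst.
by move=> /goodl_cons[[dt0 cf] /ih cs]; apply: Xi => //; exact: CbEM.
Qed.

Lemma iter01 s y : testl s -> 0 <= iter_sg Sg s y <= 1.
Proof.
elim: s y => [|[dt f] s ih] y /=; first by rewrite ler01 lexx.
move=> /testl_cons[[/= dt0 tf] ts]; apply: integral01.
  apply: (@CbE_X (fun y => f y * iter_sg Sg s y)) => //.
  by apply: CbEM; [exact: CbE_test|exact/iter_CbE/testl_goodl].
move=> w; have /andP[h1 h2] := ih (X dt w) ts.
have [_ /(_ (X dt w))/andP[h3 h4]] := tf.
by rewrite mulr_ge0//= mulr_ile1.
Qed.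

Lemma fdd01 (d' : measure_display) (T : measurableType d') (Z : R -> T -> R) s
  t w : testl s -> 0 <= fdd_prod Z s t w <= 1.
Proof.
elim: s t => [|[dt f] s ih] t /=; first by rewrite ler01 lexx.
move=> /testl_cons[[/= dt0 [_ tf]] ts].
have /andP[h1 h2] := ih (t + dt) ts; have /andP[h3 h4] := tf (Z (t + dt) w).
by rewrite mulr_ge0//= mulr_ile1.
Qed.

Lemma measurable_fdd s t : goodl s -> 0 <= t -> measurable_fun setT (fdd_prod X s t).
Proof.
elim: s t => [|[dt f] s ih] t //= /goodl_cons[[/= dt0 cf] gs] t0.
by apply: measurable_funM; [apply: CbE_X => //|apply: ih => //]; rewrite addr_ge0.
Qed.

Lemma fdd_bounded s t : goodl s -> 0 <= t ->
  exists M, forall w, `|fdd_prod X s t w| <= M.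
Proof.
elim: s t => [|[dt f] s ih] t /=; first by exists 1 => w; rewrite normr1.
move=> /goodl_cons[[/= dt0 [_ [M fM]]] gs] t0.
have [|N hN] := ih (t + dt) gs; first by rewrite addr_ge0.
exists (M * N) => w; rewrite normrM ler_pM//; apply: fM; apply: XE.
by rewrite addr_ge0.
Qed.

Lemma markov_eint x s : Eset x -> goodl s ->
  (\int[P x]_w (fdd_prod X s 0 w)%:E)%E = (iter_sg Sg s x)%:E.
Proof.
move=> Ex gs; rewrite -(XM Ex gs) fineK//.
have [M hM] := fdd_bounded gs (lexx 0).
exact: (integral_bounded_fin_num _ (measurable_fdd gs (lexx 0)) hM).
Qed.

Lemma sorted_times (l : seq (R * (R -> R))) (r : R) :
  (forall p, p \in l -> 0 <= p.1 <= r) -> 0 <= r ->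
  exists l', [/\ perm_eq l l', path le_time (0, cst 0) l' &
     last 0 (map fst l') <= r].
Proof.
move=> lr r0; exists (sort le_time l).
have E : forall p, p \in sort le_time l -> 0 <= p.1 <= r by move=> p;
  rewrite mem_sort => /lr.
split.
- by rewrite perm_sym perm_sort.
- by apply: sorted_path => p /lr/andP[].
- elim/last_ind: (sort le_time l) E => //= l' p _ E.
  rewrite map_rcons last_rcons.
  by have := E p; rewrite mem_rcons mem_head => /(_ isT)/andP[].
Qed.

(** Two lists with the same iterated semigroup are compared: after the tests of the past, one waits
    until [r] with the constant test 1 and goes on with [s], the other ends at [r] with the test
    [iter_sg Sg s]. *)
Lemma markov_fixed x l s r : Eset x -> 0 <= r -> tests l ->
  (forall p, p \in l -> 0 <= p.1 <= r) -> goodl s ->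
  (\int[P x]_w (prodl X l w * fdd_prod X s r w)%:E =
   \int[P x]_w (prodl X l w * iter_sg Sg s (X r w))%:E)%E.
Proof.
move=> Ex r0 tl lr gs; have [l' [ll' pl' lastr]] := sorted_times lr r0.
have tl' : tests l' by move=> p; rewrite -(perm_mem ll'); exact: tl.
set v := last 0 (map fst l') in lastr.
have gi : goodl (incr 0 l') by apply: testl_goodl; exact: testl_incr.
have cat_good s' : goodl s' -> goodl (incr 0 l' ++ s').
  by move=> gs' p; rewrite mem_cat => /orP[]; [exact: gi|exact: gs'].
have g1 : goodl (incr 0 l' ++ (r - v, cst 1) :: s).
  by apply: cat_good; apply/goodl_cons; split => //; split;
    [rewrite subr_ge0|exact: CbE_cst].
have g2 : goodl (incr 0 l' ++ [:: (r - v, iter_sg Sg s)]).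
  by apply: cat_good; apply/goodl_cons; split => //; split;
    [rewrite subr_ge0|exact: iter_CbE].
have := markov_eint Ex g1; have := markov_eint Ex g2.
rewrite (_ : iter_sg Sg (incr 0 l' ++ (r - v, cst 1) :: s) =
             iter_sg Sg (incr 0 l' ++ [:: (r - v, iter_sg Sg s)])); last first.
  by apply: iter_sg_cat => /=; congr (Sg _ _); apply/funext => y; rewrite mul1r mulr1.
move=> <- E.
have shift w s' : fdd_prod X (incr 0 l' ++ s') 0 w = prodl X l w * fdd_prod X s' v w.
  have := fdd_prod_incr X 0 0 l' s' w; rewrite !add0r => ->.
  rewrite (prodl_perm _ _ ll'); congr (_ * _).
  by congr prodl; apply/funext => t; rewrite add0r.
transitivity (\int[P x]_w (fdd_prod X (incr 0 l' ++ (r - v, cst 1) :: s) 0 w)%:E)%E.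
  by apply: eq_integral => w _; rewrite shift /= mul1r (addrC v) subrK.
rewrite E; apply: eq_integral => w _.
by rewrite shift /= mulr1 (addrC v) subrK.
Qed.

(* Nothing is known about [X] at negative times: the absolute value makes a path
   on the whole line out of the path on nonnegative times. *)
Definition clamp (r t : R) : R := Num.min `|t| r.

Lemma clamp_itv r t : 0 <= r -> 0 <= clamp r t <= r.
Proof. by move=> r0; rewrite /clamp le_min normr_ge0 r0/= ge_min lexx orbT. Qed.

Definition pathto (r : R) (w : Omega) : pathType R R := fun t => X (clamp r t) w.

(** The two weights of [law_determined] carry the functionals of the future; tests of the path
    frozen at [r] have their times in [[0, r]] and fall under [markov_fixed]. *)
Lemma markov_adapted x s r (B : set (pathType R R)) : Eset x -> 0 <= r ->
  testl s -> measurable B ->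
  (\int[P x]_(w in pathto r @^-1` B) (fdd_prod X s r w)%:E =
   \int[P x]_(w in pathto r @^-1` B) (iter_sg Sg s (X r w))%:E)%E.
Proof.
move=> Ex r0 ts mB; have gs := testl_goodl ts.
apply: (@law_determined R _ _ _ _ (P x) (P x) (fdd_prod X s r)
  (fun w => iter_sg Sg s (X r w)) (fun t => X (clamp r t)) (fun t => X (clamp r
    t))) => //.
- exact: measurable_fdd.
- by apply: CbE_X => //; exact: iter_CbE.
- by move=> w; exact: fdd01.
- by move=> w; exact: iter01.
- move=> l tl.
  under eq_integral do rewrite mulrC -(prodl_map X (clamp r)).
  rewrite markov_fixed//.
  + by under eq_integral do rewrite mulrC (prodl_map X (clamp r)).
  + exact: tests_map.
  + by move=> _ /mapP[p _ ->]; exact: clamp_itv.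
Qed.

(** For [r >= 0], this is the natural filtration at time [r]. *)
Definition adapted (r : R) (A : set Omega) :=
  measurable (A : set (g_sigma_algebra_preimageType (pathto r))).

Lemma adaptedP r A : adapted r A <->
  exists2 B : set (pathType R R), measurable B & A = pathto r @^-1` B.
Proof.
split; first by move=> [B mB <-]; exists B => //; rewrite setTI.
by move=> [B mB ->]; exists B => //; rewrite setTI.
Qed.

Lemma measurable_pathto r : measurable_fun setT (pathto r).
Proof. by apply: measurable_fun_path => t; exact: mX. Qed.

Lemma adapted_measurable r A : adapted r A -> measurable A.
Proof.
move=> /adaptedP[B mB ->]; rewrite -[X in measurable X]setTI.
exact: measurable_pathto.
Qed.

Lemma adapted_le r r' A : 0 <= r <= r' -> adapted r A -> adapted r' A.
Proof.
move=> /andP[r0 rr'] /adaptedP[B mB ->]; apply/adaptedP.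
pose h (p : pathType R R) : pathType R R := fun t => p (clamp r t).
exists (h @^-1` B).
  rewrite -[X in measurable X]setTI.
  have mh : measurable_fun setT h by apply: measurable_fun_path => t;
    exact: measurable_coord.
  exact: mh.
apply/seteqP; split=> w; rewrite /preimage /=;
  suff -> : pathto r w = h (pathto r' w) by [].
  apply/funext => t; rewrite /h /pathto; congr (X _ _).
  have /andP[h1 h2] := clamp_itv t r0.
  by rewrite {2}/clamp ger0_norm// min_l// (le_trans h2).
apply/funext => t; rewrite /h /pathto; congr (X _ _).
have /andP[h1 h2] := clamp_itv t r0.
by rewrite {2}/clamp ger0_norm// min_l// (le_trans h2).
Qed.

Lemma adapted_X r t (B : set R) : 0 <= t <= r -> measurable B ->
  adapted r [set w | B (X t w)].
Proof.
move=> /andP[t0 tr] mB; apply/adaptedP; exists [set p | B (p t)].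
  rewrite -[X in measurable X]setTI; exact: (@measurable_coord R _ R t).
by apply/seteqP; split => w; rewrite /preimage /pathto /clamp/= ger0_norm// min_l.
Qed.

End simple_markov.

Section evaluation_at_random_time.
Context {R : realType} {d : measure_display} {T : measurableType d}.

(** The grid time takes countably many values; where it is constant, [g] is evaluated at a fixed
    time. *)
Lemma measurable_grid (g : R -> T -> R) (tau : T -> R) (e : R) : 0 < e ->
  (forall t, 0 <= t -> measurable_fun setT (g t)) ->
  measurable_fun setT tau -> (forall w, 0 <= tau w) ->
  measurable_fun setT (fun w => g (gridup e (tau w)) w).
Proof.
move=> e0 mg mtau tau0.
pose E k := [set w | k%:R * e <= tau w < k.+1%:R * e].
have mE k : measurable (E k).
  rewrite (_ : E k = tau @^-1` `[k%:R * e, k.+1%:R * e[%classic).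
    by rewrite -[X in measurable X]setTI; exact: mtau.
  by apply/seteqP; split => w /=; rewrite /E /= in_itv/=.
have -> : setT = \bigcup_k E k.
  apply/seteqP; split => // w _; exists (Num.truncn (tau w / e)) => //.
  exact/(gridupE _ e0 (tau0 w)).
apply/measurable_fun_bigcup => // k.
apply: (eq_measurable_fun (g (k.+1%:R * e))).
  by move=> w; rewrite inE => /(gridupE k e0 (tau0 w)) kw; rewrite /gridup kw.
by apply: measurable_funTS; apply: mg; rewrite mulr_ge0// ltW.
Qed.

Lemma measurable_random_time (g : R -> T -> R) (tau : T -> R) :
  (forall t, 0 <= t -> measurable_fun setT (g t)) ->
  (forall w t, 0 <= t -> g x w @[x --> t^'+] --> g t w) ->
  measurable_fun setT tau -> (forall w, 0 <= tau w) ->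
  measurable_fun setT (fun w => g (tau w) w).
Proof.
move=> mg rc mtau tau0.
apply: (@measurable_fun_cvg _ _ _ _ (fun n w => g (gridup (mesh n) (tau w)) w)).
  by move=> n; apply: measurable_grid => //; exact: mesh_gt0.
move=> w _; apply: (@cvg_right_seq _ _ (fun t => g t w)) (rc _ _ (tau0 w)) _ _.
  by move=> n; case/andP: (gridup_itv (mesh_gt0 n) (tau0 w)).
exact: gridup_cvg.
Qed.

Lemma integral_indic_mul (P : probability T R) (D : set T) (g : T -> R) :
  (\int[P]_(w in D) (g w)%:E = \int[P]_w (\1_D w * g w)%:E)%E.
Proof.
rewrite integral_mkcond; apply: eq_integral => w _.
by rewrite /patch indicE; case: ifPn => _; rewrite ?mul1r ?mul0r.
Qed.

End evaluation_at_random_time.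

(** * The strong Markov property at the passage below a level *)

Section strong_markov.
Context {R : realType} {d : measure_display} {Omega : measurableType d}.
Variables (P : R -> probability Omega R) (X : R -> Omega -> R).
Hypothesis mX : forall t, measurable_fun setT (X t).
Hypothesis XE : forall t w, 0 <= t -> Eset (X t w).
Hypothesis Xc : forall w, cadlag (fun t => X t w).
Hypothesis Xj : forall w, no_neg_jumps (fun t => X t w).
Hypothesis X0 : forall x, Eset x -> P x [set w | X 0 w = x] = 1%E.
Hypothesis XM : markov_fdd Eset CbE P X.
Hypothesis Xi : forall f t, CbE f -> 0 <= t -> CbE (semigroup P X t f).

Local Notation Sg := (semigroup P X).

Variables (x b : R).
Hypotheses (b0 : 0 <= b) (bx : b < x).

Let T (w : Omega) : \bar R := hit (X ^~ w) b.

Let Ex : Eset x. Proof. by rewrite /Eset/= (le_trans b0) ?ltW. Qed.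

Lemma adapted_hit_lt s : adapted X s [set w | (T w < s%:E)%E].
Proof.
have [s0|s0] := ltP s 0.
  rewrite (_ : [set w | _] = set0); first exact: measurable0.
  apply/seteqP; split => // w /=; apply/negP; rewrite -leNgt.
  by apply: le_trans (hit_ge0 _ _); rewrite lee_fin ltW.
pose F (q : rat) := if ((0:R) <= ratr q) && (ratr q < s)
  then [set w | X (ratr q) w < b] else set0.
rewrite (_ : [set w | _] = \bigcup_q F q); last first.
  apply/seteqP; split => w /=.
    move=> /(hit_lt_ratP _ _ (Xc w))[q [q0 qs qb]].
    by exists q => //; rewrite /F q0 qs.
  move=> [q _]; rewrite /F; case: ifPn => // /andP[q0 qs] qb.
  by apply/(hit_lt_ratP _ _ (Xc w)); exists q.
apply: bigcupT_measurable_rat => q; rewrite /F; case: ifPn => [/andP[q0 qs]|_].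
  have := @adapted_X _ _ _ X s (ratr q) `]-oo, b[%classic.
  rewrite q0 (ltW qs) => /(_ isT (measurable_itv _)).
  by congr adapted; apply/seteqP; split => w /=; rewrite in_itv.
exact: measurable0.
Qed.

(** Known only just after [s]: the event is an intersection of strict ones with bounds decreasing to
    [s], cut at [r] to remain adapted. *)
Lemma adapted_hit_le s r : s < r -> adapted X r [set w | (T w <= s%:E)%E].
Proof.
move=> sr; have [s0|s0] := ltP s 0.
  rewrite (_ : [set w | _] = set0); first exact: measurable0.
  apply/seteqP; split => // w /=; apply/negP; rewrite -ltNge.
  by apply: lt_le_trans (hit_ge0 _ _); rewrite lte_fin.
rewrite (_ : [set w | _] =
  \bigcap_n [set w | (T w < (Num.min (s + mesh n) r)%:E)%E]).
  apply: bigcapT_measurable => n; apply: adapted_le; last exact: adapted_hit_lt.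
  rewrite le_min ge_min lexx orbT andbT (le_trans s0 (ltW sr)) andbT.
  by rewrite addr_ge0// ltW// mesh_gt0.
apply/seteqP; split => w /=.
  move=> Ts n _; apply: (le_lt_trans Ts).
  by rewrite lte_fin lt_min sr ltrDl mesh_gt0.
move=> h; rewrite leNgt; apply/negP => sT.
suff [n hn] : exists n, ((s + mesh n)%:E <= T w)%E.
  have /= := h n I; rewrite ltNge => /negP; apply.
  by apply: le_trans hn; rewrite lee_fin ge_min lexx.
move: sT; case: (T w) => [t| |] //; last by exists 0%N; rewrite leey.
rewrite lte_fin => st.
have /cvgrPdist_lt/(_ (t - s)) := @cvg_harmonic R.
rewrite subr_gt0 => /(_ st)[N _ /(_ N (leqnn N))] /=.
rewrite sub0r normrN ger0_norm// => h'; exists N.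
by rewrite lee_fin -lerBrDl ltW.
Qed.

(* The events known right after the hitting time, i.e. [F_(T+)]. *)
Definition past (A : set Omega) := measurable A /\
  forall r, adapted X r (A `&` [set w | (T w < r%:E)%E]).

Lemma past_sigma_algebra : sigma_algebra setT past.
Proof.
split.
- by split=> // r; rewrite set0I; exact: measurable0.
- move=> A [mA hA]; split; first exact: measurableD.
  move=> r; rewrite (_ : _ `&` _ = [set w | (T w < r%:E)%E] `\`
     (A `&` [set w | (T w < r%:E)%E])).
    by apply: measurableD; [exact: adapted_hit_lt|exact: hA].
  apply/seteqP; split => w /=.
    by move=> [[_ nA] Tr]; split => // -[].
  by move=> [Tr nA]; split => //; split => // Aw; apply: nA.
- move=> F hF; split; first by apply: bigcupT_measurable => n; case: (hF n).
  by move=> r; rewrite setI_bigcupl; apply: bigcupT_measurable => n; exact: (hF n).2 r.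
Qed.

Lemma measurable_pastE (A : set Omega) :
  @measurable _ (g_sigma_algebraType past) A = past A.
Proof. by rewrite measurable_g_measurableTypeE//; exact: past_sigma_algebra. Qed.

Lemma measurable_hit_le s : measurable [set w | (T w <= s%:E)%E].
Proof.
apply: (@adapted_measurable _ _ _ _ mX (s + 1)).
by apply: adapted_hit_le; rewrite ltrDl.
Qed.

Lemma measurable_hit_lt s : measurable [set w | (T w < s%:E)%E].
Proof. exact: (adapted_measurable mX (adapted_hit_lt s)). Qed.

Lemma past_hit_le s : past [set w | (T w <= s%:E)%E].
Proof.
split; first exact: measurable_hit_le.
move=> r; have [rs|sr] := leP r s.
  rewrite (_ : _ `&` _ = [set w | (T w < r%:E)%E]); first exact: adapted_hit_lt.
  apply/seteqP; split => [w []//|w /= Tr]; split => //.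
  by rewrite (le_trans (ltW Tr))// lee_fin.
rewrite (_ : _ `&` _ = [set w | (T w <= s%:E)%E]); first exact: adapted_hit_le.
apply/seteqP; split => [w []//|w /= Ts]; split => //.
by rewrite (le_lt_trans Ts)// lte_fin.
Qed.

(** Together with [past_hit_le], this covers all that a concatenation reads of its first path. *)
Lemma past_X t (B : set R) : 0 <= t -> measurable B ->
  past [set w | (t%:E < T w)%E /\ B (X t w)].
Proof.
move=> t0 mB.
have E : [set w | (t%:E < T w)%E /\ B (X t w)] =
    ~` [set w | (T w <= t%:E)%E] `&` [set w | B (X t w)].
  by apply/seteqP; split => w /= []; rewrite ltNge => /negP.
rewrite E; split.
  apply: measurableI; first exact/measurableC/measurable_hit_le.
  by rewrite -[X in measurable X]setTI; exact: mX.
move=> r; have [rt|tr] := leP r t.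
  rewrite (_ : _ `&` _ = set0); first exact: measurable0.
  apply/seteqP; split => // w /= [[h _] Tr]; apply: h.
  by rewrite (le_trans (ltW Tr))// lee_fin.
apply: measurableI; last exact: adapted_hit_lt.
apply: measurableI; first by apply: measurableC; exact: adapted_hit_le.
by apply: adapted_X => //; rewrite t0 ltW.
Qed.

Let Fin := [set w | (T w < +oo)%E].

Let T_ge0 w : (0 <= T w)%E. Proof. exact: hit_ge0. Qed.

Let tau w := fine (T w).

Let tau_ge0 w : 0 <= tau w. Proof. exact/fine_ge0/T_ge0. Qed.

Lemma measurable_hit : measurable_fun setT (fun w => hit (X ^~ w) b).
Proof.
apply: (measurability (@ErealGenInftyO.G R)); first exact: ErealGenInftyO.measurableE.
move=> _ [_ [s ->] <-]; rewrite setTI.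
rewrite (_ : _ @^-1` _ = [set w | (T w < s%:E)%E]); first exact: measurable_hit_lt.
by apply/seteqP; split => w; rewrite /preimage /= in_itv.
Qed.

Let mtau : measurable_fun setT tau.
Proof. by apply: measurableT_comp => //; exact: measurable_hit. Qed.

Lemma measurable_hit_fin : measurable [set w | (hit (X ^~ w) b < +oo)%E].
Proof.
rewrite (_ : [set w | _] = \bigcup_n [set w | (T w < n%:R%:E)%E]).
  by apply: bigcupT_measurable => n; exact: measurable_hit_lt.
apply/seteqP; split => w /=.
  move=> Tf; exists (Num.truncn (tau w)).+1 => //=.
  have -> : T w = (tau w)%:E by rewrite fineK// ge0_fin_numE.
  by rewrite lte_fin; case/andP: (truncn_itv (tau_ge0 w)).
by move=> [n _ /= Tn]; rewrite (lt_trans Tn)// ltry.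
Qed.

Lemma fdd_right_cvg s w t (u : nat -> R) : testl s -> 0 <= t ->
  (forall n, t < u n) -> u n @[n --> \oo] --> t ->
  fdd_prod X s (u n) w @[n --> \oo] --> fdd_prod X s t w.
Proof.
move=> + + + +; elim: s t u => [|[dt f] s ih] t u /=.
  by move=> _ _ _ _; exact: cvg_cst.
move=> /testl_cons[[/= dt0 [cf _]] ts] t0 tu ut.
have t0' : 0 <= t + dt by rewrite addr_ge0.
have tu' n : t + dt < u n + dt by rewrite ltrD2r.
have ut' : u n + dt @[n --> \oo] --> t + dt by apply: cvgD => //; exact: cvg_cst.
apply: cvgM; last exact: (ih (t + dt) (fun n => u n + dt)).
apply: continuous_cvg; first exact: cf.
exact: (@cvg_right_seq _ _ (fun t => X t w) (t + dt) (fun n => u n + dt) ((Xc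
  w).1 _ t0')).
Qed.

Let tn n w := gridup (mesh n) (tau w).

Let tn_gt n w : tau w < tn n w.
Proof. by case/andP: (gridup_itv (mesh_gt0 n) (tau_ge0 w)). Qed.

Let tn_cvg w : tn n w @[n --> \oo] --> tau w.
Proof. exact: gridup_cvg. Qed.

(* The hitting time is replaced by the next grid time, which takes countably many
   values. Only right limits are available, so the passage to the limit is done
   with the times following the hitting time held fixed. *)
Let strong_markov_grid A s n : past A -> testl s ->
  (\int[P x]_(w in A `&` Fin) (fdd_prod X s (tn n w) w)%:E =
   \int[P x]_(w in A `&` Fin) (iter_sg Sg s (X (tn n w) w))%:E)%E.
Proof.
move=> [mA hA] ts; pose e : R := mesh n; have e0 : 0 < e := mesh_gt0 n.
(* [D k] is the part of [A] where the grid time equals [(k + 1) e]. It is adapted at that time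
   because the passage occurs strictly before. *)
pose D k := A `&` [set w | (T w < (k.+1%:R * e)%:E)%E] `\`
  [set w | (T w < (k%:R * e)%:E)%E].
have AFE : A `&` Fin = \bigcup_k D k.
  apply/seteqP; split => w.
    move=> [Aw Fw]; exists (Num.truncn (tau w / e)) => //.
    have /andP[h1 h2] := (gridupE (Num.truncn (tau w / e)) e0 (tau_ge0 w)).1 erefl.
    have TE : T w = (tau w)%:E by rewrite fineK// ge0_fin_numE.
    by split; [split => //=; rewrite TE lte_fin|rewrite /= TE lte_fin;
      apply/negP; rewrite -leNgt].
  by move=> [k _ [[Aw /= Tk] _]]; split => //; rewrite /Fin/= (lt_trans Tk)// ltry.
have DE k w : D k w -> tn n w = k.+1%:R * e.
  move=> [[_ /= Tk] /negP]; rewrite -leNgt => kT.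
  have TE : T w = (tau w)%:E by rewrite fineK// ge0_fin_numE// (lt_trans Tk)// ltry.
  rewrite /tn /gridup; congr (_.+1%:R * _).
  by apply/(gridupE _ e0 (tau_ge0 w)); rewrite -lte_fin -lee_fin -TE kT.
have aD k : adapted X (k.+1%:R * e) (D k).
  apply: measurableD; first exact: hA.
  apply: adapted_le; last exact: adapted_hit_lt.
  by rewrite mulr_ge0 ?ler_wpM2r ?ler_nat// ltW.
have tD : trivIset setT D.
  apply/trivIsetP => i j _ _; wlog : i j / (i < j)%N.
    move=> h ij; have := ij; rewrite neq_ltn => /orP[|] lt; first exact: h.
    by rewrite setIC; apply: h => //; rewrite eq_sym.
  move=> ij _; apply/seteqP; split => // w [Di Dj].
  have := DE _ _ Di; rewrite (DE _ _ Dj) => /(mulIf (lt0r_neq0 e0))/eqP.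
  by rewrite eqr_nat eqSS => /eqP ji; rewrite ji ltnn in ij.
have m1 : measurable_fun setT (fun w => fdd_prod X s (tn n w) w).
  apply: measurable_grid => // t t0.
  by apply: measurable_fdd => //; exact: testl_goodl.
have m2 : measurable_fun setT (fun w => iter_sg Sg s (X (tn n w) w)).
  apply: (@measurable_grid _ _ _ (fun t w => iter_sg Sg s (X t w))) => // t t0.
  by apply: CbE_X => //; apply: iter_CbE => //; exact: testl_goodl.
have mD k : measurable (D k) := adapted_measurable mX (aD k).
rewrite AFE !ge0_integral_bigcup//; last 4 first.
- by apply/measurable_EFinP; exact: measurable_funTS.
- by move=> w _; rewrite lee_fin; case/andP: (iter01 mX XE Xi (X (tn n w) w) ts).
- by apply/measurable_EFinP; exact: measurable_funTS.
- by move=> w _; rewrite lee_fin; case/andP: (fdd01 X (tn n w) w ts).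
apply: eq_eseriesr => k _.
have /adaptedP[B mB DB] := aD k.
transitivity (\int[P x]_(w in D k) (fdd_prod X s (k.+1%:R * e) w)%:E)%E.
  by apply: eq_integral => w; rewrite inE => /DE ->.
transitivity (\int[P x]_(w in D k) (iter_sg Sg s (X (k.+1%:R * e) w))%:E)%E; last first.
  by apply: eq_integral => w; rewrite inE => /DE ->.
by rewrite DB; apply: markov_adapted => //; rewrite mulr_ge0// ltW.
Qed.

(** As the grid time tends to the passage time from the right, [fdd_prod] converges by
    right-continuity of the path and continuity of the tests. The iterated semigroup is continuous
    by (i) and the path is at [b] at the passage time, so the other side converges to a constant:
    hence the product form. *)
Lemma strong_markov_fdd A s : past A -> testl s ->
  (\int[P x]_w (\1_(A `&` [set w | hit (X ^~ w) b < +oo]%E) w *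
     fdd_prod X s (fine (hit (X ^~ w) b)) w)%:E =
   P x (A `&` [set w | hit (X ^~ w) b < +oo]) * (iter_sg Sg s b)%:E)%E.
Proof.
move=> pA ts; have [mA _] := pA.
have mAF : measurable (A `&` Fin) by apply: measurableI => //; exact: measurable_hit_fin.
have mfdd n : measurable_fun setT (fun w => fdd_prod X s (tn n w) w).
  apply: measurable_grid => //; first exact: mesh_gt0.
  by move=> t t0; apply: measurable_fdd => //; exact: testl_goodl.
have fcvg w : fdd_prod X s (tn n w) w @[n --> \oo] --> fdd_prod X s (tau w) w.
  exact: fdd_right_cvg.
have b1 (g : Omega -> R) w : 0 <= g w <= 1 -> `|\1_(A `&` Fin) w * g w| <= 1.
  move=> /andP[g0 g1]; rewrite indicE; case: (_ \in _); rewrite ?mul1r ?mul0r ?normr0//.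
  by rewrite ger0_norm.
have L1 : (\int[P x]_(w in A `&` Fin) (fdd_prod X s (tn n w) w)%:E)%E @[n --> \oo]
    --> (\int[P x]_w (\1_(A `&` Fin) w * fdd_prod X s (tau w) w)%:E)%E.
  under eq_fun do rewrite integral_indic_mul.
  apply: (@bounded_convergence _ _ _ _ _ _ 1).
  - by move=> n; apply: measurable_funM => //; exact: measurable_indic.
  - apply: measurable_funM; first exact: measurable_indic.
    by apply: (@measurable_fun_cvg _ _ _ _ (fun n w => fdd_prod X s (tn n w)
      w)) => // w _; exact: fcvg.
  - exists setT; split => //; first exact: probability_setT.
    by move=> w _; apply: cvgM; [exact: cvg_cst|exact: fcvg].
  - by move=> n w; apply: (b1 (fun w => fdd_prod X s (tn n w) w)); exact: fdd01.
have L2 : (\int[P x]_(w in A `&` Fin) (iter_sg Sg s (X (tn n w) w))%:E)%E @[n --> \oo]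
    --> (\int[P x]_w (\1_(A `&` Fin) w * iter_sg Sg s b)%:E)%E.
  under eq_fun do rewrite integral_indic_mul.
  apply: (@bounded_convergence _ _ _ _ _ _ 1).
  - move=> n; apply: measurable_funM; first exact: measurable_indic.
    apply: (@measurable_grid _ _ _ (fun t w => iter_sg Sg s (X t w))) => //.
      exact: mesh_gt0.
    move=> t t0; apply: CbE_X => //; apply: iter_CbE => //; exact: testl_goodl.
  - by apply: measurable_funM => //; exact: measurable_indic.
  (* Starting exactly at [x] puts the path above [b], as [hit_attained] requires. *)
  - exists [set w | X 0 w = x]; split.
    + have -> : [set w | X 0 w = x] = X 0 @^-1` [set x] by [].
      by rewrite -[X in measurable X]setTI; exact: mX.
    + exact: X0.
    + move=> w /= w0; rewrite indicE; case: (boolP (w \in _)); last first.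
        by move=> _; under eq_fun do rewrite mul0r; rewrite mul0r; exact: cvg_cst.
      rewrite inE => -[Aw Fw]; under eq_fun do rewrite mul1r; rewrite mul1r.
      have TE : hit (X ^~ w) b = (tau w)%:E by rewrite fineK// ge0_fin_numE.
      have bw : b < X 0 w by rewrite w0.
      have XT : X (tau w) w = b by exact: (@hit_attained R (X ^~ w) b (tau w)).
      have h : X (tn n w) w @[n --> \oo] --> b.
        rewrite -XT; apply: (@cvg_right_seq _ _ (fun t => X t w)) => //.
        exact: (Xc w).1.
      have cI := CbE_ext (iter_CbE Xi (testl_goodl ts)).
      have h2 : iter_sg Sg s (Num.max 0 (X (tn n w) w)) @[n --> \oo] -->
          iter_sg Sg s (Num.max 0 b).
        exact: (cvg_comp _ _ h (cI b)).
      rewrite (max_r b0) in h2; apply: cvg_trans h2; apply: near_eq_cvg.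
      apply: nearW => n; rewrite max_r//; apply: XE.
      exact/ltW/(le_lt_trans (tau_ge0 w)).
  - by move=> n w; apply: (b1 (fun w => iter_sg Sg s (X (tn n w) w))); exact: iter01.
have -> : (\int[P x]_w (\1_(A `&` Fin) w * fdd_prod X s (tau w) w)%:E =
    \int[P x]_w (\1_(A `&` Fin) w * iter_sg Sg s b)%:E)%E.
  rewrite -(cvg_lim _ L1)// -(cvg_lim _ L2)//.
  by under eq_fun do rewrite strong_markov_grid//.
under eq_integral do rewrite EFinM.
rewrite ge0_integralZr//.
- by rewrite integral_indic// setIT.
- by apply/measurable_EFinP; exact: measurable_indic.
- by rewrite lee_fin; case/andP: (iter01 mX XE Xi b ts).
Qed.


(** * Replacing the future after the passage by an independent path *)

Section concatenation.
Context {d2 : measure_display} {Omega2 : measurableType d2}.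
Variables (P2 : probability Omega2 R) (V : R -> Omega2 -> R).
Hypothesis mV : forall t, measurable_fun setT (V t).
Hypothesis Vc : forall w, cadlag (fun t => V t w).
Hypothesis VP : forall l, tests l ->
  (\int[P2]_w (prodl (fun t => V `|t|) l w)%:E =
   \int[P b]_w (prodl (fun t => X `|t|) l w)%:E)%E.

Let after (w : Omega) : pathType R R := fun t => X (tau w + `|t|) w.

Let mafter : measurable_fun setT after.
Proof.
apply: measurable_fun_path => t.
apply: (@measurable_random_time _ _ _ (fun u w => X u w)) => //.
- by move=> w u u0; exact: (Xc w).1.
- by apply: measurable_funD.
- by move=> w; rewrite addr_ge0.
Qed.

Let Vpath (w : Omega2) : pathType R R := fun t => V `|t| w.

Let mVpath : measurable_fun setT Vpath.
Proof. by apply: measurable_fun_path => t; exact: mV. Qed.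

(** The weights of [law_determined] are the indicator of the past event on which the passage occurs,
    and the constant probability of that event; the factorisation then reduces to products of tests,
    given by [strong_markov_fdd]. *)
Lemma strong_markov_law A (B : set (pathType R R)) : past A -> measurable B ->
  (P x (A `&` Fin `&` after @^-1` B) = P x (A `&` Fin) * P2 (Vpath @^-1` B))%E.
Proof.
move=> pA mB; have [mA _] := pA.
have mAF : measurable (A `&` Fin) by apply: measurableI => //; exact: measurable_hit_fin.
have fin_c : P x (A `&` Fin) \is a fin_num by exact: fin_num_measure.
have c01 : 0 <= fine (P x (A `&` Fin)) <= 1.
  by rewrite fine_ge0//= -lee_fin fineK// probability_le1.
have := @law_determined R _ _ _ _ (P x) P2 (\1_(A `&` Fin))
  (cst (fine (P x (A `&` Fin)))) (fun t w => after w t) (fun t w => Vpath w t).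
have mAB : measurable (after @^-1` B) by rewrite -[X in measurable X]setTI; exact: mafter.
have mVB : measurable (Vpath @^-1` B) by rewrite -[X in measurable X]setTI; exact: mVpath.
move=> /(_ _ _ _ _ _ _ _ B mB) h.
have {}h : (\int[P x]_(w in after @^-1` B) (\1_(A `&` Fin) w)%:E =
   \int[P2]_(w in Vpath @^-1` B) (fine (P x (A `&` Fin)))%:E)%E.
  apply: h.
  - exact: measurable_indic.
  - exact: measurable_cst.
  - by move=> w; rewrite indicE; case: (_ \in _); rewrite ?lexx ?ler01.
  - by [].
  - by move=> t; exact: (measurableT_comp (@measurable_coord R _ R t) mafter).
  - by move=> t; exact: mV.
  - move=> l tl.
    (* Test times are arbitrary reals in any order: absolute values, the only times read on both
       sides, are sorted to obtain admissible increments. *)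
    pose la := [seq (`|p.1|, p.2) | p <- l].
    have la0 p : p \in la -> 0 <= p.1 by move=> /mapP[q _ ->] /=.
    have pl' := sorted_path la0; set l' := sort le_time la in pl'.
    have ll' : perm_eq la l' by rewrite perm_sym perm_sort.
    have tl' : tests l' by move=> p; rewrite -(perm_mem ll'); apply: tests_map.
    have ti := testl_incr pl' tl'.
    have shift u w : fdd_prod X (incr 0 l') u w = prodl (fun t => X (u + `|t|)) l w.
      have := fdd_prod_incr X u 0 l' [::] w; rewrite /= cats0 addr0 mulr1 => ->.
      by rewrite -(prodl_perm _ _ ll') prodl_map.
    transitivity (P x (A `&` Fin) * (iter_sg Sg (incr 0 l') b)%:E)%E.
      rewrite -strong_markov_fdd//; apply: eq_integral => w _.
      by congr (_%:E); congr (_ * _); rewrite shift.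
    rewrite -(markov_eint mX XE XM) //; last exact: testl_goodl.
    transitivity ((fine (P x (A `&` Fin)))%:E *
        \int[P2]_w (prodl (fun t => V `|t|) l w)%:E)%E; last first.
      rewrite -ge0_integralZl//.
      - apply/measurable_EFinP; apply: measurable_prodl => [t|p pl].
          exact: mV.
        by apply: measurable_test01; exact: tl.
      - by move=> w _; rewrite lee_fin; case/andP: (prodl01 (fun t => V `|t|) w tl).
      - by rewrite lee_fin; case/andP: c01.
    rewrite fineK// (VP tl); congr (_ * _)%E.
    by apply: eq_integral => w _; rewrite shift; congr (prodl _ _ _)%:E;
      apply/funext => t; rewrite add0r.
move: h; rewrite integral_cst// fineK// => <-.
by rewrite integral_indic.
Qed.

Definition concat (t : R) (y : Omega2 * Omega) : R :=
  cpath (X ^~ y.2) b (V ^~ y.1) t.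

Let past_measT := g_sigma_algebraType past.

Let Vlaw : probability (pathType R R) R := pushp mVpath P2.

(* When level [b] is never reached the second path is irrelevant; taking the
   independent copy there makes the pair have a product law. *)
Let glue (y : Omega2 * Omega) : pathType R R * past_measT :=
  (if (T y.2 < +oo)%E then after y.2 else Vpath y.1, y.2).

Let mid : measurable_fun setT (fun w : Omega => (w : past_measT)).
Proof. by move=> _ A; rewrite measurable_pastE setTI => -[]. Qed.

(** The law [P x] on the coarser sigma-algebra [past]: the future is independent of these events,
    not of all events of [Omega]. *)
Let Px' : probability past_measT R := pushp mid (P x).

Let mFin2 : measurable [set y : Omega2 * Omega | (T y.2 < +oo)%E].
Proof.
rewrite -[X in measurable X]setTI.
exact: (@measurable_snd _ _ Omega2 Omega _ Fin measurable_hit_fin).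
Qed.

Let mglue : measurable_fun setT glue.
Proof.
apply: (measurable_fun_pair _ (measurableT_comp mid measurable_snd)).
apply: measurable_fun_ifT.
- apply: (measurable_fun_bool true).
  by rewrite setTI; exact: mFin2.
- exact: measurableT_comp.
- exact: measurableT_comp.
Qed.

(** Where the passage occurs this is [strong_markov_law]; elsewhere the independence is that of the
    product space. Both contributions share the law of [V] as a factor. *)
Let glue_rect (B : set (pathType R R)) (A : set Omega) :
  measurable B -> past A ->
  (P2 \x P x)%E (glue @^-1` (B `*` A)) = (P2 (Vpath @^-1` B) * P x A)%E.
Proof.
move=> mB pA.
have [mA _] := pA.
have mFin := measurable_hit_fin.
have mAB : measurable (after @^-1` B) by rewrite -[X in measurable X]setTI; exact: mafter.
have mVB : measurable (Vpath @^-1` B) by rewrite -[X in measurable X]setTI; exact: mVpath.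
rewrite (_ : glue @^-1` _ = (setT `*` (A `&` Fin `&` after @^-1` B)) `|`
    ((Vpath @^-1` B) `*` (A `\` Fin))); last first.
  apply/seteqP; split => -[w' w] /=.
    rewrite /glue /=; case: ifPn => h [Bw Aw]; [left|right]; split => //.
    by split => // /=; rewrite /Fin /= (negbTE h).
  move=> [[_ [[Aw Fw] Bw]]|[Bw [Aw nF]]]; rewrite /glue /=.
    by rewrite (Fw : (T w < +oo)%E).
  by case: ifPn => // h; exfalso; apply: nF.
have mAFB : measurable (A `&` Fin `&` after @^-1` B).
  by apply: measurableI => //; exact: measurableI.
have mAnF : measurable (A `\` Fin) by exact: measurableD.
rewrite measureU//; [|exact: measurableX|exact: measurableX|]; last first.
  by apply/seteqP; split => // -[w' w] [[_ [[_ Fw] _]] [_ [_ nF]]].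
rewrite [X in (X + _)%E]product_measure1E// [X in (_ + X)%E]product_measure1E//.
rewrite [X in (X * _)%E]probability_setT mul1e [X in (X + _)%E](strong_markov_law pA mB).
rewrite muleC -ge0_muleDr//; congr (_ * _)%E.
rewrite -measureU//; [|exact: measurableI|].
  by rewrite -setIUr ?setDE -?setIUr setUv setIT.
by apply/seteqP; split => // w [[_ Fw] [_ nF]].
Qed.

Let glue_law (D : set (pathType R R * past_measT)) : measurable D ->
  (P2 \x P x)%E (glue @^-1` D) = (Vlaw \x Px')%E D.
Proof.
move=> mD; rewrite -(pushmE mglue); apply/esym.
apply: product_measure_unique => // B A mB; rewrite measurable_pastE => pA.
exact: glue_rect.
Qed.

(* Rounding [t - tau] up to the grid makes this a measurable function of the past
   and of an arbitrary path, right-continuous or not. *)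
Let grid_concat (e : R) (t : R) (y : pathType R R * past_measT) : R :=
  if (t%:E < T y.2)%E then X t y.2 else y.1 (gridup e (t - tau y.2)).

Let measurable_past_le s : @measurable _ past_measT [set w | (T w <= s%:E)%E].
Proof. by rewrite measurable_pastE; exact: past_hit_le. Qed.

(** The past is sliced by the grid cell containing [t - tau]. On slice 0 the passage is still to
    come and the value is [X t]; on slice [j + 1] the value is the coordinate at the fixed time
    [(j + 1) e]. *)
Let mgrid_concat e t : 0 < e -> 0 <= t -> measurable_fun setT (grid_concat e t).
Proof.
move=> e0 t0.
pose E k : set past_measT := if k is j.+1 then
  [set w | (T w <= (t - j%:R * e)%:E)%E] `\`
    [set w | (T w <= (t - j.+1%:R * e)%:E)%E]
  else ~` [set w | (T w <= t%:E)%E].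
have mE k : measurable (E k).
  case: k => [|j]; first by apply: measurableC.
  exact: measurableD.
pose F k := (@snd (pathType R R) past_measT) @^-1` E k.
have mF k : measurable (F k).
  by rewrite -[X in measurable X]setTI; exact: measurable_snd.
have -> : setT = \bigcup_k F k.
  apply/seteqP; split => // -[p w] _.
  have [Tt|tT] := leP (T w) t%:E; last by exists 0%N => //=; apply/negP; rewrite -ltNge.
  have TE : T w = (tau w)%:E by rewrite fineK// ge0_fin_numE// (le_lt_trans Tt)// ltry.
  have tt : 0 <= t - tau w by rewrite subr_ge0 -lee_fin -TE.
  exists (Num.truncn ((t - tau w) / e)).+1 => //=.
  have /andP[h1 h2] := (gridupE (Num.truncn ((t - tau w) / e)) e0 tt).1 erefl.
  rewrite /F /= TE !lee_fin; split; first by rewrite lerBrDl -lerBrDr.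
  by apply/negP; rewrite -ltNge ltrBlDr -ltrBlDl.
apply/measurable_fun_bigcup => // -[|j].
  move=> _ B mB; rewrite (_ : _ `&` _ =
    (@snd (pathType R R) past_measT) @^-1` [set w | (t%:E < T w)%E /\ B (X t w)]).
    rewrite -[X in measurable X]setTI; apply: measurable_snd => //.
    by rewrite measurable_pastE; exact: past_X.
  apply/seteqP; split => -[p w] /=; rewrite /F /grid_concat /=.
    by move=> [/negP]; rewrite -ltNge => tT; rewrite tT.
  by move=> [tT]; rewrite tT => Bw; split => //; apply/negP; rewrite -ltNge.
apply: (eq_measurable_fun (fun y : pathType R R * past_measT => y.1 (j.+1%:R * e))).
  move=> -[p w]; rewrite inE /F /= => -[h1 /negP]; rewrite -ltNge => h2.
  have TE : T w = (tau w)%:E by rewrite fineK// ge0_fin_numE// (le_lt_trans h1)// ltry.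
  move: h1 h2; rewrite TE lee_fin lte_fin => h1 h2.
  have h0 : 0 <= j%:R * e by rewrite mulr_ge0// ltW.
  rewrite /grid_concat /= TE lte_fin ltNge (le_trans h1) ?gerBl//=.
  rewrite /gridup; congr (p (_.+1%:R * _)); apply/esym/gridupE => //.
    by rewrite subr_ge0 (le_trans h1)// gerBl.
  by rewrite lerBrDr -lerBrDl h1/= ltrBlDl -ltrBlDr.
apply: measurable_funTS.
exact: (measurableT_comp (@measurable_coord R _ R (j.+1%:R * e)) measurable_fst).
Qed.

(** [glue] mediates: it agrees with [after] wherever the first component is read, since reading it
    means that the passage has occurred, and by [glue_law] it has the law of an independent pair. *)
Let grid_law e l : 0 < e -> tests l -> (forall p, p \in l -> 0 <= p.1) ->
  (\int[P2 \x P x]_y (prodl (grid_concat e) l (after y.2, y.2))%:E =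
   \int[P2 \x P x]_y (prodl (grid_concat e) l (Vpath y.1, y.2))%:E)%E.
Proof.
move=> e0 tl l0.
have m1 : measurable_fun setT (prodl (grid_concat e) l).
  rewrite (_ : prodl _ _ = prodl (fun t => grid_concat e (Num.max 0 t)) l).
    apply: measurable_prodl => [t|p pl]; last by apply: measurable_test01; exact: tl.
    by apply: mgrid_concat => //; rewrite le_max lexx.
  apply/funext => y; rewrite /prodl; apply: eq_big_seq => p /l0 p0.
  by rewrite max_r.
transitivity (\int[P2 \x P x]_y (prodl (grid_concat e) l (glue y))%:E)%E.
  apply: eq_integral => y _; congr (_%:E); rewrite /prodl; apply: eq_bigr => p _.
  congr (p.2 _); rewrite /grid_concat /glue /=; case: ifPn => // h.
  have -> // : (T y.2 < +oo)%E.
  by apply: (@le_lt_trans _ _ (p.1)%:E); rewrite ?ltry// leNgt.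
rewrite -(ge0_integral_pushm mglue (P2 \x P x)%E (g := fun z => (prodl
  (grid_concat e) l z)%:E)); last 2 first.
- exact/measurable_EFinP.
- by move=> y; rewrite lee_fin; case/andP: (prodl01 (grid_concat e) y tl).
transitivity (\int[Vlaw \x Px']_z (prodl (grid_concat e) l z)%:E)%E.
  by apply: eq_measure_integral => D mD _; exact: glue_law.
have m2 : measurable_fun setT (fun y : Omega2 * Omega => (Vpath y.1, y.2 : past_measT)).
  apply: measurable_fun_pair.
    exact: (measurableT_comp mVpath measurable_fst).
  exact: (measurableT_comp mid measurable_snd).
rewrite -(ge0_integral_pushm m2 (P2 \x P x)%E (g := fun z => (prodl
  (grid_concat e) l z)%:E)); last 2 first.
- exact/measurable_EFinP.
- by move=> y; rewrite lee_fin; case/andP: (prodl01 (grid_concat e) y tl).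
apply: eq_measure_integral => D mD _.
apply: product_measure_unique => // B A mB; rewrite measurable_pastE => -[mA _].
have mVB : measurable (Vpath @^-1` B) by rewrite -[X in measurable X]setTI; exact: mVpath.
exact: (product_measure1E P2 (P x) mVB mA).
Qed.

Let grid_concat_cvg t (y : Omega2 * Omega) : 0 <= t ->
  grid_concat (mesh n) t (Vpath y.1, y.2) @[n --> \oo] --> concat t y.
Proof.
move=> t0; rewrite /grid_concat /concat /=; have [Tt|tT] := leP (T y.2) t%:E.
  have TE := hit_fineK Tt; have tt : 0 <= t - tau y.2 by rewrite subr_ge0 -lee_fin -TE.
  rewrite cpath_ge// /Vpath; under eq_fun do rewrite ger0_norm ?gridup_ge0 ?mesh_gt0//.
  apply: (@cvg_right_seq _ _ (fun t => V t y.1)); first exact: (Vc y.1).1.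
    by move=> n; case/andP: (gridup_itv (mesh_gt0 n) tt).
  exact: gridup_cvg.
by rewrite cpath_lt//; exact: cvg_cst.
Qed.

Let grid_after_cvg t w : 0 <= t ->
  grid_concat (mesh n) t (after w, w) @[n --> \oo] --> X t w.
Proof.
move=> t0; rewrite /grid_concat /=; have [Tt|tT] := leP (T w) t%:E; last exact: cvg_cst.
have TE := hit_fineK Tt; have tt : 0 <= t - tau w by rewrite subr_ge0 -lee_fin -TE.
rewrite /after; under eq_fun do rewrite ger0_norm ?gridup_ge0 ?mesh_gt0//.
apply: (@cvg_right_seq _ _ (fun t => X t w)); first exact: (Xc w).1.
  by move=> n; case/andP: (gridup_itv (mesh_gt0 n) tt) => h _; rewrite -ltrBlDl.
rewrite -[X in _ --> X](subrKC (tau w)).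
by apply: cvgD; [exact: cvg_cst|exact: gridup_cvg].
Qed.

Let m_Vy : measurable_fun setT (fun y : Omega2 * Omega => (Vpath y.1, y.2 : past_measT)).
Proof.
apply: measurable_fun_pair.
  exact: (measurableT_comp mVpath measurable_fst).
exact: (measurableT_comp mid measurable_snd).
Qed.

Let m_ay : measurable_fun setT (fun y : Omega2 * Omega => (after y.2, y.2 : past_measT)).
Proof.
apply: measurable_fun_pair.
  exact: (measurableT_comp mafter measurable_snd).
exact: (measurableT_comp mid measurable_snd).
Qed.

Lemma measurable_concat t : measurable_fun setT (concat t).
Proof.
have [t0|t0] := ltP t 0.
  rewrite (_ : concat t = X t \o snd).
    exact: (measurableT_comp (mX t) measurable_snd).
  apply/funext => y; rewrite /concat cpath_lt//.
  by apply: lt_le_trans (hit_ge0 _ _); rewrite lte_fin.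
apply: (@measurable_fun_cvg _ _ _ _
  (fun n (y : Omega2 * Omega) => grid_concat (mesh n) t (Vpath y.1, y.2))).
  move=> n; apply: (measurableT_comp (mgrid_concat (mesh_gt0 n) t0) m_Vy).
by move=> y _; exact: grid_concat_cvg.
Qed.

Let PP_setT : (P2 \x P x)%E setT = 1%E.
Proof.
rewrite -setXTT [LHS](product_measure1E P2 (P x))//.
by rewrite [X in (X * _)%E]probability_setT [X in (_ * X)%E]probability_setT mule1.
Qed.

Let PP : probability (Omega2 * Omega)%type R := mkprob PP_setT.

(** As the mesh tends to zero in [grid_law], reattaching the actual future gives back [X], and
    reattaching the independent path gives [concat]. *)
Lemma concat_law l : tests l -> (forall p, p \in l -> 0 <= p.1) ->
  (\int[P2 \x P x]_y (prodl concat l y)%:E = \int[P x]_w (prodl X l w)%:E)%E.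
Proof.
move=> tl l0.
have m1 e : 0 < e -> measurable_fun setT (prodl (grid_concat e) l).
  move=> e0; rewrite (_ : prodl _ _ = prodl (fun t => grid_concat e (Num.max 0 t)) l).
    apply: measurable_prodl => [t|p pl]; last by apply: measurable_test01; exact: tl.
    by apply: mgrid_concat => //; rewrite le_max lexx.
  apply/funext => y; rewrite /prodl; apply: eq_big_seq => p /l0 p0.
  by rewrite max_r.
have mXl : measurable_fun setT (prodl X l).
  by apply: measurable_prodl => // p pl; apply: measurable_test01; exact: tl.
have bnd z n : `|prodl (grid_concat (mesh n)) l z| <= 1.
  by have /andP[? ?] := prodl01 (grid_concat (mesh n)) z tl; rewrite ger0_norm.
have cprod (U : Type) (Zn : nat -> R -> U -> R) (z : U) (f : R -> R) :
    (forall t, 0 <= t -> Zn n t z @[n --> \oo] --> f t) ->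
    prodl (Zn n) l z @[n --> \oo] --> \prod_(p <- l) p.2 (f p.1).
  move=> h; rewrite /prodl; elim: (l) tl l0 => [|p l' ih] tl' l0'.
    by under eq_fun do rewrite big_nil; rewrite big_nil; exact: cvg_cst.
  under eq_fun do rewrite big_cons; rewrite big_cons; apply: cvgM.
    apply: continuous_cvg; first exact: (tl' p (mem_head _ _)).1.
    by apply: h; apply: l0'; exact: mem_head.
  by apply: ih => q ql; [apply: tl'|apply: l0']; rewrite inE ql orbT.
have L1 : (\int[PP]_y (prodl (grid_concat (mesh n)) l (after y.2, y.2))%:E)%E
    @[n --> \oo] --> (\int[PP]_y (prodl X l y.2)%:E)%E.
  apply: (@bounded_convergence _ _ _ _ _ _ 1) => //.
  - by move=> n; exact: (measurableT_comp (m1 _ (mesh_gt0 n)) m_ay).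
  - exact: (measurableT_comp mXl measurable_snd).
  - exists setT; split; [exact: measurableT|exact: PP_setT|].
    move=> y _; apply: (@cprod _ (fun n t z => grid_concat (mesh n) t (after
      z.2, z.2)) y (X ^~ y.2)).
    by move=> t t0; exact: grid_after_cvg.
have L2 : (\int[PP]_y (prodl (grid_concat (mesh n)) l (Vpath y.1, y.2))%:E)%E
    @[n --> \oo] --> (\int[PP]_y (prodl concat l y)%:E)%E.
  apply: (@bounded_convergence _ _ _ _ _ _ 1) => //.
  - by move=> n; exact: (measurableT_comp (m1 _ (mesh_gt0 n)) m_Vy).
  - apply: measurable_prodl => [t|p pl]; first exact: measurable_concat.
    by apply: measurable_test01; exact: tl.
  - exists setT; split; [exact: measurableT|exact: PP_setT|].
    move=> y _; apply: (@cprod _ (fun n t z => grid_concat (mesh n) t (Vpath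
      z.1, z.2)) y (concat ^~ y)).
    by move=> t t0; exact: grid_concat_cvg.
transitivity (\int[P2 \x P x]_y (prodl X l y.2)%:E)%E.
  rewrite -[LHS](cvg_lim _ L2)// -[RHS](cvg_lim _ L1)//.
  have E : (fun n => \int[PP]_y (prodl (grid_concat (mesh n)) l (Vpath y.1, y.2))%:E)%E =
      (fun n => \int[PP]_y (prodl (grid_concat (mesh n)) l (after y.2, y.2))%:E)%E.
    by apply/funext => n; apply/esym; exact: (grid_law (mesh_gt0 n)).
  by rewrite E.
rewrite (@fubini_tonelli2 _ _ _ _ _ P2 (P x) (fun y => (prodl X l y.2)%:E)); last 2 first.
- by apply/measurable_EFinP; exact: (measurableT_comp mXl measurable_snd).
- by move=> y; rewrite lee_fin; case/andP: (prodl01 X y.2 tl).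
apply: eq_integral => w _; rewrite /fubini_G /= integral_cst//.
by rewrite [X in (_ * X)%E]probability_setT mule1.
Qed.

End concatenation.

End strong_markov.

(** * Descent from infinity *)

Section descent.
Context {R : realType}.
Variables (p : nat -> R -> R) (x : nat -> R).

Fixpoint desc (N : nat) (t : R) : R :=
  if N is M.+1 then cpath (p N) (x M) (desc M) t else p 0%N t.

(** The upper limit keeps the path defined and measurable for all data; it is a true limit once the
    durations of the legs are summable, see [desc_cvg_entr]. *)
Definition entr (t : R) : \bar R := limn_esup (fun M => (desc M t)%:E).

Let T k : \bar R := hit (p k.+1) (x k).

Hypothesis pc : forall k, cadlag (p k).
Hypothesis xinc : forall k, x k < x k.+1.

Lemma cadlag_desc N : cadlag (desc N).
Proof. by elim: N => [|N ih] //=; exact: cadlag_cpath. Qed.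

Let T_ge0 k : (0 <= T k)%E. Proof. exact: hit_ge0. Qed.

Let x_le k N : (k <= N)%N -> x k <= x N.
Proof.
move=> /subnK <-; elim: (N - k)%N => // j ih.
by rewrite addSn (le_trans ih)// ltW.
Qed.

(** A leg still running keeps the path above the level it aims at, and a completed leg only uses up
    its share of the time budget. *)
Lemma desc_ge k N t : (k <= N)%N -> 0 <= t ->
  (t%:E < \sum_(k <= j < N) hit (p j.+1) (x j))%E -> x k <= desc N t.
Proof.
move=> kN; move: t; elim: N kN => [|N ih] kN t t0.
  by rewrite big_geq ?leqn0// lte_fin ltNge t0.
move: kN; rewrite leq_eqVlt => /orP[/eqP ->|].
  by rewrite big_geq// lte_fin ltNge t0.
rewrite ltnS => kN; rewrite big_nat_recr//= => ts.
have [Tt|tT] := leP (T N) t%:E; last first.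
  by rewrite cpath_lt//; apply: (le_trans (x_le kN)); exact: lt_hit.
rewrite cpath_ge//; have TE := hit_fineK Tt.
apply: ih => //; first by rewrite subr_ge0 -lee_fin -TE.
by rewrite EFinB -TE lteBlDr// TE.
Qed.

Hypothesis p0 : forall k, p k 0 = x k.
Hypothesis xoo : x n @[n --> \oo] --> +oo.
Variables (N0 : nat) (c : R).
Hypothesis Tc : forall M, (\sum_(N0 <= k < M) hit (p k.+1) (x k) <= c%:E)%E.

Let T_gt0 k : (0 < T k)%E.
Proof. by apply: hit_gt0 => //; rewrite p0. Qed.

Let r k := fine (T k).

Let TE k : (N0 <= k)%N -> T k = (r k)%:E.
Proof.
move=> Nk; apply: (@hit_fineK _ _ _ c); apply: le_trans (Tc k.+1).
by rewrite big_nat_recr//= leeDr// sume_ge0// => i _; exact: hit_ge0.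
Qed.

Let r_gt0 k : (N0 <= k)%N -> 0 < r k.
Proof. by move=> Nk; rewrite -lte_fin -TE. Qed.

Let s M := \sum_(N0 <= k < M) r k.

Let sE M : (\sum_(N0 <= k < M) T k)%E = (s M)%:E.
Proof.
rewrite /s -sumEFin; apply: eq_big_nat => k /andP[Nk _]; exact: TE.
Qed.

Let s_nd : nondecreasing_seq s.
Proof.
apply/nondecreasing_seqP => M; rewrite /s; have [NM|MN] := leqP N0 M.
  by rewrite big_nat_recr//= lerDl ltW// r_gt0.
by rewrite !big_geq// ltnW.
Qed.

Let s_cvg : cvgn s.
Proof.
apply: nondecreasing_is_cvgn => //; exists c => _ [M _ <-].
by rewrite -lee_fin -sE; exact: Tc.
Qed.

(* The time at which the path coming from infinity reaches level [x M]. *)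
Let sg M := limn s - s M.

Let sg_rec M : (N0 <= M)%N -> sg M = r M + sg M.+1.
Proof. by move=> NM; rewrite /sg /s big_nat_recr//=; lra. Qed.

Let sg_ge0 M : 0 <= sg M.
Proof. by rewrite subr_ge0; exact: nondecreasing_cvgn_le. Qed.

Let sg_gt0 M : (N0 <= M)%N -> 0 < sg M.
Proof. by move=> NM; rewrite sg_rec// ltr_pwDl// r_gt0. Qed.

Let sg_cvg0 : sg M @[M --> \oo] --> 0.
Proof.
rewrite /sg -(subrr (limn s)); apply: cvgB; first exact: cvg_cst.
exact: s_cvg.
Qed.

(** The legs leading from [x M] to [x N] last exactly [sg N - sg M]; what follows is the path from
    [x N]. *)
Let desc_shift N M t : (N0 <= N <= M)%N -> sg N - sg M <= t ->
  desc M t = desc N (t - (sg N - sg M)).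
Proof.
move=> /andP[N0N] /subnK <-; move: t; elim: (M - N)%N => [|j ih] t.
  by rewrite add0n subrr subr0.
have NjN : (N0 <= j + N)%N by rewrite (leq_trans N0N)// leq_addl.
rewrite addSn (_ : sg N - sg (j + N).+1 = sg N - sg (j + N) + r (j + N)); last first.
  by rewrite (sg_rec NjN); lra.
move=> ht /=.
have sj : 0 <= sg N - sg (j + N).
  have : s N <= s (j + N)%N by apply: s_nd; rewrite leq_addl.
  by rewrite /sg; lra.
have Tt : (T (j + N) <= t%:E)%E by rewrite TE// lee_fin; lra.
rewrite cpath_ge// -/(r (j + N)) ih; last by lra.
by congr desc; lra.
Qed.

(** On the clock of the path from [x N], the evaluation time is [t - sg N + sg M]. It tends to
    [t - sg N] from strictly above because [sg M] is positive, so right-continuity suffices. *)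
Let desc_cvg N t : (N0 <= N)%N -> sg N <= t ->
  desc M t @[M --> \oo] --> desc N (t - sg N).
Proof.
move=> N0N st; rewrite -(cvg_shiftn N).
have -> : (fun M => desc (M + N)%N t) = (fun M => desc N (t - sg N + sg (M + N)%N)).
  apply/funext => M; rewrite (@desc_shift N (M + N)%N) ?N0N ?leq_addl//.
    by congr desc; lra.
  by have := sg_ge0 (M + N)%N; lra.
apply: (@cvg_right_seq _ _ (desc N) _ (fun M => t - sg N + sg (M + N)%N)).
- by apply: (cadlag_desc N).1; rewrite subr_ge0.
- by move=> M; rewrite ltrDl sg_gt0// (leq_trans N0N)// leq_addl.
- rewrite -[X in _ --> X]addr0; apply: cvgD; first exact: cvg_cst.
  by rewrite (cvg_shiftn N).
Qed.

Let desc0 M : desc M 0 = x M.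
Proof.
case: M => [|M] /=; first by rewrite p0.
by rewrite cpath_lt ?p0//; exact: T_gt0.
Qed.

Let ex_sg t : 0 < t -> exists2 N, (N0 <= N)%N & sg N < t.
Proof.
move=> t0; have /cvgrPdist_lt/(_ t t0)[M _ hM] := sg_cvg0.
exists (maxn M N0); first exact: leq_maxr.
have := hM (maxn M N0) (leq_maxl _ _) => /=.
by rewrite sub0r normrN ger0_norm.
Qed.

Let entrE N t : (N0 <= N)%N -> sg N <= t -> entr t = (desc N (t - sg N))%:E.
Proof.
move=> N0N st; have h := desc_cvg N0N st.
have hE : (desc M t)%:E @[M --> \oo] --> (desc N (t - sg N))%:E.
  by apply: cvg_EFin => //; exact: nearW.
rewrite /entr is_cvg_limn_esupE; first exact: cvg_lim.
by apply/cvg_ex; eexists; exact: hE.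
Qed.

Let cvg0 : (desc M 0)%:E @[M --> \oo] --> +oo%E.
Proof. by apply/cvgeryP; under eq_fun do rewrite desc0. Qed.

Lemma entr0 : entr 0 = +oo%E.
Proof.
rewrite /entr is_cvg_limn_esupE; first exact: cvg_lim cvg0.
by apply/cvg_ex; eexists; exact: cvg0.
Qed.

Lemma desc_cvg_entr t : 0 <= t -> (desc M t)%:E @[M --> \oo] --> entr t.
Proof.
rewrite le_eqVlt => /orP[/eqP <-|t0]; first by rewrite entr0; exact: cvg0.
have [N N0N /ltW st] := ex_sg t0.
rewrite (entrE N0N st); apply: cvg_EFin; first exact: nearW.
exact: desc_cvg.
Qed.

Lemma entr_lty t : 0 < t -> (entr t < +oo)%E.
Proof.
move=> t0; have [N N0N /ltW st] := ex_sg t0.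
by rewrite (entrE N0N st) ltry.
Qed.

(** Level [x k] is not reached before time [sg k]: this is what makes the path tend to infinity at
    time zero. *)
Let entr_ge k t : (N0 <= k)%N -> 0 < t < sg k -> ((x k)%:E <= entr t)%E.
Proof.
move=> N0k /andP[t0 tk]; have [N' N0N' sN'] := ex_sg t0.
pose N := maxn N' k.
have N0N : (N0 <= N)%N by rewrite (leq_trans N0k)// leq_maxr.
have sN : sg N <= t.
  by rewrite (le_trans _ (ltW sN'))// /sg lerB// s_nd// leq_maxl.
rewrite (entrE N0N sN) lee_fin; apply: desc_ge; first exact: leq_maxr.
  by rewrite subr_ge0.
have -> : (\sum_(k <= j < N) hit (p j.+1) (x j))%E = (s N - s k)%:E.
  rewrite EFinB -!sE (big_cat_nat N0k (leq_maxr N' k))/= addeAC subee ?add0e//.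
  by rewrite sE.
by rewrite lte_fin /sg; move: tk; rewrite /sg; lra.
Qed.

Lemma cadlag_entr : cadlag entr.
Proof.
split.
  move=> t; rewrite le_eqVlt => /orP[/eqP <-|t0].
    rewrite entr0; apply/cvgeyPge => A.
    have [k [kN Ak]] : exists k, (N0 <= k)%N /\ A <= x k.
      have /cvgryPge/(_ A)[K _ hK] := xoo.
      exists (maxn K N0); split; first exact: leq_maxr.
      by apply: hK; exact: leq_maxl.
    near=> v; apply: (@le_trans _ _ (x k)%:E); first by rewrite lee_fin.
    apply: entr_ge => //; apply/andP; split; first by near: v; exact: nbhs_right_gt.
    by near: v; apply: nbhs_right_lt; exact: sg_gt0.
  have [N N0N sN] := ex_sg t0; rewrite (entrE N0N (ltW sN)).
  have h : (desc N (u - sg N))%:E @[u --> t^'+] --> (desc N (t - sg N))%:E.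
    apply: cvg_EFin; first exact: nearW.
    apply: cvg_comp (@at_right_shift _ t (sg N)) _.
    by apply: (cadlag_desc N).1; rewrite subr_ge0 ltW.
  apply: cvg_trans h; apply: near_eq_cvg; near=> u; rewrite (entrE N0N)//.
  by apply: (le_trans (ltW sN)); near: u; exact: nbhs_right_ge.
move=> t t0; have [N N0N sN] := ex_sg t0.
have [|l hl] := (cadlag_desc N).2 (t - sg N); first by rewrite subr_gt0.
exists l%:E.
have h : (desc N (u - sg N))%:E @[u --> t^'-] --> l%:E.
  apply: cvg_EFin; first exact: nearW.
  exact: cvg_comp (@at_left_shift _ t (sg N)) hl.
apply: cvg_trans h; apply: near_eq_cvg; near=> u; rewrite (entrE N0N)//.
by near: u; exact: nbhs_left_ge.
Unshelve. all: by end_near. Qed.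

End descent.

(** * The process entering from infinity along a sequence of levels *)

Section entrance_process.
Context {R : realType} {d : measure_display} {Omega : measurableType d}.
Variables (P : R -> probability Omega R) (X : R -> Omega -> R).
Hypothesis mX : forall t, measurable_fun setT (X t).
Hypothesis XE : forall t w, 0 <= t -> Eset (X t w).
Hypothesis Xc : forall w, cadlag (fun t => X t w).
Hypothesis Xj : forall w, no_neg_jumps (fun t => X t w).
Hypothesis X0 : forall x, Eset x -> P x [set w | X 0 w = x] = 1%E.
Hypothesis XM : markov_fdd Eset CbE P X.
Hypothesis Xi : forall f t, CbE f -> 0 <= t -> CbE (semigroup P X t f).
Hypothesis Xe : forall t : R, 0 < t ->
     limf_einf (fun x => P x [set w | (hit_below X b w <= t%:E)%E])
               (pinfty_nbhs R) @[b --> +oo] --> 1%E.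

Variable x : nat -> R.
Hypothesis x0 : 0 <= x 0%N.
Hypothesis xinc : forall k, x k < x k.+1.
Hypothesis xoo : x n @[n --> \oo] --> +oo.

Local Notation W := (pathType nat Omega).
Let Q : probability W R := prodP (fun k => P (x k)).

Let x_ge0 k : 0 <= x k.
Proof. by elim: k => // k ih; rewrite (le_trans ih)// ltW. Qed.

Definition Zp (N : nat) (t : R) (w : W) : R := desc (fun k t => X t (w k)) x N t.

Let ZpS N t w : Zp N.+1 t w = cpath (X ^~ (w N.+1)) (x N) (Zp N ^~ w) t.
Proof. by []. Qed.

Lemma cadlag_Zp N w : cadlag (Zp N ^~ w).
Proof. exact: cadlag_desc. Qed.

Lemma Zp_ge0 N t w : 0 <= t -> 0 <= Zp N t w.
Proof.
elim: N t => [|N ih] t t0; first exact: XE.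
rewrite ZpS; have [Tt|tT] := leP (hit (X ^~ (w N.+1)) (x N)) t%:E.
  by rewrite cpath_ge//; apply: ih; rewrite subr_ge0 -lee_fin -(hit_fineK Tt).
by rewrite cpath_lt//; exact: XE.
Qed.

Let Zp_upd N k t w v : (N < k)%N -> Zp N t (upd w k v) = Zp N t w.
Proof.
elim: N t => [|N ih] t Nk; first by rewrite /Zp /= /upd ltn_eqF.
rewrite !ZpS /upd ltn_eqF//; congr cpath.
by apply/funext => u; exact: ih (ltnW Nk).
Qed.

Lemma measurable_Zp N t : measurable_fun setT (Zp N t).
Proof.
elim: N t => [|N ih] t.
  exact: (measurableT_comp (mX t) (measurable_coord 0%N)).
have m1 : measurable_fun setT (fun w : W => (w, w N.+1)).
  by apply: measurable_fun_pair => //; exact: measurable_coord.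
exact: (measurableT_comp (measurable_concat mX Xc (x N) ih (cadlag_Zp N) t) m1).
Qed.

Let integral_coord k (F : Omega -> \bar R) : measurable_fun setT F ->
  (forall w, 0 <= F w)%E -> (\int[Q]_w F (w k) = \int[P (x k)]_v F v)%E.
Proof.
move=> mF F0; rewrite -(ge0_integral_pushm (@measurable_coord nat _ Omega k) Q
  (g := F))//.
apply: eq_measure_integral => A mA _; exact: prodP_coord.
Qed.

(** By induction: resampling coordinate [N + 1] leaves [Zp N] untouched, and [concat_law] applies
    with [Zp N] as the independent continuation of a copy started from [x (N + 1)]. *)
Lemma Zp_law N l : tests l -> (forall p, p \in l -> 0 <= p.1) ->
  (\int[Q]_w (prodl (Zp N) l w)%:E = \int[P (x N)]_w (prodl X l w)%:E)%E.
Proof.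
elim: N l => [|N ih] l tl l0.
  rewrite -(@integral_coord 0 (fun v => (prodl X l v)%:E))//.
    apply/measurable_EFinP; apply: measurable_prodl => // p pl.
    by apply: measurable_test01; exact: tl.
  by move=> v; rewrite lee_fin; case/andP: (prodl01 X v tl).
rewrite [LHS](@ge0_integral_prodP_upd _ _ _ (fun k => P (x k)) N.+1 (fun w =>
  (prodl (Zp N.+1) l w)%:E)); last 2 first.
- apply/measurable_EFinP; apply: measurable_prodl => [t|p pl].
    exact: measurable_Zp.
  by apply: measurable_test01; exact: tl.
- by move=> w; rewrite lee_fin; case/andP: (prodl01 (Zp N.+1) w tl).
rewrite -(@concat_law _ _ _ P X mX XE Xc Xj X0 XM Xi (x N.+1) (x N) (x_ge0 N) (xinc N)
  _ _ Q (Zp N) (measurable_Zp N) (cadlag_Zp N) _ l tl l0).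
  apply: eq_integral => y _; congr (_%:E); rewrite /prodl; apply: eq_bigr => p _.
  congr (p.2 _); rewrite ZpS /concat /upd eqxx; congr cpath.
  by apply/funext => u; exact: (Zp_upd u y.1 y.2 (ltnSn N)).
move=> l' tl'.
(* [concat_law] compares paths extended evenly to negative times; the absolute value is moved onto
   the test times to fit the induction hypothesis. *)
under eq_integral do rewrite -(prodl_map (Zp N) Num.norm).
under [RHS]eq_integral do rewrite -(prodl_map X Num.norm).
apply: ih; first exact: tests_map.
by move=> _ /mapP[p _ ->] /=.
Qed.

Let absZ N (w : W) : pathType R R := fun t => Zp N `|t| w.
Let absX (w : Omega) : pathType R R := fun t => X `|t| w.

Let mabsZ N : measurable_fun setT (absZ N).
Proof. by apply: measurable_fun_path => t; exact: measurable_Zp. Qed.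

Let mabsX : measurable_fun setT absX.
Proof. by apply: measurable_fun_path => t; exact: mX. Qed.

Lemma Zp_path_law N (B : set (pathType R R)) : measurable B ->
  Q (absZ N @^-1` B) = P (x N) (absX @^-1` B).
Proof.
move=> mB.
have := @law_determined R _ _ _ _ Q (P (x N)) (cst 1) (cst 1) (fun t w => absZ N w t)
  (fun t w => absX w t).
have mZB : measurable (absZ N @^-1` B) by rewrite -[X in measurable X]setTI; exact: mabsZ.
have mXB : measurable (absX @^-1` B) by rewrite -[X in measurable X]setTI; exact: mabsX.
move=> /(_ _ _ _ _ _ _ _ B mB) h.
have {}h : (\int[Q]_(w in absZ N @^-1` B) (cst 1%:E) w =
   \int[P (x N)]_(w in absX @^-1` B) (cst 1%:E) w)%E.
  apply: h; rewrite ?ler01 ?lexx//.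
  - by move=> w; rewrite ler01 lexx.
  - by move=> w; rewrite ler01 lexx.
  - by move=> t; exact: measurable_Zp.
  - by move=> t; exact: mX.
  - move=> l tl.
    under eq_integral do rewrite mul1r -(prodl_map (Zp N) Num.norm).
    under [RHS]eq_integral do rewrite mul1r -(prodl_map X Num.norm).
    apply: Zp_law; first exact: tests_map.
    by move=> _ /mapP[p _ ->] /=.
by move: h; rewrite !integral_cst// !mul1e.
Qed.

(** Equality of path laws allows any bounded measurable functional. [coord] clamps values to [E]
    because functions in [CbE] are uncontrolled elsewhere. *)
Lemma Zp_fdd N s : goodl s ->
  (\int[Q]_w (fdd_prod (Zp N) s 0 w)%:E = \int[P (x N)]_w (fdd_prod X s 0 w)%:E)%E.
Proof.
move=> gs.
pose coord : R -> pathType R R -> R := fun t p => Num.max 0 (p t).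
have coordE (d' : measure_display) (U : measurableType d') (Z : R -> U -> R) (w : U) :
    (forall t, 0 <= t -> 0 <= Z t w) ->
    fdd_prod Z s 0 w = fdd_prod coord s 0 (fun t => Z `|t| w).
  move=> Z0; suff h t : 0 <= t ->
    fdd_prod Z s t w = fdd_prod coord s t (fun t => Z `|t| w) by exact: h.
  elim: s gs t => // -[dt f] s ih /goodl_cons[[/= dt0 _] gs] t t0.
  have tdt : 0 <= t + dt by rewrite addr_ge0.
  rewrite ih//; congr (f _ * _); rewrite /coord ger0_norm// max_r//.
  exact: Z0.
have mb t : measurable_fun setT (fdd_prod coord s t) /\
    exists M, forall p, `|fdd_prod coord s t p| <= M.
  elim: s gs t {coordE} => [|[dt f] s ih].
    move=> _ t; split; first exact: measurable_cst.
    by exists 1 => p /=; rewrite normr1.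
  move=> /goodl_cons[[/= dt0 cf] gs] t; have [m1 [M hM]] := ih gs (t + dt).
  split.
    apply: measurable_funM => //.
    apply: (measurableT_comp (continuous_measurable_fun (CbE_ext cf))).
    exact: measurable_coord.
  have [_ [K hK]] := cf; exists (K * M) => p; rewrite normrM ler_pM//.
  by apply: hK; rewrite /Eset/= le_max lexx.
have [m [M hM]] := mb 0.
transitivity (\int[Q]_w (fdd_prod coord s 0 (absZ N w))%:E)%E.
  by apply: eq_integral => w _; rewrite coordE// => t; exact: Zp_ge0.
transitivity (\int[P (x N)]_w (fdd_prod coord s 0 (absX w))%:E)%E; last first.
  by apply: eq_integral => w _; rewrite [in RHS]coordE// => t; exact: XE.
rewrite -(integral_pushp (mabsZ N) (m := Q) (g := fun p => (fdd_prod coord s 0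
  p)%:E)); last 2 first.
- exact/measurable_EFinP.
- apply: (@bounded_integrable _ _ _ Q (fun w => fdd_prod coord s 0 (absZ N w)) M) => //.
  exact: (measurableT_comp m (mabsZ N)).
rewrite -(integral_pushp mabsX (m := P (x N)) (g := fun p => (fdd_prod coord s
  0 p)%:E)); last 2 first.
- exact/measurable_EFinP.
- apply: (@bounded_integrable _ _ _ (P (x N)) (fun w => fdd_prod coord s 0
    (absX w)) M) => //.
  exact: (measurableT_comp m mabsX).
by apply: eq_measure_integral => A mA _; exact: Zp_path_law.
Qed.

Definition Yp (t : R) (w : W) : \bar R := entr (fun k t => X t (w k)) x t.

Lemma measurable_Yp t : measurable_fun setT (Yp t).
Proof.
apply: measurable_fun_limn_esup => N; apply/measurable_EFinP.
exact: measurable_Zp.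
Qed.

Lemma Yp_ge0 t w : 0 <= t -> (0 <= Yp t w)%E.
Proof.
move=> t0; apply: le_ereal_inf_tmp => _ [A [N _ hN] <-].
apply: (@le_trans _ _ (Zp N t w)%:E); first by rewrite lee_fin Zp_ge0.
by apply: ereal_sup_ubound; exists N => //; exact: hN (leqnn N).
Qed.

Let T k (w : W) : \bar R := hit (X ^~ (w k.+1)) (x k).

Let mT k : measurable_fun setT (T k).
Proof.
exact: (measurableT_comp (measurable_hit mX Xc (x k)) (measurable_coord k.+1)).
Qed.

Let Sp N M (w : W) : \bar R := (\sum_(N <= k < M) T k w)%E.

Let mSp N M : measurable_fun setT (Sp N M).
Proof. by apply: emeasurable_sum => k; exact: mT. Qed.

Let mSp_le N M : measurable [set w | (Sp N M w <= 2%:E)%E].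
Proof.
rewrite -[X in measurable X]setTI.
exact: emeasurable_fun_infty_c.
Qed.

(** The horizon 2 leaves room between a passage by time 1, the event taken from the entrance
    condition, and a strict inequality, which rational times detect. *)
Let hitset (c : R) : set (pathType R R) := [set p | exists q : rat,
  [/\ (0:R) <= ratr q, (ratr q : R) < 2 & p (ratr q) < c]].

Let mhitset c : measurable (hitset c).
Proof.
pose F (q : rat) : set (pathType R R) := if ((0:R) <= ratr q) && ((ratr q : R) < 2)
  then [set p | p (ratr q) < c] else set0.
rewrite (_ : hitset c = \bigcup_q F q); last first.
  apply/seteqP; split => p /=.
    by move=> [q [q0 q2 qc]]; exists q => //; rewrite /F q0 q2.
  by move=> [q _]; rewrite /F; case: ifPn => // /andP[q0 q2] qc; exists q.
apply: bigcupT_measurable_rat => q; rewrite /F; case: ifPn => // _.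
rewrite (_ : [set p | _] = (fun p : pathType R R => p (ratr q)) @^-1` `]-oo, c[%classic).
  by rewrite -[X in measurable X]setTI; exact: (@measurable_coord R _ R).
by apply/seteqP; split => p /=; rewrite in_itv.
Qed.

Let hitsetP (p : R -> R) c : cadlag p ->
  hitset c (fun t => p `|t|) <-> (hit p c < 2%:E)%E.
Proof.
move=> cp; split.
  move=> [q [q0 q2 qc]]; apply/(hit_lt_ratP _ _ cp); exists q.
  by rewrite ger0_norm in qc.
move=> /(hit_lt_ratP _ _ cp)[q [q0 q2 qc]]; exists q.
by rewrite ger0_norm.
Qed.

(* [Zp M] stays above [x N] during the time [Sp N M]. *)
Let Q_Sp N M : (N <= M)%N ->
  (P (x M) [set w | hit_below X (x N) w <= 1%:E] <= Q [set w | Sp N M w <= 2%:E])%E.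
Proof.
move=> NM; have mZB : measurable (absZ M @^-1` hitset (x N)).
  by rewrite -[X in measurable X]setTI; exact: mabsZ.
have mXB : measurable (absX @^-1` hitset (x N)).
  by rewrite -[X in measurable X]setTI; exact: mabsX.
apply: (@le_trans _ _ (P (x M) (absX @^-1` hitset (x N)))).
  apply: le_measure; rewrite ?inE//; first exact: (measurable_hit_le mX Xc).
  move=> w /= h; apply/(hitsetP _ (Xc w)).
  by apply: (le_lt_trans h); rewrite lte_fin ltr1n.
rewrite -Zp_path_law//; apply: le_measure; rewrite ?inE//.
move=> w /= /(hitsetP _ (cadlag_Zp M w)) /hit_ltP[t [t0 t2 Zt]].
rewrite leNgt; apply/negP => h; move: Zt; apply/negP; rewrite -leNgt.
apply: desc_ge => //.
by apply: lt_trans h; rewrite lte_fin.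
Qed.

Let good N : set W := \bigcap_M [set w | (Sp N M w <= 2%:E)%E].

Let mgood N : measurable (good N).
Proof. by apply: bigcapT_measurable => M; exact: mSp_le. Qed.

(** The entrance condition at time 1 selects [N]. By [Q_Sp] the partial durations are at most 2 with
    probability at least [1 - e] for all large [M], and these events decrease in [M]. *)
Let Q_good e : 0 < e -> exists N, ((1 - e)%:E <= Q (good N))%E.
Proof.
move=> e0.
have h1 := Xe ltr01.
have e1 : ((1 - e)%:E < 1)%E by rewrite lte_fin ltrBlDr ltrDl.
have [N hN] : exists N, ((1 - e)%:E <
    limf_einf (fun y => P y [set w | (hit_below X (x N) w <= 1%:E)%E]) (pinfty_nbhs R))%E.
  have := h1 _ (open_ereal_gt' e1).
  move=> [B [_ hB]].
  have /cvgryPgt/(_ B)[N _ hN] := xoo.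
  by exists N; apply: hB; exact: (hN N (leqnn N)).
exists N.
have [K hK] : exists K, forall M, (K <= M)%N ->
    ((1 - e)%:E <= P (x M) [set w | (hit_below X (x N) w <= 1%:E)%E])%E.
  (* The lower limit is the opposite of an infimum of suprema, whence the signs. *)
  move: hN; rewrite /limf_einf lteNr.
  move=> /ereal_inf_lt[_ [A [B [_ hB]] <-] hA].
  have /cvgryPgt/(_ B)[K _ hK] := xoo.
  exists K => M KM; apply: ltW; rewrite -lteN2; apply: le_lt_trans hA.
  by apply: ereal_sup_ubound; exists (x M) => //; apply: hB; exact: hK.
have cv : Q [set w | (Sp N M w <= 2%:E)%E] @[M --> \oo] --> Q (good N).
  apply: (@nonincreasing_cvg_mu _ _ _ Q (fun M => [set w | (Sp N M w <= 2%:E)%E])) => //.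
  - by rewrite -ge0_fin_numE// fin_num_measure.
  - exact: (mgood N).
  - move=> i j ij; apply/subsetPset => w /= h; apply: le_trans h.
    rewrite /Sp; apply: lee_sum_nneg_natr => //= k _ _; exact: hit_ge0.
rewrite -(cvg_lim _ cv)//; apply: lime_ge; first by apply/cvg_ex; eexists; exact: cv.
near=> M; have KM : (maxn K N <= M)%N by near: M; exact: nbhs_infty_ge.
apply: (le_trans (hK M _)); first by rewrite (leq_trans (leq_maxl K N)).
by apply: Q_Sp; rewrite (leq_trans (leq_maxr K N)).
Unshelve. all: by end_near. Qed.

Let start : set W := \bigcap_k [set w : W | X 0 (w k) = x k].

Let mstart1 k : measurable [set w : W | X 0 (w k) = x k].
Proof.
rewrite (_ : [set w | _] = (fun w : W => X 0 (w k)) @^-1` [set x k])//.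
rewrite -[X in measurable X]setTI.
exact: (measurableT_comp (mX 0) (measurable_coord k)).
Qed.

(** The starting level [N] depends on the path, since for a fixed [N] the bound on durations is only
    obtained with probability close to one. *)
Definition good_paths : set W := start `&` \bigcup_N good N.

Lemma measurable_good_paths : measurable good_paths.
Proof.
apply: measurableI; first exact: bigcapT_measurable.
exact: bigcupT_measurable.
Qed.

Lemma Q_good_paths : Q good_paths = 1%E.
Proof.
have mU : measurable (\bigcup_N good N) by exact: bigcupT_measurable.
have mS : measurable start by exact: bigcapT_measurable.
have QU : Q (\bigcup_N good N) = 1%E.
  apply/eqP; rewrite eq_le probability_le1//=; apply/lee_addgt0Pr => e e0.
  have [N hN] := Q_good e0; rewrite -leeBlDr//.
  apply: (le_trans hN); apply: le_measure; rewrite ?inE//.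
  exact: bigcup_sup.
have QS : Q (~` start) = 0%E.
  rewrite /start setC_bigcap.
  have [A [mA A0 sA]] : Q.-negligible (\bigcup_k (~` [set w : W | X 0 (w k) = x k])).
    apply: negligible_bigcup => k; exists (~` [set w : W | X 0 (w k) = x k]).
    split => //; first exact: measurableC.
    rewrite [LHS]probability_setC// -[X in (1 - X)%E]/(Q _).
    rewrite (@prodP_coord _ _ _ (fun k => P (x k)) k [set v | X 0 v = x k]).
      by rewrite X0 ?subee//; exact: x_ge0.
    rewrite (_ : [set v | _] = X 0 @^-1` [set x k])//.
    by rewrite -[X in measurable X]setTI; exact: mX.
  apply/eqP; rewrite eq_le measure_ge0 andbT -A0; apply: le_measure => //; rewrite inE//.
  by apply: bigcupT_measurable => k; exact: measurableC.
rewrite /good_paths; apply/eqP; rewrite eq_le probability_le1 /=; last exact: measurableI.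
rewrite -QU -[leRHS]adde0 -QS.
apply: (@le_trans _ _ (Q ((start `&` \bigcup_N good N) `|` ~` start))).
  apply: le_measure; rewrite ?inE//.
    by apply: measurableU; [exact: measurableI|exact: measurableC].
  by move=> w Uw; have [?|?] := pselect (start w); [left|right].
apply: measureU2; [exact: measurableI|exact: measurableC].
Qed.

Section good_path.
Variable w : W.
Hypothesis gw : good_paths w.

Let ex_good : exists N, forall M,
  (\sum_(N <= k < M) hit (X ^~ (w k.+1)) (x k) <= 2%:E)%E.
Proof. by have [_ [N _ h]] := gw; exists N => M; exact: h M I. Qed.

Let start_w k : X 0 (w k) = x k. Proof. by have [h _] := gw; exact: h k I. Qed.

Lemma cadlag_Yp : cadlag (Yp ^~ w).
Proof. by have [N h] := ex_good; exact: (@cadlag_entr _ _ _ _ _ _ _ N 2). Qed.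

Lemma Yp0 : Yp 0 w = +oo%E.
Proof. by have [N h] := ex_good; exact: (@entr0 _ _ _ _ _ _ _). Qed.

Lemma Yp_lty t : 0 < t -> (Yp t w < +oo)%E.
Proof. by have [N h] := ex_good; exact: (@entr_lty _ _ _ _ _ _ N 2). Qed.

Lemma Zp_cvg t : 0 <= t -> (Zp N t w)%:E @[N --> \oo] --> Yp t w.
Proof. by have [N h] := ex_good; exact: (@desc_cvg_entr _ _ _ _ _ _ _ N 2). Qed.

End good_path.

End entrance_process.

(** * The Feller extension *)

Section CEbar_functions.
Context {R : realType}.
Implicit Types (g : \bar R -> R).

Lemma CEbar_cvg_within g (y : \bar R) : CEbar g -> Ebarset y ->
  g z @[z --> within Ebarset (nbhs y)] --> g y.
Proof. by move=> /subspace_continuousP cg; exact: cg. Qed.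

Lemma CEbar_cvg g (T : Type) (F : set_system T) (u : T -> \bar R) (y : \bar R) :
  Filter F -> CEbar g -> Ebarset y -> (\forall n \near F, Ebarset (u n)) ->
  u n @[n --> F] --> y -> g (u n) @[n --> F] --> g y.
Proof.
move=> FF cg Ey Eu uy; apply: cvg_comp (CEbar_cvg_within cg Ey).
move=> A hA; have := uy _ hA; rewrite /fmap /nbhs/= => h.
by apply: filterS2 h Eu => n h1 h2; exact: h1.
Qed.

Lemma CEbar_EFin_cont g : CEbar g -> {within Eset, continuous (fun r => g r%:E)}.
Proof.
move=> cg; apply/subspace_continuousP => r Er.
apply: (@CEbar_cvg g _ (within Eset (nbhs r)) (fun r => r%:E)) => //.
  by rewrite near_withinE; apply: nearW => s; rewrite /Eset /Ebarset/= lee_fin.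
by apply: cvg_within_filter; apply: cvg_EFin; [exact: nearW|exact: cvg_id].
Qed.

(** Beyond some [A] the function is within 1 of its value at infinity; on the remaining segment the
    extreme value theorem applies. *)
Lemma CEbar_bounded g : CEbar g -> exists M, forall y, Ebarset y -> `|g y| <= M.
Proof.
move=> cg.
have [A hA] : exists A : R, forall y, (A%:E < y)%E -> Ebarset y -> `|g y - g +oo%E| < 1.
  have /(CEbar_cvg_within cg) h : Ebarset (+oo%E : \bar R) by rewrite /Ebarset/= leey.
  move/cvgrPdist_lt : h => /(_ _ ltr01) [A [_ hA]]; exists A => y Ay Ey.
  by rewrite distrC; exact: hA.
pose f (r : R) := g r%:E.
have cf : {within `[0, Num.max 0 A], continuous f}.
  apply: continuous_subspaceW (CEbar_EFin_cont cg) => r /=.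
  by rewrite in_itv/= => /andP[].
have A0 : 0 <= Num.max 0 A by rewrite le_max lexx.
have [c1 _ h1] := EVT_max A0 cf; have [c2 _ h2] := EVT_min A0 cf.
exists (1 + `|g +oo%E| + `|f c1| + `|f c2|) => y Ey.
have [yA|Ay] := leP y A%:E; last first.
  have := hA y Ay Ey => h; have := lerB_dist (g y) (g +oo%E) => h'.
  by have := normr_ge0 (f c1); have := normr_ge0 (f c2); lra.
move: y Ey yA => [r| |]//; rewrite /Ebarset/= !lee_fin => r0 rA.
have rin : r \in `[0, Num.max 0 A] by rewrite in_itv/= r0 le_max rA orbT.
have h3 := h1 _ rin; have h4 := h2 _ rin; rewrite /f in h3 h4 *.
have := ler_norm (g c1%:E); have := ler_norm (- g c2%:E); rewrite normrN.
have := normr_ge0 (g c1%:E); have := normr_ge0 (g c2%:E).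
have := normr_ge0 (g +oo%E) => h5 h6 h7 h8 h9.
by rewrite ler_norml; lra.
Qed.

Lemma CEbar_CbE g : CEbar g -> CbE (fun r => g r%:E).
Proof.
move=> cg; split; first exact: CEbar_EFin_cont.
have [M gM] := CEbar_bounded cg; exists M => r Er; apply: gM.
by rewrite /Ebarset/= lee_fin.
Qed.

Lemma CEbar_intro g : CbE (fun r => g r%:E) ->
  g r%:E @[r --> +oo] --> g +oo%E -> CEbar g.
Proof.
move=> [/subspace_continuousP cg _] goo; apply/subspace_continuousP => -[r| |]//.
- rewrite /Ebarset/= lee_fin => r0 U hU; have := cg r r0 U hU.
  rewrite /nbhs /= /within /=; apply: filterS => s h.
  by rewrite lee_fin => s0; apply: h.
- move=> _ U hU; have [M [Mr hM]] := goo U hU.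
  exists M; split => // -[r| |]//.
    by rewrite lte_fin => Mr' _; exact: hM.
  by move=> _ _; exact: (nbhs_singleton hU).
Qed.

Lemma CEbarM f g : CEbar f -> CEbar g -> CEbar (fun y => f y * g y).
Proof. by move=> cf cg y; apply: cvgM; [exact: cf|exact: cg]. Qed.

Lemma CEbar_cst (c : R) : CEbar (fun=> c).
Proof. by apply: continuous_subspaceT; exact: cst_continuous. Qed.

(** Truncating [u] at [n] brings the composition back to real functions; continuity of [g] on
    [[0, +oo]] removes the truncation. *)
Lemma measurable_CEbar (d : measure_display) (T : measurableType d) g
    (u : T -> \bar R) : CEbar g -> measurable_fun setT u ->
  (forall w, Ebarset (u w)) -> measurable_fun setT (fun w => g (u w)).
Proof.
move=> cg mu Eu.
pose un n w := fine (mine (u w) n%:R%:E).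
have unE n w : (un n w)%:E = mine (u w) n%:R%:E.
  rewrite /un fineK// ge0_fin_numE.
    by rewrite (le_lt_trans (_ : _ <= n%:R%:E)%E) ?ltry// ge_min lexx orbT.
  by rewrite le_min; apply/andP; split; [exact: Eu|rewrite lee_fin].
apply: (@measurable_fun_cvg _ _ _ _ (fun n w => g (Num.max 0 (un n w))%:E)).
  move=> n; apply: (measurableT_comp (continuous_measurable_fun (CbE_ext
    (CEbar_CbE cg)))).
  by apply: measurableT_comp => //; apply: measurable_mine.
move=> w _.
have un0 n : 0 <= un n w.
  by rewrite -lee_fin unE le_min; apply/andP; split; [exact: Eu|rewrite lee_fin].
under eq_fun do rewrite max_r//.
apply: (CEbar_cvg (u := fun n => (un n w)%:E)) => //;
  first by apply: nearW => n; rewrite /Ebarset/= lee_fin.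
under eq_fun do rewrite unE.
have := Eu w; case: (u w) => [r| |]// r0.
  apply: cvg_near_cst; near=> n; apply/min_idPl; rewrite lee_fin.
  by near: n; exact: nbhs_infty_ger.
apply/cvgeyPge => A; near=> n; rewrite le_min leey /= lee_fin.
by near: n; exact: nbhs_infty_ger.
Unshelve. all: by end_near. Qed.

End CEbar_functions.

Lemma lt_thirds (R : realType) (e a b c : R) :
  a < e / 3 -> b < e / 3 -> c < e / 3 -> a + b + c < e.
Proof. by move=> *; lra. Qed.

Section feller_extension.
Context {R : realType} {d : measure_display} {Omega : measurableType d}.
Variables (P : R -> probability Omega R) (X : R -> Omega -> R).
Hypothesis mX : forall t, measurable_fun setT (X t).
Hypothesis XE : forall t w, 0 <= t -> Eset (X t w).
Hypothesis Xc : forall w, cadlag (fun t => X t w).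
Hypothesis Xj : forall w, no_neg_jumps (fun t => X t w).
Hypothesis X0 : forall x, Eset x -> P x [set w | X 0 w = x] = 1%E.
Hypothesis XM : markov_fdd Eset CbE P X.
Hypothesis Xi : forall f t, CbE f -> 0 <= t -> CbE (semigroup P X t f).
Hypothesis Xii : forall f x, CbE f -> Eset x ->
  semigroup P X t f x @[t --> 0^'+] --> f x.
Hypothesis Xe : forall t : R, 0 < t ->
     limf_einf (fun x => P x [set w | (hit_below X b w <= t%:E)%E])
               (pinfty_nbhs R) @[b --> +oo] --> 1%E.

Local Notation W := (pathType nat Omega).

(** * Limits of finite-dimensional laws along one sequence of starting points *)

Section one_sequence.
Variable x : nat -> R.
Hypothesis x0 : 0 <= x 0%N.
Hypothesis xinc : forall k, x k < x k.+1.
Hypothesis xoo : x n @[n --> \oo] --> +oo.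

Let Q : probability W R := prodP (fun k => P (x k)).
Let Y := Yp X x.
Let good := good_paths X x.

Let mgood : measurable good. Proof. exact: measurable_good_paths. Qed.
Let Qgood : Q good = 1%E. Proof. exact: Q_good_paths. Qed.

Definition lift_seq (s : seq (R * (\bar R -> R))) : seq (R * (R -> R)) :=
  [seq (p.1, fun r => p.2 r%:E) | p <- s].

Definition goodE (s : seq (R * (\bar R -> R))) :=
  forall p, p \in s -> 0 <= p.1 /\ CEbar p.2.

Lemma goodE_cons p s : goodE (p :: s) <-> (0 <= p.1 /\ CEbar p.2) /\ goodE s.
Proof.
split; first by move=> h; split => [|q ql]; apply: h; rewrite inE ?eqxx ?ql ?orbT.
by move=> [h1 h2] q; rewrite inE => /orP[/eqP->|/h2].
Qed.

Lemma goodl_lift s : goodE s -> goodl (lift_seq s).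
Proof. by move=> gs _ /mapP[p /gs[p0 /CEbar_CbE cp] ->]. Qed.

Lemma measurable_fddE (d' : measure_display) (U : measurableType d')
    (Z : R -> U -> \bar R) s t : goodE s -> 0 <= t ->
  (forall t, measurable_fun setT (Z t)) ->
  (forall t w, 0 <= t -> Ebarset (Z t w)) ->
  measurable_fun setT (fdd_prod Z s t) /\
  exists M, forall w, `|fdd_prod Z s t w| <= M.
Proof.
move=> + + mZ EZ; elim: s t => [|[dt f] s ih] t.
  move=> _ _; split; first exact: measurable_cst.
  by exists 1 => w /=; rewrite normr1.
move=> /goodE_cons[[/= dt0 cf] gs] t0; have tdt : 0 <= t + dt by rewrite addr_ge0.
have [m [M hM]] := ih (t + dt) gs tdt; have [K hK] := CEbar_bounded cf; split.
  apply: measurable_funM => //; apply: measurable_CEbar => // w; exact: EZ.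
by exists (K * M) => w; rewrite normrM ler_pM//; apply: hK; exact: EZ.
Qed.

(** All [Zp N] live on one probability space and converge at every nonnegative time on the good
    event, so bounded convergence applies; [Zp_fdd] identifies their expectations with those of [X]
    from [x N]. *)
Lemma fdd_entrance_cvg s : goodE s ->
  (\int[P (x N)]_w (fdd_prod X (lift_seq s) 0 w)%:E)%E @[N --> \oo] -->
  (\int[Q]_w (fdd_prod Y s 0 w)%:E)%E.
Proof.
move=> gs; have gl := goodl_lift gs.
have EY t w : 0 <= t -> Ebarset (Y t w) by exact: Yp_ge0.
have mY t : measurable_fun setT (Y t) by exact: measurable_Yp.
pose ZE N t (w : W) := (Zp X x N t w)%:E.
have mZE N t : measurable_fun setT (ZE N t) by apply/measurable_EFinP;
  exact: measurable_Zp.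
have EZE N t w : 0 <= t -> Ebarset (ZE N t w) by move=> t0;
  rewrite /Ebarset/= lee_fin Zp_ge0.
have liftE N t w : fdd_prod (Zp X x N) (lift_seq s) t w = fdd_prod (ZE N) s t w.
  by elim: (s) t => //= -[dt f] s' ih t /=; rewrite ih.
have [M hM] : exists M, forall N w, `|fdd_prod (ZE N) s 0 w| <= M.
  suff h t : 0 <= t -> exists M, forall N w, `|fdd_prod (ZE N) s t w| <= M by exact: h.
  elim: (s) t gs => [|[dt f] s' ih] t; first by exists 1 => N w /=; rewrite normr1.
  move=> /goodE_cons[[/= dt0 cf] gs'] t0; have tdt : 0 <= t + dt by rewrite addr_ge0.
  have [M hM] := ih (t + dt) gs' tdt; have [K hK] := CEbar_bounded cf.
  by exists (K * M) => N w; rewrite normrM ler_pM//; apply: hK; exact: EZE.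
rewrite (_ : (fun N => _) = (fun N => \int[Q]_w (fdd_prod (ZE N) s 0 w)%:E)%E);
  last first.
  apply/funext => N; rewrite -(Zp_fdd mX XE Xc Xj X0 XM Xi x0 xinc _ gl).
  by apply: eq_integral => w _; rewrite liftE.
apply: (@bounded_convergence _ _ _ Q (fun N => fdd_prod (ZE N) s 0) (fdd_prod Y
  s 0) M) => //.
- by move=> N; have [] := measurable_fddE gs (lexx 0) (mZE N) (EZE N).
- by have [] := measurable_fddE gs (lexx 0) mY EY.
- exists good; split => // w gw.
  suff h t : 0 <= t -> fdd_prod (ZE N) s t w @[N --> \oo] --> fdd_prod Y s t w
    by exact: h.
  elim: (s) t gs => [|[dt f] s' ih] t; first by move=> _ _; exact: cvg_cst.
  move=> /goodE_cons[[/= dt0 cf] gs'] t0; have tdt : 0 <= t + dt by rewrite addr_ge0.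
  apply: cvgM; last exact: ih.
  apply: (CEbar_cvg (u := fun N => ZE N (t + dt) w)) => //.
  + exact: EY.
  + by apply: nearW => N; exact: EZE.
  + exact: (Zp_cvg Xc xinc xoo gw).
Qed.

Lemma semigroup_entrance_cvg g t : CEbar g -> 0 <= t ->
  semigroup P X t (fun y => g y%:E) (x N) @[N --> \oo] -->
  fine (\int[Q]_w (g (Y t w))%:E)%E.
Proof.
move=> cg t0.
have gs : goodE [:: (t, g)] by move=> p; rewrite inE => /eqP ->.
have := fdd_entrance_cvg gs.
have E1 N : (\int[P (x N)]_w (fdd_prod X (lift_seq [:: (t, g)]) 0 w)%:E =
    \int[P (x N)]_w (g (X t w)%:E)%:E)%E.
  by apply: eq_integral => w _ /=; rewrite mulr1 add0r.
have E2 : (\int[Q]_w (fdd_prod Y [:: (t, g)] 0 w)%:E = \int[Q]_w (g (Y t w))%:E)%E.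
  by apply: eq_integral => w _ /=; rewrite mulr1 add0r.
under eq_fun do rewrite E1; rewrite E2.
have EY u w : 0 <= u -> Ebarset (Y u w) by exact: Yp_ge0.
have [M hM] := CEbar_bounded cg.
have fin : (\int[Q]_w (g (Y t w))%:E)%E \is a fin_num.
  apply: (@integral_bounded_fin_num _ _ _ Q (fun w => g (Y t w)) M).
    by apply: measurable_CEbar => //; [exact: measurable_Yp|move=> w; exact: EY].
  by move=> w; apply: hM; exact: EY.
by rewrite -{1}(fineK fin) => /fine_cvg.
Qed.

End one_sequence.

Let xn (n : nat) : R := n%:R.
Let xn0 : 0 <= xn 0%N. Proof. by []. Qed.
Let xninc k : xn k < xn k.+1. Proof. by rewrite /xn ltr_nat. Qed.
Let xnoo : xn n @[n --> \oo] --> +oo. Proof. exact: cvgr_idn. Qed.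

Let Q : probability W R := prodP (fun k => P (xn k)).
Let Y := Yp X xn.

(* [semigroup_entrance_cvg] holds along every increasing sequence. If the limit
   failed, alternating integers with points where [P_t g] is far from its limit
   along the integers would give a sequence without limit. *)
Lemma semigroup_cvg_infty g t : CEbar g -> 0 <= t ->
  semigroup P X t (fun y => g y%:E) r @[r --> +oo] -->
  fine (\int[Q]_w (g (Y t w))%:E)%E.
Proof.
move=> cg t0; set h := semigroup P X t (fun y => g y%:E).
set l := fine _; apply: contrapT => nh.
have [e e0 he] : exists2 e : R, 0 < e & forall K, exists2 r, K < r & e <= `|l - h r|.
  apply: contrapT => /forall2NP ne; apply: nh; apply/cvgrPdist_lt => e e0.
  have [//|] := ne e; move=> /existsNP[K hK].
  exists K; split; first exact: num_real.
  move=> r Kr; rewrite ltNge; apply/negP => er.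
  by apply: hK; exists r.
have he' K : exists r, K < r /\ e <= `|l - h r|.
  by have [r Kr er] := he K; exists r.
have [bad badP] := choice he'.
(* Both choices exceed [y + 1], so the sequence increases to infinity. For odd [m], [z m.+1] is an
   integer and [z m.+2] is a bad point, close to the same limit [l']. *)
pose nxt n (y : R) : R := if odd n then (Num.truncn (`|y| + 1)).+1%:R else bad (y + 1).
pose fix z n : R := if n is m.+1 then nxt m (z m) else 0.
have zS n : z n + 1 < z n.+1.
  rewrite /= /nxt; case: ifPn => _; last by case: (badP (z n + 1)).
  apply: (@le_lt_trans _ _ (`|z n| + 1)); first by rewrite lerD2r ler_norm.
  by have /andP[] := truncn_itv (addr_ge0 (normr_ge0 (z n)) ler01).
have zn n : n%:R <= z n.
  elim: n => // n ih; apply: ltW; apply: le_lt_trans (zS n).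
  by rewrite -natr1 lerD2r.
have zinc k : z k < z k.+1 by apply: le_lt_trans (zS k); rewrite lerDl.
have zoo : z n @[n --> \oo] --> +oo.
  apply/cvgryPge => A; near=> n; apply: le_trans (zn n).
  by near: n; exact: nbhs_infty_ger.
have e3 : 0 < e / 3 by rewrite divr_gt0.
have h1 := semigroup_entrance_cvg (lexx 0) zinc zoo cg t0.
have h2 := semigroup_entrance_cvg xn0 xninc xnoo cg t0.
rewrite -/h in h1 h2; set l' := fine _ in h1; rewrite -/l in h2.
move/cvgrPdist_lt : h1 => /(_ _ e3)[N1 _ hN1].
move/cvgrPdist_lt : h2 => /(_ _ e3)[N2 _ hN2].
pose m := (maxn N1 N2).*2.+1.
have mN1 : (N1 <= m.+1)%N by rewrite /m -addnn; lia.
have mN2 : (N2 <= m.+1)%N by rewrite /m -addnn; lia.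
have om : odd m by rewrite /= odd_double.
clearbody m.
have a1 : `|l' - h (z m.+1)| < e / 3 := hN1 m.+1 mN1.
have a2 : `|l' - h (z m.+2)| < e / 3 := hN1 m.+2 (leqW mN1).
have zint : z m.+1 = (Num.truncn (`|z m| + 1)).+1%:R by rewrite [LHS]/= /nxt om.
have a3 : `|l - h (z m.+1)| < e / 3.
  rewrite zint; apply: (hN2 (Num.truncn (`|z m| + 1)).+1) => /=.
  by rewrite -(ler_nat R) -zint (le_trans _ (zn m.+1))// ler_nat.
have zbad : z m.+2 = bad (z m.+1 + 1).
  by rewrite -[LHS]/(nxt m.+1 (z m.+1)) /nxt /= om.
have a4 : e <= `|l - h (z m.+2)| by rewrite zbad; case: (badP (z m.+1 + 1)).
have := ler_normD (l - h (z m.+1)) (h (z m.+1) - l').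
have := ler_normD (l - h (z m.+1) + (h (z m.+1) - l')) (l' - h (z m.+2)).
rewrite !addrA !subrK (distrC (h (z m.+1)) l') => b1 b2.
suff : `|l - h (z m.+2)| < e by move=> /(le_lt_trans a4); rewrite ltxx.
apply: (le_lt_trans (le_trans b1 (lerD b2 (lexx _)))).
exact: lt_thirds a3 a1 a2.
Unshelve. all: by end_near. Qed.


(** * The extended process on [[0, +oo]] *)

Let into_fin (v : Omega) : bool * W := (true, fun=> v).
Let into_inf (w : W) : bool * W := (false, w).

Let minto_fin : measurable_fun setT into_fin.
Proof.
by apply: measurable_fun_pair => //; exact: measurable_fun_path.
Qed.

Let minto_inf : measurable_fun setT into_inf.
Proof. by apply: measurable_fun_pair. Qed.

(* The boolean tells whether the process starts from a finite point, in which case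
   it is [X] read off coordinate [0]. The value at [-oo] is irrelevant. *)
Definition Qbar (y : \bar R) : probability (bool * W)%type R :=
  if y is r%:E then pushp minto_fin (P r) else pushp minto_inf Q.

Definition Ybar (t : R) (z : bool * W) : \bar R :=
  if z.1 then (X t (z.2 0%N))%:E else Y t z.2.

Lemma measurable_Ybar t : measurable_fun setT (Ybar t).
Proof.
apply: measurable_fun_ifT.
- exact: measurable_fst.
- apply/measurable_EFinP; apply: (measurableT_comp (mX t)).
  exact: (measurableT_comp (@measurable_coord nat _ Omega 0%N) measurable_snd).
- exact: (measurableT_comp (measurable_Yp mX Xc xn t) measurable_snd).
Qed.

Lemma Ybar_Ebar t z : 0 <= t -> Ebarset (Ybar t z).
Proof.
move=> t0; rewrite /Ybar; case: z.1; last exact: Yp_ge0.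
by rewrite /Ebarset/= lee_fin; exact: XE.
Qed.

Let integral_fin r (F : bool * W -> R) (M : R) : measurable_fun setT F ->
  (forall z, `|F z| <= M) ->
  (\int[Qbar r%:E]_z (F z)%:E = \int[P r]_v (F (into_fin v))%:E)%E.
Proof.
move=> mF FM.
rewrite -(integral_pushp minto_fin (m := P r) (g := fun z => (F z)%:E))//.
  exact/measurable_EFinP.
apply: (@bounded_integrable _ _ _ (P r) (F \o into_fin) M) => //.
  exact: measurableT_comp.
by move=> v; exact: FM.
Qed.

Let integral_inf (F : bool * W -> R) (M : R) : measurable_fun setT F ->
  (forall z, `|F z| <= M) ->
  (\int[Qbar +oo%E]_z (F z)%:E = \int[Q]_w (F (into_inf w))%:E)%E.
Proof.
move=> mF FM.
rewrite -(integral_pushp minto_inf (m := Q) (g := fun z => (F z)%:E))//.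
  exact/measurable_EFinP.
apply: (@bounded_integrable _ _ _ Q (F \o into_inf) M) => //.
  exact: measurableT_comp.
by move=> w; exact: FM.
Qed.

Let gYbar g t : CEbar g -> 0 <= t ->
  measurable_fun setT (fun z => g (Ybar t z)) /\
  exists M, forall z, `|g (Ybar t z)| <= M.
Proof.
move=> cg t0; split.
  by apply: measurable_CEbar => // [|z]; [exact: measurable_Ybar|exact: Ybar_Ebar].
by have [M hM] := CEbar_bounded cg; exists M => z; apply: hM; exact: Ybar_Ebar.
Qed.

Lemma semigroup_Qbar_fin g t r : CEbar g -> 0 <= t ->
  semigroup Qbar Ybar t g r%:E = semigroup P X t (fun y => g y%:E) r.
Proof.
move=> cg t0; have [m [M hM]] := gYbar cg t0.
by rewrite /semigroup (integral_fin r m hM).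
Qed.

Lemma semigroup_Qbar_infty g t : CEbar g -> 0 <= t ->
  semigroup Qbar Ybar t g +oo%E = fine (\int[Q]_w (g (Y t w))%:E)%E.
Proof.
move=> cg t0; have [m [M hM]] := gYbar cg t0.
by rewrite /semigroup (integral_inf m hM).
Qed.

(** Continuity on [E] is hypothesis (i); continuity at infinity is [semigroup_cvg_infty]. *)
Lemma semigroup_Qbar_CEbar g t : CEbar g -> 0 <= t ->
  CEbar (semigroup Qbar Ybar t g).
Proof.
move=> cg t0; apply: CEbar_intro.
  rewrite (_ : (fun r => _) = semigroup P X t (fun y => g y%:E)).
    by apply: Xi => //; exact: CEbar_CbE.
  by apply/funext => r; exact: semigroup_Qbar_fin.
rewrite semigroup_Qbar_infty//.
under eq_fun do rewrite semigroup_Qbar_fin//.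
exact: semigroup_cvg_infty.
Qed.

Lemma iter_Qbar_CEbar s : goodE s -> CEbar (iter_sg (semigroup Qbar Ybar) s).
Proof.
elim: s => [|[dt f] s ih]; first by move=> _; exact: CEbar_cst.
move=> /goodE_cons[[/= dt0 cf] gs]; apply: semigroup_Qbar_CEbar => //.
by apply: CEbarM => //; exact: ih.
Qed.

Lemma iter_Qbar_fin s r : goodE s ->
  iter_sg (semigroup Qbar Ybar) s r%:E = iter_sg (semigroup P X) (lift_seq s) r.
Proof.
elim: s r => // -[dt f] s ih r /goodE_cons[[/= dt0 cf] gs].
rewrite semigroup_Qbar_fin//.
  by congr semigroup; apply/funext => y; rewrite ih.
by apply: CEbarM => //; exact: iter_Qbar_CEbar.
Qed.

Let fdd_lift s t v : fdd_prod Ybar s t (into_fin v) = fdd_prod X (lift_seq s) t v.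
Proof. by elim: s t => // -[dt f] s ih t /=; rewrite ih. Qed.

Let fdd_inf s t w : fdd_prod Ybar s t (into_inf w) = fdd_prod Y s t w.
Proof. by elim: s t => // -[dt f] s ih t /=; rewrite ih. Qed.

(** At infinity both sides are limits of the same numbers, taken from integer starting points: the
    expectation by [fdd_entrance_cvg], the iterated semigroup because it belongs to [CEbar], that
    is, by the Feller property. *)
Lemma markov_Qbar : markov_fdd Ebarset CEbar Qbar Ybar.
Proof.
move=> y Ey s gs.
have [m [M hM]] := measurable_fddE gs (lexx 0) measurable_Ybar Ybar_Ebar.
case: y Ey => [r| |]// Ey.
  rewrite iter_Qbar_fin// (integral_fin r m hM).
  under eq_integral do rewrite fdd_lift.
  apply: XM; first by move: Ey; rewrite /Ebarset/= lee_fin.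
  exact: goodl_lift.
rewrite (integral_inf m hM); under eq_integral do rewrite fdd_inf.
have h1 := fdd_entrance_cvg xn0 xninc xnoo gs.
have fin : (\int[Q]_w (fdd_prod Y s 0 w)%:E)%E \is a fin_num.
  apply: (@integral_bounded_fin_num _ _ _ Q (fdd_prod Y s 0) M).
    have EY t w : 0 <= t -> Ebarset (Y t w) by exact: Yp_ge0.
    by have [] := measurable_fddE gs (lexx 0) (measurable_Yp mX Xc xn) EY.
  by move=> w; rewrite -fdd_inf.
have h2 : iter_sg (semigroup Qbar Ybar) s (xn N)%:E @[N --> \oo] -->
    iter_sg (semigroup Qbar Ybar) s +oo%E.
  apply: (CEbar_cvg (u := fun N => (xn N)%:E)) => //.
  - exact: iter_Qbar_CEbar.
  - by apply: nearW => N; rewrite /Ebarset/= lee_fin /xn.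
  - exact/cvgeryP.
have {}h1 : iter_sg (semigroup Qbar Ybar) s (xn N)%:E @[N --> \oo] -->
    fine (\int[Q]_w (fdd_prod Y s 0 w)%:E)%E.
  move: h1; rewrite -{1}(fineK fin) => /fine_cvg; apply: cvg_trans.
  apply: near_eq_cvg; apply: nearW => N /=.
  rewrite iter_Qbar_fin// (markov_eint mX XE XM)//; last exact: goodl_lift.
  by rewrite /Eset/= /xn.
by rewrite -(cvg_lim _ h1)// -(cvg_lim _ h2).
Qed.

(** At infinity, almost every path starts there and is right-continuous at zero in the extended
    topology, so bounded convergence along sequences applies. *)
Lemma semigroup_Qbar_right g y : CEbar g -> Ebarset y ->
  semigroup Qbar Ybar t g y @[t --> 0^'+] --> g y.
Proof.
move=> cg; case: y => [r| |]// Ey.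
  have Er : Eset r by move: Ey; rewrite /Ebarset/= lee_fin.
  apply: cvg_trans (Xii (CEbar_CbE cg) Er); apply: near_eq_cvg; near=> t.
  by rewrite semigroup_Qbar_fin//; near: t; exact: nbhs_right_ge.
apply/cvg_at_rightP => u [u0 ucvg].
have mY t : measurable_fun setT (Y t) := measurable_Yp mX Xc xn t.
have EY t w : 0 <= t -> Ebarset (Y t w) by exact: Yp_ge0.
have [M hM] := CEbar_bounded cg.
have mg := @measurable_good_paths _ _ _ X mX Xc xn.
have Qg : Q (good_paths X xn) = 1%E by exact: Q_good_paths.
have Q1 : (\int[Q]_w (g (Y 0 w))%:E)%E = (g +oo%E)%:E.
  transitivity (\int[Q]_w (cst (g +oo%E) w)%:E)%E.
    apply: (eq_integral_ae mg Qg) => //.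
      by apply: measurable_CEbar => // w; exact: EY.
    by move=> w gw; rewrite /= /Y (Yp0 Xc xninc xnoo gw).
  rewrite -[LHS]/(\int[Q]_w (cst (g +oo%E)%:E w))%E integral_cst//.
  by rewrite [X in (_ * X)%E](probability_setT Q) mule1.
have : (\int[Q]_w (g (Y (u n) w))%:E)%E @[n --> \oo] --> (g +oo%E)%:E.
  rewrite -Q1; apply: (@bounded_convergence _ _ _ Q (fun n w => g (Y (u n) w))
    (fun w => g (Y 0 w)) M).
  - by move=> n; apply: measurable_CEbar => // w; apply: EY; exact: ltW.
  - by apply: measurable_CEbar => // w; exact: EY.
  - exists (good_paths X xn); split => // w gw.
    apply: (CEbar_cvg (u := fun n => Y (u n) w)) => //.
    + exact: EY.
    + by apply: nearW => n; apply: EY; exact: ltW.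
    + have [rc _] := cadlag_Yp Xc xninc xnoo gw.
      exact: (cvg_right_seq (rc 0 (lexx 0)) u0 ucvg).
  - by move=> n w; apply: hM; apply: EY; exact: ltW.
move=> /fine_cvg; apply: cvg_trans; apply: near_eq_cvg; apply: nearW => n /=.
by rewrite semigroup_Qbar_infty// ltW.
Unshelve. all: by end_near. Qed.

Let mtrue : measurable [set z : bool * W | z.1].
Proof.
by rewrite -[X in measurable X]setTI;
  exact: (@measurable_fst _ _ bool W measurableT [set true]).
Qed.

Let inf_good : set (bool * W) := [set z | ~~ z.1] `&` [set z | good_paths X xn z.2].

Let minf_good : measurable inf_good.
Proof.
apply: measurableI.
  rewrite (_ : [set z | _] = ~` [set z : bool * W | z.1]); first exact: measurableC.
  by apply/seteqP; split => z /= /negP.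
rewrite -[X in measurable X]setTI.
apply: (@measurable_snd _ _ bool W measurableT (good_paths X xn)).
exact: measurable_good_paths.
Qed.

Let Qinf_good : Qbar +oo%E inf_good = 1%E.
Proof.
rewrite -[LHS]/(Q (into_inf @^-1` inf_good)) (_ : _ @^-1` _ = good_paths X xn);
  first exact: Q_good_paths.
by apply/seteqP; split => [w []//|w gw].
Qed.

Lemma cadlag_Ybar y : Ebarset y -> exists A, [/\ measurable A, Qbar y A = 1%E &
  forall z, A z -> cadlag (fun t => Ybar t z)].
Proof.
case: y => [r| |]// _.
  exists [set z : bool * W | z.1]; split => //.
    rewrite -[LHS]/(P r (into_fin @^-1` _)) (_ : _ @^-1` _ = setT);
      first exact: probability_setT.
    by apply/seteqP; split.
  move=> [[] w]// _; have [rc lc] := Xc (w 0%N); split => t t0.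
    by apply: cvg_EFin; [exact: nearW|exact: rc].
  have [l hl] := lc t t0; exists l%:E.
  by apply: cvg_EFin; [exact: nearW|exact: hl].
exists inf_good; split => //.
by move=> [[] w] [//= _ gw]; exact: (cadlag_Yp Xc xninc xnoo gw).
Qed.

Lemma Ybar0 y : Ebarset y -> Qbar y [set z | Ybar 0 z = y] = 1%E.
Proof.
have m1 y' : measurable [set z | Ybar 0 z = y'].
  rewrite (_ : [set z | _] = Ybar 0 @^-1` [set y'])//.
  by rewrite -[X in measurable X]setTI; exact: measurable_Ybar.
case: y => [r| |]// Ey.
  rewrite -[LHS]/(P r (into_fin @^-1` _)) (_ : _ @^-1` _ = [set w | X 0 w = r]).
    by apply: X0; move: Ey; rewrite /Ebarset/= lee_fin.
  by apply/seteqP; split => w; [move=> -[]|rewrite /Ybar /= => ->].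
apply/eqP; rewrite eq_le probability_le1//= -Qinf_good.
apply: le_measure; rewrite ?inE//.
by move=> [[] w] [//= _ gw]; exact: (Yp0 Xc xninc xnoo gw).
Qed.

Lemma Ybar_lty : exists A, [/\ measurable A, Qbar +oo%E A = 1%E &
  forall z, A z -> forall t, 0 < t -> (Ybar t z < +oo)%E].
Proof.
exists inf_good; split => //.
by move=> [[] w] [//= _ gw] t t0; exact: (Yp_lty Xc xninc gw).
Qed.

End feller_extension.

Theorem theorem1 (R : realType) (d : measure_display) (Omega : measurableType d)
  (P : R -> probability Omega R) (X : R -> Omega -> R) :
  (* X is a process with values in E = [0,oo) (hence non-explosive),
     cadlag paths and no negative jumps *)
  (forall t, measurable_fun setT (X t)) ->
  (forall t w, 0 <= t -> Eset (X t w)) ->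
  (forall w, cadlag (fun t => X t w)) ->
  (forall w, no_neg_jumps (fun t => X t w)) ->
  (* started from x under P x, time-homogeneous Markov with semigroup P_t *)
  (forall x, Eset x -> P x [set w | X 0 w = x] = 1%E) ->
  markov_fdd Eset CbE P X ->
  (* (i) *)
  (forall f t, CbE f -> 0 <= t -> CbE (semigroup P X t f)) ->
  (* (ii) *)
  (forall f x, CbE f -> Eset x ->
     semigroup P X t f x @[t --> 0^'+] --> f x) ->
  (* entrance boundary condition *)
  (forall t : R, 0 < t ->
     limf_einf (fun x => P x [set w | (hit_below X b w <= t%:E)%E])
               (pinfty_nbhs R) @[b --> +oo] --> 1%E) ->
  (* conclusion: a Feller extension on Ebar *)
  exists (d' : measure_display) (Omega' : measurableType d')
         (Q : \bar R -> probability Omega' R) (Y : R -> Omega' -> \bar R),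
    (forall t, measurable_fun setT (Y t)) /\
    (forall t w, 0 <= t -> Ebarset (Y t w)) /\
    (forall x, Ebarset x -> exists A, [/\ measurable A, Q x A = 1%E &
         forall w, A w -> cadlag (fun t => Y t w)]) /\
    (forall x, Ebarset x -> Q x [set w | Y 0 w = x] = 1%E) /\
    markov_fdd Ebarset CEbar Q Y /\
        (* extension: on E the semigroup of Y is that of X *)
        (forall g t x, CEbar g -> 0 <= t -> Eset x ->
           semigroup Q Y t g x%:E = semigroup P X t (fun y => g y%:E) x) /\
        (* Feller on Ebar *)
        (forall g t, CEbar g -> 0 <= t -> CEbar (semigroup Q Y t g)) /\
        (forall g x, CEbar g -> Ebarset x ->
           semigroup Q Y t g x @[t --> 0^'+] --> g x) /\
        (* started at oo: X_0 = oo a.s. and X_t < oo for all t > 0 a.s. *)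
        Q +oo%E [set w | Y 0 w = +oo%E] = 1%E /\
        exists A, [/\ measurable A, Q +oo%E A = 1%E &
           forall w, A w -> forall t, 0 < t -> (Y t w < +oo)%E].
Proof.
move=> mX XE Xc Xj X0 XM Xi Xii Xe.
exists _, (bool * pathType nat Omega)%type, (Qbar P), (Ybar X).
split; first exact: measurable_Ybar.
split; first exact: Ybar_Ebar.
split; first exact: (cadlag_Ybar mX XE Xc Xj X0 XM Xi Xe).
split; first exact: (Ybar0 mX XE Xc Xj X0 XM Xi Xe).
split; first exact: (markov_Qbar mX XE Xc Xj X0 XM Xi Xe).
split; first by move=> g t x cg t0 _; exact: (semigroup_Qbar_fin P mX XE Xc x cg t0).
split; first exact: (semigroup_Qbar_CEbar mX XE Xc Xj X0 XM Xi Xe).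
split; first exact: (semigroup_Qbar_right mX XE Xc Xj X0 XM Xi Xii Xe).
split; last exact: (Ybar_lty mX XE Xc Xj X0 XM Xi Xe).
by apply: (Ybar0 mX XE Xc Xj X0 XM Xi Xe); rewrite /Ebarset/= leey.
Qed.
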